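(* Assume that, in the classical risk model, the claim amounts are mixtures of gamma random variables, that is, their common distribution function is $$F_X(u)=\sum_{i=1}^n p_iF_{\alpha_i,\beta_i}(u),$$ where $F_{\alpha_i,\beta_i}$ is the distribution function with density $f_{\alpha_i,\beta_i}(u)=\frac{1}{\Gamma(\alpha_i)}\beta_i^{\alpha_i}u^{\alpha_i-1}e^{-\beta_iu}$, $u\ge 0$ ($\beta_i>0$), $p_i>0$ and $p_1+\dots+p_n=1$. Assume that $\alpha_i\ge 1$ for $i=1,\dots,n$. Then the ruin probability $\psi$ satisfies $\psi\in\mathcal D_1$. Therefore, the approximation $M_t^{[2]}\psi$, $t>0$, has uniform order of convergence $1/t^2$, that is, for all $t>0$, $$\|M_t^{[2]}\psi-\psi\|\le\frac{1}{8t^2}\|\psi''(u)\|+\frac{1}{6t^2}\|u\,\psi'''(u)\|+\frac{9}{16t^2}\|u^2\psi^{iv}(u)\|<\infty.$$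
   Context: Classical risk model: claims arrive according to a Poisson process $(N(t),\ t\ge 0)$ with intensity $\lambda>0$; the claim amounts $X_1,X_2,\dots$ are i.i.d. positive random variables with distribution function $F_X$ and finite mean $\mu=EX_1>0$, independent of $N$; premiums are received at constant rate $c>0$, and it is assumed that $\phi:=\lambda\mu/c<1$. The ruin probability with initial capital $u\ge 0$ is $$\psi(u)=P\Big(\inf_{t\ge 0}\Big(u+ct-\sum_{i=1}^{N(t)}X_i\Big)<0\Big).$$ It is known that $\psi$ is the locally bounded solution of $\psi(u)=\phi\big(\int_0^u\psi(u-y)\frac{\bar F_X(y)}{\mu}dy+\int_u^\infty\frac{\bar F_X(y)}{\mu}dy\big)$, $u\ge 0$, with $\bar F_X=1-F_X$. $C^4([0,\infty))$ is the class of continuous functions on $[0,\infty)$ with continuous fourth derivative on $(0,\infty)$. $\|\cdot\|$ denotes the supremum norm (over $(0,\infty)$ for expressions involving derivatives defined only there). $\mathcal D_1:=\{g\in C^4([0,\infty)):\ \|g''(u)\|<\infty \text{ and } \|u^2g^{iv}(u)\|<\infty\}$. Operators: for $g\in C([0,\infty))$ with $|g(u)|=O(e^{\gamma u})$ as $u\to\infty$ for some $\gamma\ge 0$, and $t>\gamma$, let $\tilde g(t)=\int_0^\infty e^{-tu}g(u)\,du$ and $$L_t^*g(u)=\frac{(-1)^{[tu]}t^{[tu]+1}}{\Gamma([tu]+1)}\tilde g^{([tu])}(t)=E\,g\!\left(\frac{S([tu]+1)}{t}\right),\quad u\ge 0,$$ where $[x]$ is the integer part of $x$ and $S(r)$ is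 a gamma random variable with shape $r$ and scale $1$. Then $M_t^{[2]}g(0)=g(0)$, $$M_t^{[2]}g\!\left(\frac kt\right)=2L_{2t}^*g\!\left(\frac{2k-1}{2t}\right)-L_t^*g\!\left(\frac{k-1}{t}\right),\quad k=1,2,\dots,$$ and for $u>0$ not of the form $k/t$, $k=1,2,\dots$, $$M_t^{[2]}g(u)=(tu-[tu])\,M_t^{[2]}g\!\left(\frac{[tu]+1}{t}\right)+([tu]+1-tu)\,M_t^{[2]}g\!\left(\frac{[tu]}{t}\right).$$ *)

(* Defs.v *)
From mathcomp Require Import all_boot all_order all_algebra.
From mathcomp Require Import finmap.
From mathcomp Require Import all_classical all_reals all_analysis.

Set Implicit Arguments.
Unset Strict Implicit.
Unset Printing Implicit Defensive.

Import Order.TTheory GRing.Theory Num.Theory.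
Import numFieldNormedType.Exports.

Local Open Scope classical_set_scope.
Local Open Scope ring_scope.

Definition mutually_independent (d d' : measure_display) (T : measurableType d)
    (T' : measurableType d') (R : realType) (P : probability T R)
    (I : choiceType) (Y : I -> T -> T') : Prop :=
  forall (J : {fset I}) (B : I -> set T'), (forall i, measurable (B i)) ->
    P (\bigcap_(i in [set` J]) (Y i @^-1` B i)) =
    (\prod_(i <- J) P (Y i @^-1` B i))%E.

(* The sigma-algebra generated by the family (Y i), i in D. *)
Definition sigma_family (d d' : measure_display) (T : measurableType d)
    (T' : measurableType d') (I : Type) (D : set I) (Y : I -> T -> T') :
    set (set T) :=
  <<s \bigcup_(i in D) preimage_set_system [set: T] (Y i) measurable >>.

Definition independent_sigma (d : measure_display) (T : measurableType d)
    (R : realType) (P : probability T R) (F G : set (set T)) : Prop :=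
  forall A B, F A -> G B -> P (A `&` B) = (P A * P B)%E.

(* N s is only constrained for s >= 0.  Since paths are nondecreasing, the
   truncated subtraction (N t w - N s w)%N is the actual increment. *)
Record poisson_process (d : measure_display) (T : measurableType d)
    (R : realType) (P : probability T R) (lambda : R)
    (N : R -> {RV P >-> nat}) : Prop := PoissonProcess {
  poisson_start : forall w, N 0 w = 0%N ;
  poisson_nondecreasing : forall w s t, 0 <= s -> s <= t ->
    (N s w <= N t w)%N ;
  poisson_right_continuous : forall w s, 0 <= s ->
    \forall t \near s^'+, N t w = N s w ;
  poisson_increment : forall s t k, 0 <= s -> s < t ->
    P [set w | (N t w - N s w)%N = k] =
    (poisson_pmf (lambda * (t - s)) k)%:E ;
  poisson_independent_increments : forall tau : nat -> R,
    0 <= tau 0%N -> {homo tau : i j / (i <= j)%N >-> i <= j} ->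
    mutually_independent P (fun k w => (N (tau k.+1) w - N (tau k) w)%N)
}.

(* The claim amounts X_1, X_2, ... are X 0, X 1, ... *)
Record classical_risk_model (d : measure_display) (T : measurableType d)
    (R : realType) (P : probability T R) (lambda c mu : R) (FX : R -> R)
    (N : R -> {RV P >-> nat}) (X : nat -> {RV P >-> R}) : Prop :=
  ClassicalRiskModel {
  risk_lambda_gt0 : 0 < lambda ;
  risk_c_gt0 : 0 < c ;
  risk_poisson : poisson_process lambda N ;
  risk_claims_pos : forall i, \forall w \ae P, 0 < X i w ;
  risk_claims_cdf : forall i u, cdf (X i) u = (FX u)%:E ;
  risk_claims_indep : mutually_independent P (fun i => X i : T -> R) ;
  risk_claims_mean : ('E_P[X 0%N] = mu%:E)%E ;
  risk_mu_gt0 : 0 < mu ;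
  risk_indep_arrivals_claims : independent_sigma P
    (sigma_family `[0, +oo[ (fun t => N t : T -> nat))
    (sigma_family [set: nat] (fun i => X i : T -> R)) ;
  risk_net_profit : lambda * mu / c < 1
}.

Definition surplus (T : Type) (R : realType) (c : R) (N : R -> T -> nat)
    (X : nat -> T -> R) (u t : R) (w : T) : R :=
  u + c * t - \sum_(i < N t w) X i w.

Definition ruin_probability (d : measure_display) (T : measurableType d)
    (R : realType) (P : probability T R) (c : R)
    (N : R -> {RV P >-> nat}) (X : nat -> {RV P >-> R}) (u : R) : R :=
  fine (P [set w |
    (ereal_inf [set (surplus c N X u t w)%:E | t in `[0%R, +oo[] < 0)%E]).

Definition Gamma (R : realType) (a : R) : R :=
  \int[lebesgue_measure]_(x in `]0, +oo[) (x `^ (a - 1) * expR (- x)).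

Definition gamma_pdf (R : realType) (a b u : R) : R :=
  (Gamma a)^-1 * b `^ a * u `^ (a - 1) * expR (- (b * u)).

Definition gamma_cdf (R : realType) (a b u : R) : R :=
  \int[lebesgue_measure]_(x in `[0, u]) gamma_pdf a b x.

Definition supnorm (R : realType) (D : set R) (f : R -> R) : \bar R :=
  ereal_sup [set `|f u|%:E | u in D].

Definition C4 (R : realType) (g : R -> R) : Prop :=
  [/\ {within `[0, +oo[, continuous g},
      forall k u, (k < 4)%N -> 0 < u -> derivable (g^`(k)%classic) u 1 &
      {within `]0, +oo[, continuous (g^`(4)%classic)}].

Definition class_D1 (R : realType) (g : R -> R) : Prop :=
  [/\ C4 g,
      (supnorm `]0%R, +oo[ (g^`(2)%classic) < +oo)%E &
      (supnorm `]0%R, +oo[ (fun u => (u ^+ 2 * g^`(4)%classic u)%R) < +oo)%E].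

Definition laplace (R : realType) (g : R -> R) (t : R) : R :=
  \int[lebesgue_measure]_(u in `[0, +oo[) (expR (- (t * u)) * g u).

Definition Lstar (R : realType) (t : R) (g : R -> R) (u : R) : R :=
  let n := Num.truncn (t * u) in
  (-1) ^+ n * t ^+ n.+1 / Gamma (n.+1%:R : R) * (laplace g)^`(n)%classic t.

(* The value of M_t^[2] g at the node k / t. *)
Definition M2_node (R : realType) (t : R) (g : R -> R) (k : nat) : R :=
  if k == 0%N then g 0 else
    2 * Lstar (2 * t) g ((2 * k%:R - 1) / (2 * t))
    - Lstar t g ((k%:R - 1) / t).

(* When t * u is an integer k, the first coefficient vanishes, the second is 1
   and the value is M2_node t g k, so nodes need no separate case. *)
Definition M2 (R : realType) (t : R) (g : R -> R) (u : R) : R :=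
  let k := Num.truncn (t * u) in
  (t * u - k%:R) * M2_node t g k.+1 + (k.+1%:R - t * u) * M2_node t g k.

(* Main.v *)
(* Sampling the surplus on the grid of mesh [l / 2 ^ m] and conditioning on the
   first cell gives, in the limit, the renewal equation for the survival
   probability D on [0, oo[:
     D u = D 0 + (lambda / c) * \int_0^u (1 - FX (u - s)) * D s ds.
   For a mixture of gamma laws with shapes at least 1 the density of FX is
   continuous, and the u^k-weighted (k+1)-st derivatives of the kernel decay
   exponentially.  Because lambda * mu / c < 1 this passes through the renewal
   equation to D', D'', u D''' and u^2 D'''', so psi = 1 - D is in D_1.

   At a node x = k / t, M_t^[2] psi = 2 E psi (S(2k) / 2t) - E psi (S(k) / t).
   In the third-order Taylor expansion at x the second moments cancel and the
   third leaves -x psi''' / (6 t^2).  If u^2 |psi''''| <= B, the remainder is at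
   most B times that of -u^2 ln u / 2 (whose fourth derivative is 1 / u^2),
   which a quartic polynomial dominates.  Between nodes linear interpolation
   costs |psi''| / (8 t^2). *)
From HB Require Import structures.
Require Import Defs.
From mathcomp Require Import all_boot all_order all_algebra.
From mathcomp Require Import finmap ring lra.
From mathcomp Require Import all_classical all_reals all_analysis.
From mathcomp Require Import measurable_realfun.

Set Implicit Arguments.
Unset Strict Implicit.
Unset Printing Implicit Defensive.

Import Order.TTheory GRing.Theory Num.Theory.
Import numFieldNormedType.Exports.

Local Open Scope classical_set_scope.
Local Open Scope ring_scope.

(** The infimum defining ruin runs over all times, so the renewal equation has to be derived from
    the paths. The grid is built on a fixed horizon [l], which is then exactly [2 ^ m] cells. On it,
    no ruin means that the maximal loss of a random walk stays below the capital, and the law of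
    that loss does not depend on the starting cell; this replaces a Markov property. Two or more
    claims in a cell cost O(mesh^2), hence O(mesh) over the horizon. For one claim the law of claim
    plus later loss enters only through its integral over [[0, l]], which is a convolution with the
    distribution function itself.

    For a shape in ]1, 2[ the derivative of the claim density is unbounded at 0 and its second
    derivative is not integrable there. Derivatives are therefore recovered from integrals, and the
    last differentiation is moved from the kernel to the solution.

    The quartic dominating the remainder of the logarithm has a free parameter [e]. The choice
    [e = 0] would give the factor 1 instead of 9/16 at the first node, while a fixed positive [e]
    gives an unbounded factor at large nodes. *)

Section cvg_bounds.
Context (R : realType).
Implicit Types (u v : nat -> R) (l k M : R).

Lemma cvgn_ge u l M : u @ \oo --> l -> (forall n, M <= u n) -> M <= l.
Proof. by move=> ul uM; apply: (cvgr_to_ge ul); exact: nearW. Qed.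

Lemma cvgn_le u l M : u @ \oo --> l -> (forall n, u n <= M) -> l <= M.
Proof. by move=> ul uM; apply: (cvgr_to_le ul); exact: nearW. Qed.

Lemma cvgn_homo u v l k : u @ \oo --> l -> v @ \oo --> k ->
  (forall n, u n <= v n) -> l <= k.
Proof. by move=> ul vk uv; apply: (ler_cvg_to ul vk); exact: nearW. Qed.

End cvg_bounds.

(** * Integrals over compact intervals *)

Section Rintegral_itv.
Context (R : realType).
Local Notation mu := (@lebesgue_measure R).
Implicit Types (f g : R -> R) (a b c M : R).

Lemma itv_bounded_integrable a b f M :
  measurable_fun `[a, b] f -> (forall x, a <= x <= b -> `|f x| <= M) ->
  mu.-integrable `[a, b] (EFin \o f).
Proof.
move=> mf fM; apply: measurable_bounded_integrable => //=.
  by rewrite lebesgue_measure_itv/=; case: ifP => // _; rewrite -EFinB ltry.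
exists M; split => [|N MN x /=]; first exact: num_real.
by rewrite in_itv/= => /fM h; exact: le_trans h (ltW MN).
Qed.

Lemma itv_continuous_integrable a b f :
  {within `[a, b], continuous f} -> mu.-integrable `[a, b] (EFin \o f).
Proof. by move=> cf; apply: continuous_compact_integrable => //; exact: segment_compact. Qed.

Lemma Rintegral_itv_split a b c f : a <= c -> c <= b ->
  mu.-integrable `[a, b] (EFin \o f) ->
  \int[mu]_(x in `[a, b]) f x =
  \int[mu]_(x in `[a, c]) f x + \int[mu]_(x in `[c, b]) f x.
Proof.
move=> ac cb fi; have := @Rintegral_itvB _ f (BLeft a) (BRight b) c fi.
rewrite !bnd_simp => /(_ ac cb) /eqP; rewrite subr_eq => /eqP ->.
rewrite addrC Rintegral_itv_obnd_cbnd//.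
by apply: integrableS fi => //; apply: subset_itvr; rewrite bnd_simp.
Qed.

Lemma Rintegral_itv_cst a b M : a <= b -> \int[mu]_(_ in `[a, b]) M = M * (b - a).
Proof.
move=> ab; rewrite Rintegral_cst//= lebesgue_measure_itv/= lte_fin.
by case: ltgtP ab => //= ->; rewrite ?subrr ?mulr0.
Qed.

Lemma Rintegral_itv_le a b f M : a <= b ->
  mu.-integrable `[a, b] (EFin \o f) -> (forall x, a <= x <= b -> f x <= M) ->
  \int[mu]_(x in `[a, b]) f x <= M * (b - a).
Proof.
move=> ab fi fM; rewrite -Rintegral_itv_cst//; apply: le_Rintegral => //.
by apply: (@itv_bounded_integrable _ _ _ `|M|).
Qed.

Lemma Rintegral_itv_ge a b f M : a <= b ->
  mu.-integrable `[a, b] (EFin \o f) -> (forall x, a <= x <= b -> M <= f x) ->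
  M * (b - a) <= \int[mu]_(x in `[a, b]) f x.
Proof.
move=> ab fi fM; rewrite -Rintegral_itv_cst//; apply: le_Rintegral => //.
by apply: (@itv_bounded_integrable _ _ _ `|M|).
Qed.

Lemma Rintegral_dominated (d : measure_display) (T : measurableType d)
    (nu : {measure set T -> \bar R}) (D : set T) (f_ : nat -> T -> R)
    (f g : T -> R) :
  measurable D -> (forall n, measurable_fun D (f_ n)) ->
  (forall x, D x -> f_ ^~ x @ \oo --> f x) ->
  nu.-integrable D (EFin \o g) -> (forall n x, D x -> `|f_ n x| <= g x) ->
  nu.-integrable D (EFin \o f) /\
  (fun n => \int[nu]_(x in D) f_ n x) @ \oo --> \int[nu]_(x in D) f x.
Proof.
move=> mD mf f_f ig f_g.
have [|||||fi _ cvg_f] := @dominated_convergence _ _ _ nu D mD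
  (fun n => EFin \o f_ n) (EFin \o f) (EFin \o g).
- by move=> n; exact/measurable_EFinP.
- by apply/measurable_EFinP; exact: (measurable_fun_cvg mf f_f).
- by apply: aeW => x Dx; apply: cvg_EFin; [exact: nearW|exact: f_f].
- exact: ig.
- by apply: aeW => x n Dx /=; rewrite lee_fin; exact: f_g.
split => //; apply: fine_cvg; rewrite fineK; first exact: cvg_f.
exact: integrable_fin_num.
Qed.

Lemma Rintegral_itv_dominated a b (f_ : nat -> R -> R) f M :
  (forall n, measurable_fun `[a, b] (f_ n)) ->
  (forall x, a <= x <= b -> f_ ^~ x @ \oo --> f x) ->
  (forall n x, a <= x <= b -> `|f_ n x| <= M) ->
  (fun n => \int[mu]_(x in `[a, b]) f_ n x) @ \oo --> \int[mu]_(x in `[a, b]) f x.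
Proof.
move=> mf f_f fM.
apply: (proj2 (@Rintegral_dominated _ _ mu `[a, b] f_ f (fun=> `|M|) _ _ _ _ _)) => // [|n x].
  by apply: (@itv_bounded_integrable _ _ _ `|M|) => // x _; rewrite normr_id.
by rewrite /= in_itv/= => /(fM n) h; exact: le_trans h (ler_norm _).
Qed.

(** On each cell a monotone function lies between its end values, so the cell errors are at most [h]
    times the increments, and these telescope. Monotonicity is the only regularity known for the
    grid probabilities. *)
Lemma riemann_sum_monotone f (h : R) n : 0 < h ->
  {in `[0, n%:R * h] &, {homo f : x y / x <= y}} ->
  measurable_fun `[0, n%:R * h] f ->
  0 <= \sum_(j < n) h * f (j.+1%:R * h) - \int[mu]_(x in `[0, n%:R * h]) f x
    <= h * (f (n%:R * h) - f 0).
Proof.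
move=> h0; elim: n => [|n IH] fnd mf.
  rewrite big_ord0 mul0r set_itv1 Rintegral_set1 !subrr mulr0 lexx//.
have nh0 : 0 <= n%:R * h by rewrite mulr_ge0// ltW.
have nh1 : n%:R * h <= n.+1%:R * h by rewrite ler_pM2r// ler_nat.
have nS : n.+1%:R * h - n%:R * h = h by rewrite -natr1; ring.
have fi : mu.-integrable `[0, n.+1%:R * h] (EFin \o f).
  apply: (@itv_bounded_integrable _ _ _ (`|f 0| + `|f (n.+1%:R * h)|)) => // x /andP[x0 xn].
  have h1 : f 0 <= f x by apply: fnd; rewrite ?in_itv//= ?lexx/= ?x0 ?xn// (le_trans x0 xn).
  have h2 : f x <= f (n.+1%:R * h) by apply: fnd; rewrite ?in_itv//= ?lexx/= ?x0 ?xn// (le_trans x0 xn).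
  have := ler_norm (f (n.+1%:R * h)); have := ler_norm (- f 0); rewrite normrN.
  have := normr_ge0 (f 0); have := normr_ge0 (f (n.+1%:R * h)).
  by rewrite ler_norml; lra.
have {IH} /andP[] : 0 <= \sum_(j < n) h * f (j.+1%:R * h) - \int[mu]_(x in `[0, n%:R * h]) f x
    <= h * (f (n%:R * h) - f 0).
  apply: IH.
    by move=> x y; rewrite !in_itv/= => /andP[x0 xn] /andP[y0 yn]; apply: fnd;
      rewrite in_itv/= ?x0 ?y0/= ?(le_trans xn)// (le_trans yn).
  by apply: measurable_funS mf => //; apply: subset_itvl; rewrite bnd_simp.
rewrite big_ord_recr/= (Rintegral_itv_split nh0 nh1 fi).
have fi2 : mu.-integrable `[n%:R * h, n.+1%:R * h] (EFin \o f).
  by apply: integrableS fi => //; apply: subset_itvr; rewrite bnd_simp.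
have := @Rintegral_itv_le _ _ f (f (n.+1%:R * h)) nh1 fi2.
have := @Rintegral_itv_ge _ _ f (f (n%:R * h)) nh1 fi2.
rewrite nS => /(_ _) h1 /(_ _) h2.
have {}h1 : f (n%:R * h) * h <= \int[mu]_(x in `[n%:R * h, n.+1%:R * h]) f x.
  apply: h1 => x /andP[x0 xn]; apply: fnd; rewrite ?in_itv//= ?nh0 ?nh1// xn andbT.
  exact: le_trans x0.
have {}h2 : \int[mu]_(x in `[n%:R * h, n.+1%:R * h]) f x <= f (n.+1%:R * h) * h.
  apply: h2 => x /andP[x0 xn]; apply: fnd; rewrite ?in_itv//= ?xn ?lexx ?andbT//.
    exact: le_trans x0.
  exact: le_trans nh1.
by move=> h3 h4; apply/andP; split; lra.
Qed.

End Rintegral_itv.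

(** * Independence and laws *)

Section independence.
Context (d : measure_display) (T : measurableType d) (R : realType)
  (P : probability T R).

(** The events independent of the fixed event [E] form a Dynkin system. *)
Lemma indep_event_gen (E : set T) (G : set (set T)) :
  measurable E -> setI_closed G -> (forall A, G A -> measurable A) ->
  (forall A, G A -> P (E `&` A) = (P E * P A)%E) ->
  forall A, <<s G >> A -> P (E `&` A) = (P E * P A)%E.
Proof.
move=> mE GI Gm GE A; rewrite -setI_closed_g_dynkin_g_sigma_algebra// => sA.
suff : [set A | measurable A /\ P (E `&` A) = (P E * P A)%E] A by case.
apply: sA; split => /=; last by move=> B GB; split; [exact: Gm|exact: GE].
split => [|B [mB PB]|F tF mF] /=.
- by split => //; rewrite setIT probability_setT mule1.
- split; first exact: measurableC.
  rewrite -setDE measureD ?ltey_eq ?fin_num_measure//= PB probability_setC//.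
  by rewrite muleBr ?mule1 ?fin_num_measure// fin_num_adde_defl// fin_num_measure.
- split; first by apply: bigcup_measurable => k _; case: (mF k).
  rewrite setI_bigcupr measure_bigcup//; last 2 first.
    + by move=> i _; apply: measurableI => //; case: (mF i).
    + by apply: trivIset_setIl.
  rewrite measure_bigcup//; last by move=> i _; case: (mF i).
  rewrite -(fineK (fin_num_measure P E mE)) -nneseriesZl//; apply: eq_eseriesr => i _.
  by rewrite fineK ?fin_num_measure//; case: (mF i).
Qed.

Context (d' : measure_display) (S : measurableType d').

(** Coordinate [a] is excluded by [B a = setT] rather than by removing it from [J]; intersections
    are then formed with the union of the index sets. *)
Definition cylinders_off (Y : nat -> T -> S) (a : nat) : set (set T) :=
  [set C | exists (J : {fset nat}) (B : nat -> set S),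
    [/\ forall i, measurable (B i), B a = setT &
        C = \bigcap_(i in [set` J]) (Y i @^-1` B i)]].

Lemma cylinders_offI (Y : nat -> T -> S) a : setI_closed (cylinders_off Y a).
Proof.
move=> _ _ [J1 [B1 [mB1 B1a ->]]] [J2 [B2 [mB2 B2a ->]]].
exists (J1 `|` J2)%fset.
exists (fun i => (if i \in J1 then B1 i else setT) `&`
                 (if i \in J2 then B2 i else setT)).
split.
- by move=> i; apply: measurableI; case: ifP.
- by rewrite B1a B2a !if_same setIT.
- apply/seteqP; split => w /=.
    move=> [h1 h2] i /=; rewrite inE => /orP iJ; split.
      by case: ifPn => // i1; exact: h1.
    by case: ifPn => // i2; exact: h2.
  move=> h; split => i /= iJ; have /= := h i; rewrite inE iJ ?orbT => /(_ isT).
    by case.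
  by case.
Qed.

(** The product formula is applied with slot [a] filled by [E]; filling the slot with the full set
    identifies the remaining product with [P C]. *)
Lemma mutually_independent_off (Y : nat -> T -> S) a (E : set S) C :
  mutually_independent P Y -> measurable E -> cylinders_off Y a C ->
  P (Y a @^-1` E `&` C) = (P (Y a @^-1` E) * P C)%E.
Proof.
move=> iY mE [J [B [mB Ba ->]]].
pose J' := (a |` J)%fset.
pose Bf (E' : set S) i := if i == a then E' else B i.
have mBf E' i : measurable E' -> measurable (Bf E' i).
  by move=> mE'; rewrite /Bf; case: ifP.
have key E' : measurable E' -> P (Y a @^-1` E' `&` \bigcap_(i in [set` J]) (Y i @^-1` B i)) =
   (P (Y a @^-1` E') * \prod_(i <- (J' `\ a)%fset) P (Y i @^-1` B i))%E.
  move=> mE'; transitivity (P (\bigcap_(i in [set` J']) (Y i @^-1` Bf E' i))).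
    congr (P _); apply/seteqP; split => w /=.
      move=> [h1 h2] i /=; rewrite /Bf !inE; case: eqVneq => [-> //|_ /= iJ].
      exact: h2.
    move=> h; split.
      by have /= := h a; rewrite !inE eqxx /Bf eqxx => /(_ isT).
    move=> i /= iJ; have /= := h i; rewrite !inE iJ orbT => /(_ isT).
    by rewrite /Bf; case: eqVneq => // ->; rewrite Ba.
  rewrite (iY J' (Bf E'))//; last by move=> i; exact: mBf.
  rewrite (big_fsetD1 a)/=; last by rewrite !inE eqxx.
  rewrite {1}/Bf eqxx; congr (_ * _)%E.
  by rewrite !big_seq; apply: eq_bigr => i; rewrite !inE /Bf => /andP[/negbTE ->].
rewrite key//; congr (_ * _)%E.
have := key setT measurableT.
by rewrite preimage_setT setTI probability_setT mul1e.
Qed.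

(** A pi-system carrying the other coordinates of [Y] together with a second source of randomness
    [H]. With claim counts as [Y] and claims as [H], or the reverse, it generates all that is
    independent of one count or one claim. *)
Definition off_system (Y : nat -> T -> S) (H : set (set T)) a : set (set T) :=
  [set C `&` D | C in cylinders_off Y a & D in H].

Lemma indep_off (Y : nat -> T -> S) (H : set (set T)) a (E : set S) :
  mutually_independent P Y -> (forall i, measurable_fun setT (Y i)) ->
  setI_closed H -> (forall A, H A -> measurable A) ->
  independent_sigma P (sigma_family setT Y) H ->
  measurable E -> forall B, <<s off_system Y H a >> B ->
  P (Y a @^-1` E `&` B) = (P (Y a @^-1` E) * P B)%E.
Proof.
move=> iY mY HI Hm YH mE.
have sY i F : measurable F -> sigma_family setT Y (Y i @^-1` F).
  move=> mF; apply: sub_sigma_algebra; exists i => //; exists F => //.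
  by rewrite setTI.
have mpre i F : measurable F -> measurable (Y i @^-1` F).
  by move=> mF; rewrite -[_ @^-1` _]setTI; exact: mY.
have sC C : cylinders_off Y a C -> sigma_family setT Y C.
  move=> [J [B [mB _ ->]]].
  apply: (@fin_bigcap_measurable _ (g_sigma_algebraType
    (\bigcup_(i in [set: nat]) preimage_set_system [set: T] (Y i) measurable))) => //.
  by move=> i _; exact: sY.
have mC C : cylinders_off Y a C -> measurable C.
  move=> [J [B [mB _ ->]]]; apply: fin_bigcap_measurable => //.
  by move=> i _; exact: mpre.
apply: indep_event_gen; first exact: mpre.
- move=> _ _ [C1 C1c [D1 HD1 <-]] [C2 C2c [D2 HD2 <-]].
  exists (C1 `&` C2); first exact: cylinders_offI.
  by exists (D1 `&` D2); [exact: HI|rewrite setIACA].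
- by move=> _ [C Cc [D HD <-]]; apply: measurableI; [exact: mC|exact: Hm].
- move=> _ [C Cc [D HD <-]]; rewrite setIA YH//; last first.
    exact: (@measurableI _ (g_sigma_algebraType
      (\bigcup_(i in [set: nat]) preimage_set_system [set: T] (Y i) measurable)))
      (sY _ _ mE) (sC _ Cc).
  rewrite mutually_independent_off// YH//; last exact: sC.
  by rewrite muleA.
Qed.

Lemma measurable_off_fun (Y : nat -> T -> S) (H : set (set T)) a i :
  H setT -> i != a ->
  measurable_fun setT (Y i : g_sigma_algebraType (off_system Y H a) -> S).
Proof.
move=> HT ia _ F mF; rewrite setTI; apply: sub_sigma_algebra.
exists (Y i @^-1` F); last by exists setT => //; rewrite setIT.
exists [fset i]%fset, (fun j => if j == a then setT else F); split.
- by move=> j; case: ifP.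
- by rewrite eqxx.
- apply/seteqP; split => w /=.
    by move=> h j /=; rewrite inE => /eqP ->; rewrite (negbTE ia).
  by move=> /(_ i) /=; rewrite inE eqxx (negbTE ia) => /(_ isT).
Qed.

Lemma measurable_off_other (Y : nat -> T -> S) (H : set (set T)) a
    (d2 : measure_display) (S2 : measurableType d2) (f : T -> S2) :
  (forall F, measurable F -> H (f @^-1` F)) ->
  measurable_fun setT (f : g_sigma_algebraType (off_system Y H a) -> S2).
Proof.
move=> Hf _ F mF; rewrite setTI; apply: sub_sigma_algebra.
exists setT; last by exists (f @^-1` F); [exact: Hf|rewrite setTI].
exists fset0, (fun=> setT); split => //.
by apply/seteqP; split.
Qed.

End independence.

Section laws.
Context (d : measure_display) (T : measurableType d) (R : realType)
  (P : probability T R).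

Lemma eq_law_gen (d' : measure_display) (S : measurableType d')
    (Z Z' : T -> S) (G : set (set S)) :
  measurable_fun setT Z -> measurable_fun setT Z' ->
  @measurable _ S = <<s G >> -> setI_closed G ->
  (forall A, G A -> P (Z @^-1` A) = P (Z' @^-1` A)) ->
  forall A, measurable A -> P (Z @^-1` A) = P (Z' @^-1` A).
Proof.
move=> mZ mZ' GE GI GP A; rewrite GE.
have mp (Y : T -> S) B : measurable_fun setT Y -> measurable B -> measurable (Y @^-1` B).
  by move=> mY mB; rewrite -[_ @^-1` _]setTI; exact: mY.
apply: (dynkin_induction (P := fun A => P (Z @^-1` A) = P (Z' @^-1` A)) GE GI) => //.
- move=> B mB PB; rewrite -!preimage_setC.
  by rewrite !probability_setC ?PB//; exact: mp.
- move=> F mF tF PF.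
  have tp (Y : T -> S) : trivIset setT (fun k => Y @^-1` F k).
    by move=> i j _ _ [w [/= Fi Fj]]; apply: tF => //; exists (Y w).
  rewrite !preimage_bigcup !measure_bigcup//; try by move=> i _; exact: mp.
  by apply: eq_eseriesr => i _; exact: PF.
Qed.

Lemma eq_law_rays (X X' : T -> R) :
  measurable_fun setT X -> measurable_fun setT X' ->
  (forall x, P [set w | X w <= x] = P [set w | X' w <= x]) ->
  forall A, measurable A -> P (X @^-1` A) = P (X' @^-1` A).
Proof.
move=> mX mX' XX'; apply: (eq_law_gen mX mX' (RGenOInfty.measurableE R)).
  move=> _ _ [x ->] [y ->]; exists (Num.max x y).
  apply/seteqP; split => z /=; rewrite !in_itv/= !andbT.
    by rewrite gt_max => -[-> ->].
  by rewrite gt_max => /andP[].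
move=> _ [x ->].
have E (Y : T -> R) : measurable_fun setT Y ->
    P (Y @^-1` `]x, +oo[%classic) = (1 - P [set w | (Y w <= x)%R])%E.
  move=> mY; have -> : Y @^-1` `]x, +oo[%classic = ~` [set w | Y w <= x].
    by apply/seteqP; split => z /=; rewrite in_itv/= andbT ltNge => /negP.
  rewrite probability_setC//.
  have -> : [set w | Y w <= x] = setT `&` Y @^-1` `]-oo, x]%classic.
    by rewrite setTI; apply/seteqP; split => z /=; rewrite in_itv.
  exact: mY.
by rewrite !E// XX'.
Qed.

(** The joint laws are products on rectangles, so both are determined by the two marginal
    distribution functions, and the event on the sum is a measurable subset of the plane. *)
Lemma eq_law_sum (X X' V V' : T -> R) :
  measurable_fun setT X -> measurable_fun setT X' ->
  measurable_fun setT V -> measurable_fun setT V' ->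
  (forall A B, measurable A -> measurable B ->
     P (X @^-1` A `&` V @^-1` B) = P (X @^-1` A) * P (V @^-1` B))%E ->
  (forall A B, measurable A -> measurable B ->
     P (X' @^-1` A `&` V' @^-1` B) = P (X' @^-1` A) * P (V' @^-1` B))%E ->
  (forall x, P [set w | X w <= x] = P [set w | X' w <= x]) ->
  (forall x, P [set w | V w <= x] = P [set w | V' w <= x]) ->
  forall x, P [set w | X w + V w <= x] = P [set w | X' w + V' w <= x].
Proof.
move=> mX mX' mV mV' iXV iXV' XX' VV' x.
have mS : measurable [set z : R * R | z.1 + z.2 <= x].
  rewrite -[X in measurable X]setTI.
  have -> : [set z : R * R | z.1 + z.2 <= x] = (fun z => z.1 + z.2) @^-1` `]-oo, x]%classic.
    by apply/seteqP; split => z /=; rewrite in_itv.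
  have mf : measurable_fun setT (fun z : R * R => z.1 + z.2).
    exact: measurable_funD.
  exact: mf.
have := @eq_law_gen _ (R * R)%type (fun w => (X w, V w)) (fun w => (X' w, V' w))
  [set A `*` B | A in measurable & B in measurable] _ _ _ _ _ _ mS; apply.
- exact: measurable_fun_pair.
- exact: measurable_fun_pair.
- exact: measurable_prod_measurableType.
- move=> _ _ [A1 mA1 [B1 mB1 <-]] [A2 mA2 [B2 mB2 <-]].
  exists (A1 `&` A2); first exact: measurableI.
  by exists (B1 `&` B2); [exact: measurableI|rewrite setXI].
- move=> _ [A mA [B mB <-]].
  transitivity (P (X @^-1` A `&` V @^-1` B)); first by congr (P _).
  rewrite iXV// (eq_law_rays mX mX')// (eq_law_rays mV mV')// -iXV'//.
Qed.

End laws.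

Section random_index.
Context (d : measure_display) (T : measurableType d).

Lemma measurable_fun_random_index (d' : measure_display) (S : measurableType d')
    (n : T -> nat) (g : nat -> T -> S) :
  measurable_fun setT n -> (forall k, measurable_fun setT (g k)) ->
  measurable_fun setT (fun w => g (n w) w).
Proof.
move=> mn mg _ B mB; rewrite setTI.
have -> : (fun w => g (n w) w) @^-1` B = \bigcup_k (n @^-1` [set k] `&` g k @^-1` B).
  apply/seteqP; split => [w /= Bw|w [k _ [/= <- //]]].
  by exists (n w).
apply: bigcup_measurable => k _; apply: measurableI.
  by rewrite -[_ @^-1` _]setTI; exact: mn.
by rewrite -[_ @^-1` _]setTI; exact: mg.
Qed.

Lemma probability_split_index (R : realType) (P : probability T R) (n : T -> nat)
    (A : set T) : measurable A -> measurable_fun setT n ->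
  P A = (\sum_(0 <= k <oo) P (n @^-1` [set k] `&` A))%E.
Proof.
move=> mA mn.
rewrite [in LHS](_ : A = \bigcup_k (n @^-1` [set k] `&` A)); last first.
  by apply/seteqP; split => [w Aw|w [k _ [_ //]]]; exists (n w).
rewrite measure_bigcup//.
- by apply: eq_eseriesl => k; rewrite in_setT.
- move=> k _; apply: measurableI => //.
  by rewrite -[_ @^-1` _]setTI; exact: mn.
- by move=> i j _ _ [w [[/= <- _] [/= <- _]]].
Qed.

End random_index.

(** * Maximal loss of a random walk *)

Section maxloss.
Context (R : realType).
Implicit Types (b u : R) (n : nat -> nat) (x : nat -> R).

(** Maximum over [j <= J] of the claims in the first [j] cells minus [b * j], with counts [n] read
    from index [a] and claims [x] from index [m]. The recursion isolates the first cell: what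
    follows it is again a [maxloss] with shifted indices. *)
Fixpoint maxloss b n x a m J : R :=
  if J is J'.+1 then
    Num.max 0 (\sum_(i < n a) x (m + i)%N - b + maxloss b n x a.+1 (m + n a)%N J')
  else 0.

Lemma maxlossP b n x a m J u :
  (forall j, (j <= J)%N ->
     \sum_(i < \sum_(l < j) n (a + l)%N) x (m + i)%N <= u + b * j%:R) <->
  maxloss b n x a m J <= u.
Proof.
elim: J a m u => [|J IH] a m u /=.
  split=> [/(_ 0%N (leqnn _))|u0 j]; first by rewrite !big_ord0 mulr0 addr0.
  by rewrite leqn0 => /eqP ->; rewrite !big_ord0 mulr0 addr0.
have E j : \sum_(i < \sum_(l < j.+1) n (a + l)%N) x (m + i)%N =
    \sum_(i < n a) x (m + i)%N +
    \sum_(i < \sum_(l < j) n (a.+1 + l)%N) x (m + n a + i)%N.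
  have -> : (\sum_(l < j.+1) n (a + l) = n a + \sum_(l < j) n (a.+1 + l))%N.
    rewrite big_ord_recl addn0; congr (_ + _)%N; apply: eq_bigr => i _.
    by rewrite lift0 addnS -addSn.
  by rewrite big_split_ord/=; congr (_ + _); apply: eq_bigr => i _; rewrite addnA.
rewrite ge_max -lerBrDl; split.
  move=> h; apply/andP; split.
    by have := h 0%N isT; rewrite !big_ord0 mulr0 addr0.
  by apply/IH => j jJ; have := h j.+1 jJ; rewrite E -natr1; lra.
case/andP=> u0 /IH h [_|j]; first by rewrite !big_ord0 mulr0 addr0.
by rewrite ltnS => /h; rewrite E -natr1; lra.
Qed.

Lemma maxloss_ge0 b n x a m J : 0 <= maxloss b n x a m J.
Proof. by case: J => [|J] //=; rewrite le_max lexx. Qed.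

Lemma maxloss_homo b n x a m J J' : (J <= J')%N ->
  maxloss b n x a m J <= maxloss b n x a m J'.
Proof.
move=> JJ'; apply/maxlossP => j jJ.
by have /maxlossP := lexx (maxloss b n x a m J'); apply; exact: leq_trans JJ'.
Qed.

Lemma measurable_maxloss (d : measure_display) (T : measurableType d)
    (Y : nat -> T -> nat) (X : nat -> T -> R) b a m J :
  (forall j, (a <= j)%N -> measurable_fun setT (Y j)) ->
  (forall i, (m <= i)%N -> measurable_fun setT (X i)) ->
  measurable_fun setT (fun w => maxloss b (Y^~ w) (X^~ w) a m J).
Proof.
elim: J a m => [|J IH] a m mY mX //=.
(* The random number of summands is frozen at [k], and [measurable_fun_random_index] reinstates
   it. *)
pose g k w := Num.max 0 (\sum_(i < k) X (m + i)%N w - b +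
  maxloss b (Y^~ w) (X^~ w) a.+1 (m + k)%N J).
apply: (@measurable_fun_random_index _ _ _ _ (Y a) g); first exact: mY.
move=> k; apply: measurable_maxr => //; apply: measurable_funD.
  apply: measurable_funB => //; apply: measurable_sum => i.
  by apply: mX; rewrite leq_addr.
apply: IH => [j aj|i mi]; first by apply: mY; exact: ltnW.
by apply: mX; exact: leq_trans (leq_addr _ _) mi.
Qed.

End maxloss.

Section law_of_maxloss.
Context (d : measure_display) (T : measurableType d) (R : realType)
  (P : probability T R) (Y : nat -> T -> nat) (X : nat -> T -> R) (b : R).
Hypotheses (mY : forall j, measurable_fun setT (Y j))
  (mX : forall i, measurable_fun setT (X i))
  (iY : mutually_independent P Y) (iX : mutually_independent P X)
  (iYX : independent_sigma P (sigma_family setT Y) (sigma_family setT X))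
  (Ydist : forall a k, P (Y a @^-1` [set k]) = P (Y 0%N @^-1` [set k]))
  (Xdist : forall i x, P [set w | X i w <= x] = P [set w | X 0%N w <= x]).

Let W a m J w := maxloss b (Y^~ w) (X^~ w) a m J.
Let S m k w := \sum_(i < k) X (m + i)%N w.

Let mW a m J : measurable_fun setT (W a m J).
Proof. by apply: measurable_maxloss. Qed.

Let mS m k : measurable_fun setT (S m k).
Proof. by apply: measurable_sum. Qed.

Let mSW m k a J : measurable_fun setT (fun w => S m k w + W a (m + k)%N J w).
Proof. exact: measurable_funD. Qed.

Let sigma_familyI (d' : measure_display) (U : measurableType d') (Z : nat -> T -> U) :
  setI_closed (sigma_family setT Z).
Proof. by move=> A B; exact: (@measurableI _ (g_sigma_algebraType _)). Qed.

Let sigma_familyT (d' : measure_display) (U : measurableType d') (Z : nat -> T -> U) :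
  sigma_family setT Z setT.
Proof. exact: (@measurableT _ (g_sigma_algebraType _)). Qed.

Let sigma_family_meas (d' : measure_display) (U : measurableType d') (Z : nat -> T -> U) :
  (forall i, measurable_fun setT (Z i)) ->
  forall A, sigma_family setT Z A -> measurable A.
Proof.
move=> mZ; apply: smallest_sub; first exact: sigma_algebra_measurable.
by move=> _ [i _ [B mB <-]]; exact: mZ.
Qed.

Let sigma_family_preimage (d' : measure_display) (U : measurableType d')
  (Z : nat -> T -> U) i F : measurable F -> sigma_family setT Z (Z i @^-1` F).
Proof.
move=> mF; apply: sub_sigma_algebra; exists i => //; exists F => //.
by rewrite setTI.
Qed.

(** [V] reads claims and the counts of cells after [a] only, so it is measurable for the
    [off_system] of [a]. The next lemma does the same with the roles of counts and claims
    exchanged. *)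
Lemma count_indep a m k J (E : set nat) (B : set R) : measurable B ->
  let V w := S m k w + W a.+1 (m + k)%N J w in
  P (Y a @^-1` E `&` V @^-1` B) = (P (Y a @^-1` E) * P (V @^-1` B))%E.
Proof.
move=> mB V.
have mX' i : measurable_fun setT
    (X i : g_sigma_algebraType (off_system Y (sigma_family setT X) a) -> R).
  by apply: measurable_off_other => F; exact: sigma_family_preimage.
have mV : measurable_fun setT
    (V : g_sigma_algebraType (off_system Y (sigma_family setT X) a) -> R).
  apply: measurable_funD; first by apply: measurable_sum => i; exact: mX'.
  apply: measurable_maxloss => // j aj; apply: measurable_off_fun => //.
  by rewrite gt_eqF.
apply: (indep_off iY mY (@sigma_familyI _ _ X) (sigma_family_meas mX) iYX) => //.
by rewrite -[_ @^-1` _]setTI; exact: mV.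
Qed.

Lemma claim_indep a m k J (A B : set R) : measurable A -> measurable B ->
  let V w := S m.+1 k w + W a (m.+1 + k)%N J w in
  P (X m @^-1` A `&` V @^-1` B) = (P (X m @^-1` A) * P (V @^-1` B))%E.
Proof.
move=> mA mB V.
have mY' i : measurable_fun setT
    (Y i : g_sigma_algebraType (off_system X (sigma_family setT Y) m) -> nat).
  by apply: measurable_off_other => F; exact: sigma_family_preimage.
have mX' i : (m < i)%N -> measurable_fun setT
    (X i : g_sigma_algebraType (off_system X (sigma_family setT Y) m) -> R).
  by move=> mi; apply: measurable_off_fun; [exact: sigma_familyT|rewrite gt_eqF].
have mV : measurable_fun setT
    (V : g_sigma_algebraType (off_system X (sigma_family setT Y) m) -> R).
  apply: measurable_funD.
    by apply: measurable_sum => i; apply: mX'; rewrite addSn ltnS leq_addr.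
  apply: measurable_maxloss => // j aj; apply: mX'.
  by apply: leq_trans aj; rewrite addSn ltnS leq_addr.
apply: (indep_off iX mX (@sigma_familyI _ _ Y) (sigma_family_meas mY)) => //.
  by move=> C D sC sD; rewrite setIC iYX// muleC.
by rewrite -[_ @^-1` _]setTI; exact: mV.
Qed.

Let measurable_le (V : T -> R) x : measurable_fun setT V ->
  measurable [set w | V w <= x].
Proof.
move=> mV; have -> : [set w | V w <= x] = setT `&` V @^-1` `]-oo, x]%classic.
  by rewrite setTI; apply/seteqP; split => z /=; rewrite in_itv.
exact: mV.
Qed.

(** Conditioning on the number of claims in the first cell, which is independent of the claims and
    of the later cells. A negative [u] gives 0 because [maxloss] is nonnegative. *)
Lemma maxloss_step a m J u :
  P [set w | W a m J.+1 w <= u] =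
  if 0 <= u then
    (\sum_(0 <= k <oo) P (Y a @^-1` [set k]) *
      P [set w | (S m k w + W a.+1 (m + k)%N J w <= u + b)%R])%E
  else 0%E.
Proof.
case: ifPn => u0; last first.
  rewrite [X in P X](_ : _ = set0) ?measure0//.
  by apply/seteqP; split => // w /=; rewrite /W/= ge_max (negbTE u0).
rewrite (@probability_split_index _ _ _ P (Y a))//; last exact: measurable_le.
apply: eq_eseriesr => k _.
have -> : Y a @^-1` [set k] `&` [set w | W a m J.+1 w <= u] =
   Y a @^-1` [set k] `&`
   (fun w => S m k w + W a.+1 (m + k)%N J w) @^-1` `]-oo, u + b]%classic.
  have E w : Y a w = k -> (W a m J.+1 w <= u) =
     (S m k w + W a.+1 (m + k)%N J w <= u + b).
    move=> Yk; rewrite /W /= ge_max u0 Yk /= /S; lra.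
  by apply/seteqP; split => w /= [Yk]; rewrite in_itv/= (E w Yk).
by rewrite count_indep//; congr (_ * P _)%E; apply/seteqP; split => w /=; rewrite in_itv.
Qed.

(** The [k] claims are peeled off one at a time, each being independent of the remaining sum, so
    [eq_law_sum] applies at every stage. *)
Lemma law_claims_maxloss J :
  (forall a a' m m' u, P [set w | W a m J w <= u] = P [set w | W a' m' J w <= u]) ->
  forall k m m' a a' v,
    P [set w | S m k w + W a (m + k)%N J w <= v] =
    P [set w | S m' k w + W a' (m' + k)%N J w <= v].
Proof.
move=> WJ; elim => [|k IH] m m' a a' v.
  under eq_set do rewrite /S big_ord0 add0r.
  under [in RHS]eq_set do rewrite /S big_ord0 add0r.
  exact: WJ.
have ES m0 w : S m0 k.+1 w = X m0 w + S m0.+1 k w.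
  rewrite /S big_ord_recl addn0; congr (_ + _); apply: eq_bigr => i _.
  by rewrite lift0 addnS -addSn.
have E m0 a0 : [set w | S m0 k.+1 w + W a0 (m0 + k.+1)%N J w <= v] =
   [set w | X m0 w + (S m0.+1 k w + W a0 (m0.+1 + k)%N J w) <= v].
  by apply/seteqP; split => w /=; rewrite ES addSnnS addrA.
rewrite !E; apply: eq_law_sum => //.
- by move=> A B mA mB; exact: claim_indep.
- by move=> A B mA mB; exact: claim_indep.
- by move=> x; rewrite Xdist [RHS]Xdist.
Qed.

(** Stationarity: after the first cell the walk restarts with the law it had at the beginning. *)
Lemma law_maxloss J a a' m m' u :
  P [set w | W a m J w <= u] = P [set w | W a' m' J w <= u].
Proof.
elim: J a a' m m' u => [//|J IH] a a' m m' u.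
rewrite !maxloss_step; case: ifP => // _; apply: eq_eseriesr => k _.
by rewrite Ydist [in RHS]Ydist; congr (_ * _)%E; exact: law_claims_maxloss.
Qed.

End law_of_maxloss.

Section sum_of_independent.
Context (d : measure_display) (T : measurableType d) (R : realType)
  (P : probability T R).
Local Notation mu := (@lebesgue_measure R).

Lemma measurable_rv_le (V : T -> R) x : measurable_fun setT V ->
  measurable [set w | V w <= x].
Proof.
move=> mV; rewrite -[X in measurable X]setTI.
exact: (measurable_fun_le measurableT mV (measurable_cst x)).
Qed.

(* Both sides equal the expectation of the positive part of [l - X - V]. *)
Lemma integral_cdf_sum (X V : T -> R) (l : R) :
  measurable_fun setT X -> measurable_fun setT V ->
  {ae P, forall w, 0 < X w} -> (forall w, 0 <= V w) ->
  (forall x v, P ([set w | X w <= x]%R `&` [set w | V w <= v]%R) =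
     P [set w | X w <= x]%R * P [set w | V w <= v]%R)%E ->
  (\int[mu]_(v in `[0%R, l]) P [set w | X w + V w <= v]%R =
   \int[mu]_(s in `[0%R, l]) (P [set w | X w <= l - s]%R * P [set w | V w <= s]%R))%E.
Proof.
move=> mX mV X0 V0 iXV.
pose A : set (R * T) := [set z | 0 <= z.1] `&` [set z | z.1 <= l] `&`
  [set z | X z.2 + V z.2 <= z.1].
pose B : set (R * T) := [set z | 0 <= z.1] `&` [set z | z.1 <= l] `&`
  [set z | V z.2 <= z.1] `&` [set z | X z.2 <= l - z.1].
have m1 : measurable_fun setT (fun z : R * T => z.1) by exact: measurable_fst.
have mX2 : measurable_fun setT (fun z : R * T => X z.2).
  exact: (measurableT_comp mX measurable_snd).
have mV2 : measurable_fun setT (fun z : R * T => V z.2).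
  exact: (measurableT_comp mV measurable_snd).
have ml (f g : R * T -> R) : measurable_fun setT f -> measurable_fun setT g ->
    measurable [set z | f z <= g z].
  by move=> mf mg; rewrite -[X in measurable X]setTI; exact: measurable_fun_le.
have mA : measurable A.
  apply: measurableI; last by apply: ml => //; exact: measurable_funD.
  by apply: measurableI; apply: ml => //; exact: measurable_cst.
have mB : measurable B.
  apply: measurableI; last by apply: ml => //; exact: measurable_funB.
  apply: measurableI; last exact: ml.
  by apply: measurableI; apply: ml => //; exact: measurable_cst.
have FE (C : set (R * T)) : measurable C ->
   (\int[mu]_v P (xsection C v) = \int[P]_w mu (ysection C w))%E.
  move=> mC; have := @indic_fubini_tonelli _ _ _ _ _ mu P C mC.
  by rewrite indic_fubini_tonelli_FE// indic_fubini_tonelli_GE.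
have FA : (\int[mu]_(v in `[0%R, l]) P [set w | X w + V w <= v]%R =
    \int[mu]_v P (xsection A v))%E.
  rewrite integral_mkcond; apply: eq_integral => v _; rewrite patchE.
  case: ifPn => [|]; rewrite ?inE ?notin_setE/= in_itv/= => v0l.
    congr (P _); apply/seteqP; split => w; rewrite /xsection/= inE /A/=;
    by move/andP : v0l => [? ?]; tauto.
  rewrite [X in P X](_ : _ = set0) ?measure0//; apply/seteqP; split => // w.
  by rewrite /xsection/= inE /A/= => -[[h1 h2] _]; apply: v0l; rewrite h1 h2.
have FB : (\int[mu]_(s in `[0%R, l]) (P [set w | X w <= l - s]%R * P [set w | V w <= s]%R) =
    \int[mu]_v P (xsection B v))%E.
  rewrite integral_mkcond; apply: eq_integral => v _; rewrite patchE.
  case: ifPn => [|]; rewrite ?inE ?notin_setE/= in_itv/= => v0l.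
    rewrite -iXV.
    congr (P _); apply/seteqP; split => w; rewrite /xsection/= inE /B/=;
    by move/andP : v0l => [? ?]; tauto.
  rewrite [X in P X](_ : _ = set0) ?measure0//; apply/seteqP; split => // w.
  by rewrite /xsection/= inE /B/= => -[[[h1 h2] _] _]; apply: v0l; rewrite h1 h2.
rewrite FA FB !FE//; apply: ae_eq_integral => //.
- exact: measurable_fun_ysection.
- exact: measurable_fun_ysection.
(* For fixed [w] the two sections are intervals that differ by the translation [X w]; positivity of
   [X w] keeps both inside [[0, l]]. *)
apply: filterS X0 => w Xw _.
have -> : ysection A w = `[X w + V w, l]%classic.
  apply/seteqP; split => v; rewrite /ysection/= inE /A/= in_itv/=.
    by case=> [[? ?] ?]; apply/andP.
  by move=> /andP[h1 h2]; split; [split|] => //; have := V0 w; lra.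
have -> : ysection B w = `[V w, l - X w]%classic.
  apply/seteqP; split => v; rewrite /ysection/= inE /B/= in_itv/=.
    by case=> [[[? ?] ?] ?]; apply/andP; split; lra.
  by move=> /andP[h1 h2]; have := V0 w; split; [split|]; [split| |]; lra.
rewrite !lebesgue_measure_itv/= !lte_fin.
have -> : (V w < l - X w) = (X w + V w < l) by lra.
by case: ifP => // _; rewrite -!EFinB; congr EFin; lra.
Qed.

End sum_of_independent.

(** * One cell of the grid: zero, one or several claims *)

Section step_estimate.
Context (d : measure_display) (T : measurableType d) (R : realType)
  (P : probability T R) (Y : nat -> T -> nat) (X : nat -> T -> R) (b x : R).
Hypotheses (mY : forall j, measurable_fun setT (Y j))
  (mX : forall i, measurable_fun setT (X i))
  (iY : mutually_independent P Y) (iX : mutually_independent P X)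
  (iYX : independent_sigma P (sigma_family setT Y) (sigma_family setT X))
  (Ydist : forall a k, P (Y a @^-1` [set k]) = (poisson_pmf x k)%:E)
  (Xdist : forall i x, P [set w | X i w <= x] = P [set w | X 0%N w <= x])
  (Xpos : {ae P, forall w, 0 < X 0%N w}) (x0 : 0 < x).

(** No ruin up to the [J]-th grid time from capital [u]. In [gridQ] one claim is paid first, so the
    walk reads its claims from index 1. *)
Definition gridD J u := fine (P [set w | maxloss b (Y^~ w) (X^~ w) 0 0 J <= u]).
Definition gridQ J v :=
  fine (P [set w | X 0%N w + maxloss b (Y^~ w) (X^~ w) 0 1 J <= v]).

Let mW a m J : measurable_fun setT (fun w => maxloss b (Y^~ w) (X^~ w) a m J).
Proof. by apply: measurable_maxloss. Qed.

Let mXW J : measurable_fun setT (fun w => X 0%N w + maxloss b (Y^~ w) (X^~ w) 0 1 J).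
Proof. exact: measurable_funD. Qed.

Lemma gridDE J u :
  (gridD J u)%:E = P [set w | maxloss b (Y^~ w) (X^~ w) 0 0 J <= u].
Proof. by rewrite fineK// fin_num_measure//; exact: measurable_rv_le. Qed.

Lemma gridQE J u :
  (gridQ J u)%:E = P [set w | X 0%N w + maxloss b (Y^~ w) (X^~ w) 0 1 J <= u].
Proof. by rewrite fineK// fin_num_measure//; exact: measurable_rv_le. Qed.

Let Ydist0 a k : P (Y a @^-1` [set k]) = P (Y 0%N @^-1` [set k]).
Proof. by rewrite !Ydist. Qed.

(** The capital after the cell is [u + b] before claims. Zero and one claim have Poisson weights
    [expR (- x)] and [x * expR (- x)]; the rest contributes between 0 and the remaining mass. *)
Lemma gridD_step J u : 0 <= u ->
  0 <= gridD J.+1 u - expR (- x) * gridD J (u + b) - x * expR (- x) * gridQ J (u + b)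
    <= 1 - expR (- x) - x * expR (- x).
Proof.
move=> u0.
pose q k := P [set w | \sum_(i < k) X (0 + i)%N w +
   maxloss b (Y^~ w) (X^~ w) 1 (0 + k)%N J <= u + b].
have pk0 k : (0 <= (poisson_pmf x k)%:E :> \bar R)%E by rewrite lee_fin poisson_pmf_ge0.
have E1 : (gridD J.+1 u)%:E = (\sum_(0 <= k <oo) (poisson_pmf x k)%:E * q k)%E.
  rewrite gridDE (maxloss_step b mY mX iY iYX) u0.
  by apply: eq_eseriesr => k _; rewrite Ydist.
have E2 : 1%E = (\sum_(0 <= k <oo) (poisson_pmf x k)%:E)%E :> \bar R.
  rewrite -(@probability_setT _ _ _ P) (@probability_split_index _ _ _ P (Y 0%N))//.
  by apply: eq_eseriesr => k _; rewrite setIT Ydist.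
have q1 k : (q k <= 1)%E by apply: probability_le1; apply: measurable_rv_le; apply: measurable_funD => //; exact: measurable_sum.
have q0 : q 0%N = (gridD J (u + b))%:E.
  rewrite gridDE /q; under eq_set do rewrite big_ord0 add0r.
  exact: (law_maxloss b mY mX iY iX iYX Ydist0 Xdist).
have q1E : q 1%N = (gridQ J (u + b))%:E.
  have := law_claims_maxloss mY mX iX iYX Xdist
    (law_maxloss b mY mX iY iX iYX Ydist0 Xdist J) 1 0 0 1 0 (u + b).
  rewrite gridQE /q => ->.
  by under eq_set do rewrite big_ord1.
have sp (f : nat -> \bar R) : (forall k, 0 <= f k)%E ->
    (\sum_(0 <= k <oo) f k = f 0%N + f 1%N + \sum_(2 <= k <oo) f k)%E.
  move=> f0; rewrite (@nneseries_split _ f 0 2)// add0n.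
  by rewrite big_nat_recl// big_nat1.
have p0 : poisson_pmf x 0 = expR (- x) by rewrite /poisson_pmf x0 expr0 fact0 invr1 !mul1r.
have p1 : poisson_pmf x 1 = x * expR (- x) by rewrite /poisson_pmf x0 expr1 invr1 mulr1.
rewrite sp in E1; last by move=> k; rewrite mule_ge0// measure_ge0.
rewrite sp// in E2.
set t1 := (\sum_(2 <= k <oo) _)%E in E1; set t2 := (\sum_(2 <= k <oo) _)%E in E2.
have t12 : (0 <= t1 <= t2)%E.
  rewrite nneseries_ge0/=; last by move=> k _ _; rewrite mule_ge0// measure_ge0.
  apply: lee_nneseries => k _; first by rewrite mule_ge0// measure_ge0.
  by rewrite -[leRHS]mule1; apply: lee_wpmul2l.
have t2f : t2 \is a fin_num.
  rewrite ge0_fin_numE; last by case/andP: t12 => h1 h2; exact: le_trans h2.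
  rewrite ltey; apply/eqP => t2y; move: E2; rewrite t2y.
  by rewrite addey// -EFinD.
have t1f : t1 \is a fin_num.
  case/andP: t12 => t10 t12; rewrite ge0_fin_numE//.
  by apply: le_lt_trans t12 _; rewrite ltey_eq t2f.
move: E1 E2 t12; rewrite -(fineK t1f) -(fineK t2f) q0 q1E p0 p1 -!EFinM -!EFinD.
by move=> [->] [E2]; rewrite !lee_fin => /andP[h1 h2]; lra.
Qed.

(** Integrating over the capital turns the law of a sum into a convolution with the distribution
    function of the claim, with neither a density nor a Stieltjes integral. *)
Lemma gridQ_integral J l :
  (\int[@lebesgue_measure R]_(v in `[0%R, l]) (gridQ J v)%:E =
   \int[@lebesgue_measure R]_(s in `[0%R, l])
     (fine (P [set w | (X 0%N w <= l - s)%R]) * gridD J s)%:E)%E.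
Proof.
under eq_integral do rewrite gridQE.
have law01 s : P [set w | maxloss b (Y^~ w) (X^~ w) 0 1 J <= s] = (gridD J s)%:E.
  by rewrite gridDE; exact: (law_maxloss b mY mX iY iX iYX Ydist0 Xdist).
rewrite integral_cdf_sum//.
- apply: eq_integral => s _; rewrite EFinM fineK ?law01//.
  by rewrite fin_num_measure//; exact: measurable_rv_le.
- by move=> w; exact: maxloss_ge0.
- move=> u v; have := claim_indep b mY mX iX iYX.
  move=> /(_ 0%N 0%N 0%N J `]-oo, u]%classic `]-oo, v]%classic).
  have -> : (fun w => \sum_(i < 0) X (1 + i)%N w +
     maxloss b (Y^~ w) (X^~ w) 0 (1 + 0) J) =
     (fun w => maxloss b (Y^~ w) (X^~ w) 0 1 J).
    by apply/funext => w; rewrite big_ord0 add0r.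
  have E (Z : T -> R) t : Z @^-1` `]-oo, t]%classic = [set w | Z w <= t].
    by apply/seteqP; split => w /=; rewrite in_itv.
  by rewrite !E => ->.
Qed.

End step_estimate.

(** * Infinitely many grid times on a fixed grid, and summation over the cells of the horizon *)

Section grid_limit.
Context (R : realType).
Local Notation mu := (@lebesgue_measure R).
Context (D Q : nat -> R -> R) (delta q F : R -> R) (b x kappa : R) (n : nat).
Hypotheses (b0 : 0 < b) (x0 : 0 < x) (xE : x = kappa * b)
  (D01 : forall J u, 0 <= D J u <= 1) (Q01 : forall J u, 0 <= Q J u <= 1)
  (Dnd : forall J, {homo D J : u v / u <= v})
  (Qnd : forall J, {homo Q J : u v / u <= v})
  (Dcvg : forall u, D ^~ u @ \oo --> delta u)
  (Qcvg : forall u, Q ^~ u @ \oo --> q u)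
  (F01 : forall u, 0 <= F u <= 1) (mF : measurable_fun setT F)
  (step : forall J u, 0 <= u ->
    0 <= D J.+1 u - expR (- x) * D J (u + b) - x * expR (- x) * Q J (u + b)
      <= 1 - expR (- x) - x * expR (- x))
  (QD : forall J, \int[mu]_(v in `[0, n%:R * b]) Q J v =
     \int[mu]_(s in `[0, n%:R * b]) (F (n%:R * b - s) * D J s)).

Let e_lo : 1 - x <= expR (- x).
Proof. exact: expR_ge1Dx. Qed.

Let e_hi : expR (- x) <= 1 - x + x ^+ 2.
Proof.
have e0 := expR_gt0 (- x); have h : 1 + x <= expR x by exact: expR_ge1Dx.
have : expR (- x) * expR x = 1 by rewrite -expRD addNr expR0.
move=> E; have : expR (- x) * (1 + x) <= 1 by rewrite -[leRHS]E ler_pM2l.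
move=> le1; have x1 : 0 < 1 + x by rewrite addr_gt0.
rewrite -(ler_pM2r x1); apply: le_trans le1 _.
have -> : (1 - x + x ^+ 2) * (1 + x) = 1 + x ^+ 3 by ring.
by rewrite lerDl exprn_ge0// ltW.
Qed.

Let delta01 u : 0 <= delta u <= 1.
Proof.
apply/andP; split.
  by apply: (cvgn_ge (@Dcvg u)) => J; case/andP: (D01 J u).
by apply: (cvgn_le (@Dcvg u)) => J; case/andP: (D01 J u).
Qed.

Let q01 u : 0 <= q u <= 1.
Proof.
apply/andP; split.
  by apply: (cvgn_ge (@Qcvg u)) => J; case/andP: (Q01 J u).
by apply: (cvgn_le (@Qcvg u)) => J; case/andP: (Q01 J u).
Qed.

Let delta_nd : {homo delta : u v / u <= v}.
Proof.
move=> u v uv; by apply: (cvgn_homo (@Dcvg u) (@Dcvg v)) => J; exact: Dnd.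
Qed.

Let q_nd : {homo q : u v / u <= v}.
Proof.
move=> u v uv; by apply: (cvgn_homo (@Qcvg u) (@Qcvg v)) => J; exact: Qnd.
Qed.

(** First-order expansion of the one-cell estimate in [x], using
    [1 - x <= expR (- x) <= 1 - x + x ^+ 2]. *)
Let stepJ J u : 0 <= u ->
  D J (u + b) - D J.+1 u <= x /\
  `|D J (u + b) - D J.+1 u - x * (D J (u + b) - Q J (u + b))| <= 2 * x ^+ 2.
Proof.
move=> u0; have /andP[h1 h2] := step J u0.
have /andP[d0 d1] := D01 J (u + b); have /andP[q0 q1] := Q01 J (u + b).
have e0 := expR_gt0 (- x).
move: h1 h2 d0 d1 q0 q1 e0 e_lo e_hi.
set e := expR _; set p := D J (u + b); set r := Q J (u + b); set s := D J.+1 u.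
move=> h1 h2 d0 d1 q0 q1 e0 elo ehi.
(* [A1] to [A9] are nonnegative products offered to [nra] for both bounds. *)
have A1 : 0 <= x * e * r by rewrite !mulr_ge0// ltW.
have e1 : e <= 1 by rewrite expR_le1 oppr_le0 ltW.
have A2 : 0 <= (1 - e) * (1 - p) by rewrite mulr_ge0// subr_ge0.
have A3 : 0 <= (e - 1 + x) * p by rewrite mulr_ge0//; lra.
have A4 : 0 <= (1 - x + x ^+ 2 - e) * p by rewrite mulr_ge0//; lra.
have A5 : 0 <= x * (1 - e) * r.
  by rewrite !mulr_ge0//; [exact: ltW|rewrite subr_ge0].
have A6 : 0 <= x * (e - 1 + x) * r by rewrite !mulr_ge0//; [exact: ltW|lra].
have A7 : 0 <= x ^+ 2 * (1 - p) by rewrite mulr_ge0// ?sqr_ge0//; lra.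
have A8 : 0 <= x ^+ 2 * (1 - r) by rewrite mulr_ge0// ?sqr_ge0//; lra.
have A9 : 0 <= x * (e - 1 + x) by rewrite !mulr_ge0//; [exact: ltW|lra].
by split; [nra|rewrite ler_norml; apply/andP; split; nra].
Qed.

Let cvg_shift u : (fun J => D J.+1 u) @ \oo --> delta u.
Proof. by have := @Dcvg u; rewrite -(cvg_shiftS (D ^~ u)). Qed.

Lemma grid_lipschitz u : 0 <= u -> delta (u + b) - delta u <= x.
Proof.
move=> u0; have c : (fun J => D J (u + b) - D J.+1 u) @ \oo --> delta (u + b) - delta u.
  exact: cvgB (@Dcvg _) (@cvg_shift _).
by apply: (cvgn_le c) => J; case: (stepJ J u0).
Qed.

Let step_lim u : 0 <= u ->
  `|delta (u + b) - delta u - x * (delta (u + b) - q (u + b))| <= 2 * x ^+ 2.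
Proof.
move=> u0.
have c : (fun J => `|D J (u + b) - D J.+1 u - x * (D J (u + b) - Q J (u + b))|) @ \oo -->
    `|delta (u + b) - delta u - x * (delta (u + b) - q (u + b))|.
  apply: cvg_norm; apply: cvgB; first exact: cvgB (@Dcvg _) (@cvg_shift _).
  by apply: cvgMr; exact: cvgB (@Dcvg _) (@Qcvg _).
by apply: (cvgn_le c) => J; case: (stepJ J u0).
Qed.

Let jb (j : nat) : 0 <= j%:R * b. Proof. by rewrite mulr_ge0// ltW. Qed.

Let telescope_bound m :
  `|delta (m%:R * b) - delta 0 -
    \sum_(j < m) x * (delta (j.+1%:R * b) - q (j.+1%:R * b))| <= m%:R * (2 * x ^+ 2).
Proof.
elim: m => [|m IH]; first by rewrite big_ord0 !mul0r !subrr normr0.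
rewrite big_ord_recr/=.
have := step_lim (jb m); have -> : m%:R * b + b = m.+1%:R * b by rewrite -natr1; ring.
move: IH; rewrite -natr1 !ler_norml => /andP[h1 h2] /andP[h3 h4].
by apply/andP; split; lra.
Qed.

(** Summing the one-cell relations telescopes the left side and leaves right-endpoint Riemann sums
    of [delta] and [q]. As [n%:R * b] is the horizon and [x = kappa * b], the whole right side is of
    order [b]. *)
Lemma grid_renewal_bound :
  `|delta (n%:R * b) - delta 0 - kappa * (\int[mu]_(s in `[0, n%:R * b]) delta s -
     \int[mu]_(s in `[0, n%:R * b]) (F (n%:R * b - s) * delta s))|
  <= n%:R * (2 * x ^+ 2) + kappa * b.
Proof.
have md (f : R -> R) : {homo f : u v / u <= v} -> measurable_fun `[0, n%:R * b] f.
  by move=> h; apply: nondecreasing_measurable.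
have qE : \int[mu]_(s in `[0, n%:R * b]) q s =
    \int[mu]_(s in `[0, n%:R * b]) (F (n%:R * b - s) * delta s).
  have c1 : (fun J => \int[mu]_(s in `[0, n%:R * b]) Q J s) @ \oo -->
      \int[mu]_(s in `[0, n%:R * b]) q s.
    apply: (@Rintegral_itv_dominated _ _ _ _ _ 1) => [J|y _|J y _].
    - exact: md.
    - exact: Qcvg.
    - by rewrite ler_norml; have := Q01 J y; lra.
  have c2 : (fun J => \int[mu]_(s in `[0, n%:R * b]) (F (n%:R * b - s) * D J s)) @ \oo
      --> \int[mu]_(s in `[0, n%:R * b]) (F (n%:R * b - s) * delta s).
    apply: (@Rintegral_itv_dominated _ _ _ _ _ 1) => [J|y _|J y _].
    - apply: measurable_funM; last exact: md.
      apply: measurableT_comp => //.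
      by apply: measurable_funB => //; exact: measurable_id.
    - by apply: cvgMr; exact: Dcvg.
    - have /andP[? ?] := D01 J y; have /andP[? ?] := F01 (n%:R * b - y).
      by rewrite ger0_norm ?mulr_ge0// mulr_ile1.
  have E : (fun J => \int[mu]_(s in `[0, n%:R * b]) Q J s) =
      (fun J => \int[mu]_(s in `[0, n%:R * b]) (F (n%:R * b - s) * D J s)).
    by apply/funext => J; exact: QD.
  by rewrite -E in c2; rewrite -(cvg_lim _ c1)// -(cvg_lim _ c2).
rewrite -qE.
have hom (f : R -> R) : {homo f : u v / u <= v} -> {in `[0, n%:R * b] &, {homo f : x y / x <= y}}.
  by move=> h u v _ _; exact: h.
have := riemann_sum_monotone b0 (hom _ delta_nd) (md _ delta_nd).
have := riemann_sum_monotone b0 (hom _ q_nd) (md _ q_nd).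
have := telescope_bound n.
have -> : \sum_(j < n) x * (delta (j.+1%:R * b) - q (j.+1%:R * b)) =
  kappa * (\sum_(j < n) b * delta (j.+1%:R * b) - \sum_(j < n) b * q (j.+1%:R * b)).
  rewrite -sumrB mulr_sumr; apply: eq_bigr => j _; rewrite xE; ring.
set s1 := \sum_(j < n) _; set s2 := \sum_(j < n) _.
set i2 := \int[mu]_(_ in _) _; set i1 := \int[mu]_(_ in _) _.
move=> h1 /andP[h2 h3] /andP[h4 h5].
have k0 : 0 < kappa by move: x0; rewrite xE pmulr_lgt0.
have /andP[d1 d2] := delta01 (n%:R * b); have /andP[d3 d4] := delta01 0.
have /andP[q1 q2] := q01 (n%:R * b); have /andP[q3 q4] := q01 0.
(* Values lie in [[0, 1]], so each Riemann sum exceeds its integral by an amount in [[0, b]]; two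
   such excesses differ by at most [b]. *)
have {}h3 : s2 - i2 <= b by apply: le_trans h3 _; rewrite ger_pMr//; lra.
have {}h5 : s1 - i1 <= b by apply: le_trans h5 _; rewrite ger_pMr//; lra.
have h6 : `|kappa * (s1 - s2) - kappa * (i1 - i2)| <= kappa * b.
  rewrite -mulrBr normrM gtr0_norm// ler_pM2l// ler_norml; apply/andP; split; lra.
apply: le_trans (lerD h1 h6).
set A := delta _ - delta _.
by rewrite -[X in `|X|](_ : (A - kappa * (s1 - s2)) + (kappa * (s1 - s2) - kappa * (i1 - i2)) = _)
  ?ler_normD//; ring.
Qed.

End grid_limit.

(** * Renewal equation for the survival probability *)

Section survival.
Context (d : measure_display) (T : measurableType d) (R : realType)
  (P : probability T R) (lambda c mu : R) (FX : R -> R)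
  (N : R -> {RV P >-> nat}) (X : nat -> {RV P >-> R})
  (hmodel : classical_risk_model lambda c mu FX N X).

Definition survival (u : R) : set T :=
  [set w | forall t, 0 <= t -> 0 <= surplus c N X u t w].

Lemma ruin_survival u :
  [set w | (ereal_inf [set (surplus c N X u t w)%:E | t in `[0%R, +oo[] < 0)%E] =
  ~` survival u.
Proof.
apply/seteqP; split => w /=.
  move=> /ereal_inf_lt[y [t /= + <-]]; rewrite in_itv/= andbT => t0.
  by rewrite lte_fin => lt0 /(_ t t0); rewrite leNgt lt0.
move=> /existsNP[t] /not_implyP[t0 /negP]; rewrite -ltNge => lt0.
apply/ereal_inf_ltP; exists (surplus c N X u t w)%:E; rewrite ?lte_fin//.
by exists t => //=; rewrite in_itv/= t0.
Qed.

Let c0 : 0 < c. Proof. exact: risk_c_gt0 hmodel. Qed.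
Let hN : poisson_process lambda N. Proof. exact: risk_poisson hmodel. Qed.

Section grid.
Context (l : R) (l0 : 0 < l).

(** A step of capital: the time step is [mesh m / c], over which the premium income is [mesh m].
    Repeated halving makes the grids nested and keeps [l] a grid point. *)
Definition mesh (m : nat) : R := l / 2 ^+ m.
Definition grid_count (m k : nat) (w : T) : nat :=
  (N (mesh m / c * k.+1%:R)%R w - N (mesh m / c * k%:R)%R w)%N.
Definition grid_loss (m J : nat) (w : T) : R :=
  maxloss (mesh m) (grid_count m ^~ w) (X ^~ w) 0 0 J.

Lemma mesh_gt0 m : 0 < mesh m.
Proof. by rewrite divr_gt0// exprn_gt0. Qed.

Let h0 m : 0 < mesh m / c. Proof. by rewrite divr_gt0// mesh_gt0. Qed.

Lemma mesh_sum m : (2 ^ m)%:R * mesh m = l.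
Proof. by rewrite /mesh natrX mulrC divfK// expf_neq0// pnatr_eq0. Qed.

Lemma sum_grid_count m j w :
  (\sum_(i < j) grid_count m (0 + i) w = N (mesh m / c * j%:R)%R w)%N.
Proof.
elim: j => [|j IH]; first by rewrite big_ord0 mulr0 (poisson_start hN).
rewrite big_ord_recr/= IH add0n /grid_count subnKC//.
apply: (poisson_nondecreasing hN); first by rewrite mulr_ge0// ltW.
by rewrite ler_pM2l// ler_nat.
Qed.

Lemma grid_lossP m J u w : grid_loss m J w <= u <->
  (forall j, (j <= J)%N -> 0 <= surplus c N X u (mesh m / c * j%:R) w).
Proof.
rewrite -maxlossP; have E j : (\sum_(i < \sum_(l0 < j) grid_count m (0 + l0) w) X (0 + i)%N w
     <= u + mesh m * j%:R) = (0 <= surplus c N X u (mesh m / c * j%:R) w).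
  rewrite sum_grid_count /surplus subr_ge0; congr (_ <= _ + _).
  by rewrite [RHS]mulrA [c * _]mulrC divfK ?gt_eqF//.
by split=> h j jJ; [rewrite -E; exact: h|rewrite E; exact: h].
Qed.

Definition grid_survival m u : set T := \bigcap_J [set w | grid_loss m J w <= u].

Lemma grid_survivalP m u w : grid_survival m u w <->
  forall j, 0 <= surplus c N X u (mesh m / c * j%:R) w.
Proof.
split=> [h j|h J _]; last by apply/grid_lossP => j _.
by have /grid_lossP := h j I; apply.
Qed.

Lemma measurable_grid_count m k : measurable_fun setT (grid_count m k).
Proof. exact: measurable_fun_subn. Qed.

Lemma measurable_grid_loss m J : measurable_fun setT (grid_loss m J).
Proof.
apply: measurable_maxloss => [j _|i _]; first exact: measurable_grid_count.
exact: measurable_funP.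
Qed.

Lemma measurable_grid_survival m u : measurable (grid_survival m u).
Proof.
apply: bigcapT_measurable => J; apply: measurable_rv_le.
exact: measurable_grid_loss.
Qed.

(** Countably many times suffice: if the surplus is negative at [t], no claim occurs just after [t],
    and on a fine grid the next grid time comes before premiums make up the deficit. *)
Lemma survivalE u : survival u = \bigcap_m grid_survival m u.
Proof.
apply/seteqP; split => w.
  move=> h m _; apply/grid_survivalP => j; apply: h.
  by rewrite mulr_ge0// ltW.
move=> h t t0; rewrite leNgt; apply/negP => st.
have rc := poisson_right_continuous hN w t0.
(* The time that premiums at rate [c] need to make up the deficit. *)
pose e := - surplus c N X u t w / c.
have e0 : 0 < e by rewrite divr_gt0// oppr_gt0.
have : \forall s \near t^'+, s < t + e /\ N s w = N t w.
  have lte : \forall s \near t^'+, s < t + e by apply: nbhs_right_lt; rewrite ltrDl.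
  by apply: filterS2 rc lte => s Ns st'.
move=> [r /= r0 hr].
have [m mr] : exists m, mesh m / c < r.
  exists (Num.bound (l / c / r)); set m := Num.bound _.
  have : l / c / r < 2 ^+ m by apply: upper_nthrootP.
  rewrite /mesh !ltr_pdivrMr ?exprn_gt0// => hm.
  by have -> : r * c * 2 ^+ m = 2 ^+ m * r * c by ring.
(* The first grid time strictly after [t]. *)
pose j := (Num.truncn (t / (mesh m / c))).+1.
have tj : t < mesh m / c * j%:R.
  by rewrite mulrC -ltr_pdivrMr//; exact: truncnS_gt.
have jt : mesh m / c * j%:R <= t + mesh m / c.
  rewrite /j -natr1 mulrDr mulr1 lerD2r mulrC -ler_pdivlMr// truncn_le.
  by rewrite divr_ge0// ltW.
have /grid_survivalP/(_ j) := h m I.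
have [] := hr (mesh m / c * j%:R).
- by rewrite /= ltr_distlC; apply/andP; split; lra.
- exact: tj.
move=> je NE; rewrite leNgt => /negP; apply.
have : c * (mesh m / c * j%:R) < c * (t + e) by rewrite ltr_pM2l.
move: st; rewrite /e mulrDr; set q := c * (mesh m / c * _).
rewrite mulrCA divff ?gt_eqF// mulr1.
by rewrite /surplus NE; rewrite -/q; lra.
Qed.

Lemma grid_survival_homo m u : grid_survival m.+1 u `<=` grid_survival m u.
Proof.
move=> w /grid_survivalP h; apply/grid_survivalP => j.
have := h (2 * j)%N; congr (0 <= surplus _ _ _ _ _ _).
rewrite /mesh exprS natrM; field.
by rewrite expf_neq0// gt_eqF.
Qed.

End grid.

Lemma measurable_survival u : measurable (survival u).
Proof.
rewrite (survivalE ltr01); apply: bigcapT_measurable => m.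
exact: measurable_grid_survival.
Qed.

Definition survival_probability u : R := fine (P (survival u)).

Lemma survival_probabilityE u : (survival_probability u)%:E = P (survival u).
Proof. by rewrite fineK// fin_num_measure//; exact: measurable_survival. Qed.

Lemma ruin_probabilityE u :
  ruin_probability c N X u = 1 - survival_probability u.
Proof.
rewrite /ruin_probability ruin_survival probability_setC; last exact: measurable_survival.
by rewrite -survival_probabilityE -EFinB.
Qed.

End survival.

Section renewal.
Context (d : measure_display) (T : measurableType d) (R : realType)
  (P : probability T R) (lambda c mu : R) (FX : R -> R)
  (N : R -> {RV P >-> nat}) (X : nat -> {RV P >-> R})
  (hmodel : classical_risk_model lambda c mu FX N X).
Local Notation leb := (@lebesgue_measure R).

Let c0 : 0 < c. Proof. exact: risk_c_gt0 hmodel. Qed.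
Let lambda0 : 0 < lambda. Proof. exact: risk_lambda_gt0 hmodel. Qed.
Let hN : poisson_process lambda N. Proof. exact: risk_poisson hmodel. Qed.
Local Notation sv := (survival_probability c N X).
Local Notation kappa := (lambda / c).

Lemma claim_cdf i x : P [set w | X i w <= x] = (FX x)%:E.
Proof.
rewrite -(risk_claims_cdf hmodel i) /cdf /distribution /pushforward.
by congr (P _); apply/seteqP; split => w /=; rewrite in_itv.
Qed.

Lemma claim_cdf01 x : 0 <= FX x <= 1.
Proof.
rewrite -!lee_fin -(claim_cdf 0) measure_ge0/=.
by apply: probability_le1; apply: measurable_rv_le; exact: measurable_funP.
Qed.

Lemma measurable_claim_cdf : measurable_fun setT FX.
Proof.
apply: nondecreasing_measurable => // x y xy.
rewrite -lee_fin -!(claim_cdf 0); apply: le_measure; rewrite ?inE.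
- by apply: measurable_rv_le; exact: measurable_funP.
- by apply: measurable_rv_le; exact: measurable_funP.
- by move=> w /= h; exact: le_trans h xy.
Qed.

Lemma survival_probability_homo : {homo sv : u v / u <= v}.
Proof.
move=> u v uv; rewrite -lee_fin !(survival_probabilityE hmodel).
apply: le_measure; rewrite ?inE; [exact: measurable_survival hmodel _|exact: measurable_survival hmodel _|].
by move=> w h t t0; apply: le_trans (h t t0) _; rewrite /surplus !lerD2r.
Qed.

Lemma survival_probability01 u : 0 <= sv u <= 1.
Proof.
rewrite -!lee_fin (survival_probabilityE hmodel) measure_ge0/=.
by apply: probability_le1; exact: measurable_survival hmodel _.
Qed.

Section fixed_horizon.
Context (l : R) (l0 : 0 < l) (m : nat).
Let Y := grid_count c N l m.
Let b := mesh l m.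
Let x := lambda * (b / c).
Let Xf i : T -> R := X i.

Let b0 : 0 < b. Proof. exact: mesh_gt0. Qed.
Let x0 : 0 < x. Proof. by rewrite mulr_gt0// divr_gt0. Qed.
Let xE : x = kappa * b. Proof. by rewrite /x mulrCA mulrC mulrAC mulrA. Qed.

Let mY j : measurable_fun setT (Y j).
Proof. exact: measurable_grid_count. Qed.

Let mX i : measurable_fun setT (Xf i).
Proof. exact: measurable_funP. Qed.

Let iY : mutually_independent P Y.
Proof.
apply: (poisson_independent_increments hN (tau := fun k => b / c * k%:R)).
  by rewrite mulr0.
by move=> i j ij; rewrite ler_pM2l ?divr_gt0// ler_nat.
Qed.

Let iX : mutually_independent P Xf.
Proof. exact: risk_claims_indep hmodel. Qed.

Let Ydist a k : P (Y a @^-1` [set k]) = (poisson_pmf x k)%:E.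
Proof.
have h0 : 0 < b / c by rewrite divr_gt0.
have := poisson_increment hN (s := b / c * a%:R) (t := b / c * a.+1%:R) k.
rewrite -mulrBr -natrB// subSnn mulr1 => -> //; first by rewrite mulr_ge0// ltW.
by rewrite ltr_pM2l// ltr_nat.
Qed.

Let Xdist i y : P [set w | Xf i w <= y] = P [set w | Xf 0%N w <= y].
Proof. by rewrite !claim_cdf. Qed.

Let iYX : independent_sigma P (sigma_family setT Y) (sigma_family setT Xf).
Proof.
move=> A B sA sB; apply: (risk_indep_arrivals_claims hmodel) => //.
move: A sA; apply: smallest_sub.
  exact: (@sigma_algebra_measurable _ (g_sigma_algebraType _)).
pose G := (\bigcup_(t in `[0%R, +oo[%classic) preimage_set_system setT
  (N t : T -> nat) measurable).
have mN t : 0 <= t -> measurable_fun setT (N t : g_sigma_algebraType G -> nat).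
  move=> t0 _ F mF; apply: sub_sigma_algebra; exists t; last by exists F.
  by rewrite /= in_itv/= t0.
have b_ge0 (j : nat) : 0 <= b / c * j%:R.
  by rewrite mulr_ge0// divr_ge0// ltW.
move=> _ [k _ [F mF <-]].
have : measurable_fun setT (Y k : g_sigma_algebraType G -> nat).
  by apply: measurable_fun_subn; exact: mN.
exact.
Qed.

Let Xpos : {ae P, forall w, 0 < Xf 0%N w}.
Proof. exact: (risk_claims_pos hmodel 0). Qed.

Let D J u := gridD P Y Xf b J u.
Let Q J u := gridQ P Y Xf b J u.

Let prob01 (A : set T) : measurable A -> 0 <= fine (P A) <= 1.
Proof.
move=> mA; rewrite -!lee_fin fineK ?fin_num_measure// measure_ge0/=.
exact: probability_le1.
Qed.

Let mW a p J : measurable_fun setT (fun w => maxloss b (Y^~ w) (Xf^~ w) a p J).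
Proof. exact: measurable_maxloss. Qed.

Let mXW J : measurable_fun setT (fun w => Xf 0%N w + maxloss b (Y^~ w) (Xf^~ w) 0 1 J).
Proof. exact: measurable_funD. Qed.

Let rv_homo (V : T -> R) : measurable_fun setT V ->
  {homo (fun u => fine (P [set w | V w <= u])) : u v / u <= v}.
Proof.
move=> mV u v uv; apply: fine_le; rewrite ?fin_num_measure//;
  try exact: measurable_rv_le.
apply: le_measure; rewrite ?inE; try exact: measurable_rv_le.
by move=> w /= h; exact: le_trans h uv.
Qed.

Let cvg_cap (V : nat -> T -> R) u : (forall J, measurable_fun setT (V J)) ->
  (forall w J, V J w <= V J.+1 w) ->
  (fun J => fine (P [set w | V J w <= u])) @ \oo -->
  fine (P (\bigcap_J [set w | V J w <= u])).
Proof.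
move=> mV Vnd; apply: fine_cvg; rewrite fineK; last first.
  by apply: fin_num_measure; apply: bigcapT_measurable => J; exact: measurable_rv_le.
apply: (@nonincreasing_cvg_mu _ _ _ P (fun J => [set w | V J w <= u])).
- by rewrite ltey_eq fin_num_measure//; exact: measurable_rv_le.
- by move=> J; exact: measurable_rv_le.
- by apply: bigcapT_measurable => J; exact: measurable_rv_le.
- apply/nonincreasing_seqP => J; apply/subsetPset => w /=.
  exact: le_trans.
Qed.

Definition grid_survival_probability u := fine (P (grid_survival c N X l m u)).
Local Notation gsv := grid_survival_probability.

Let q v := fine (P (\bigcap_J
  [set w | Xf 0%N w + maxloss b (Y^~ w) (Xf^~ w) 0 1 J <= v])).

Let Dcvg u : (fun J => D J u) @ \oo --> gsv u.
Proof.
apply: (@cvg_cap (fun J w => maxloss b (Y^~ w) (Xf^~ w) 0 0 J)) => // w J.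
exact: maxloss_homo.
Qed.

Let Qcvg u : (fun J => Q J u) @ \oo --> q u.
Proof.
apply: (@cvg_cap (fun J w => Xf 0%N w + maxloss b (Y^~ w) (Xf^~ w) 0 1 J)) => // w J.
by rewrite lerD2l; exact: maxloss_homo.
Qed.

Let D01 J u : 0 <= D J u <= 1.
Proof. by apply: prob01; exact: measurable_rv_le. Qed.

Let Q01 J u : 0 <= Q J u <= 1.
Proof. by apply: prob01; exact: measurable_rv_le. Qed.

Let Dnd J : {homo D J : u v / u <= v}.
Proof. exact: rv_homo. Qed.

Let Qnd J : {homo Q J : u v / u <= v}.
Proof. exact: rv_homo. Qed.

Let step J u : 0 <= u ->
    0 <= D J.+1 u - expR (- x) * D J (u + b) - x * expR (- x) * Q J (u + b)
      <= 1 - expR (- x) - x * expR (- x).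
Proof. exact: gridD_step. Qed.

Let QD J : \int[leb]_(v in `[0, (2 ^ m)%:R * b]) Q J v =
  \int[leb]_(s in `[0, (2 ^ m)%:R * b]) (FX ((2 ^ m)%:R * b - s) * D J s).
Proof.
have := gridQ_integral b mY mX iY iX iYX Ydist Xdist Xpos J ((2 ^ m)%:R * b).
rewrite /Rintegral => ->; congr fine; apply: eq_integral => s _.
by rewrite claim_cdf.
Qed.

Lemma grid_survival_homo_level : {homo gsv : u v / u <= v}.
Proof.
by move=> u v uv; apply: (cvgn_homo (@Dcvg u) (@Dcvg v)) => J; exact: Dnd.
Qed.

Lemma grid_survival_renewal :
  `|gsv l - gsv 0 - kappa * (\int[leb]_(s in `[0, l]) gsv s -
     \int[leb]_(s in `[0, l]) (FX (l - s) * gsv s))|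
  <= (2 * (kappa * l) ^+ 2 + kappa * l) / 2 ^+ m.
Proof.
have := grid_renewal_bound b0 x0 xE D01 Q01 Dnd Qnd Dcvg Qcvg claim_cdf01
  measurable_claim_cdf step QD.
rewrite mesh_sum => /le_trans; apply.
rewrite le_eqVlt; apply/orP; left; apply/eqP.
rewrite xE /b /mesh natrX; field.
by rewrite expf_neq0//= gt_eqF.
Qed.

(** The one-cell increment bound is iterated over the [2 ^ m] cells that make up the increment [l];
    the base point [u] need not be on the grid. *)
Lemma grid_survival_lipschitz u : 0 <= u -> gsv (u + l) - gsv u <= kappa * l.
Proof.
move=> u0.
have H k : gsv (u + k%:R * b) - gsv u <= k%:R * x.
  elim: k => [|k IH]; first by rewrite !mul0r addr0 subrr.
  have u1 : 0 <= u + k%:R * b by rewrite addr_ge0// mulr_ge0// ltW.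
  have := grid_lipschitz x0 D01 Q01 Dcvg step u1.
  have -> : u + k%:R * b + b = u + k.+1%:R * b by rewrite -natr1; ring.
  by rewrite -natr1; lra.
have := H (2 ^ m)%N; rewrite mesh_sum => /le_trans; apply.
by rewrite xE mulrCA mesh_sum.
Qed.

End fixed_horizon.

Lemma cvg_grid_survival l u : 0 < l ->
  (fun m => grid_survival_probability l m u) @ \oo --> sv u.
Proof.
move=> l0; apply: fine_cvg; rewrite fineK; last first.
  by apply: fin_num_measure; exact: measurable_survival hmodel _.
rewrite (survivalE hmodel l0).
apply: (@nonincreasing_cvg_mu _ _ _ P (fun m => grid_survival c N X l m u)).
- by rewrite ltey_eq fin_num_measure//; exact: measurable_grid_survival.
- by move=> m; exact: measurable_grid_survival.
- by apply: bigcapT_measurable => m; exact: measurable_grid_survival.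
- apply/nonincreasing_seqP => m; apply/subsetPset.
  exact: (grid_survival_homo hmodel l0).
Qed.

(** The grids are adapted to the increment [l], then refined. With monotonicity this makes the
    survival probability Lipschitz on the half-line. *)
Lemma survival_probability_lipschitz u l : 0 <= u -> 0 <= l ->
  sv (u + l) - sv u <= kappa * l.
Proof.
move=> u0; rewrite le_eqVlt => /predU1P[<-|l0].
  by rewrite addr0 subrr mulr0.
have cv : (fun m => grid_survival_probability l m (u + l) -
    grid_survival_probability l m u) @ \oo --> sv (u + l) - sv u.
  by apply: cvgB; exact: cvg_grid_survival.
by apply: (cvgn_le cv) => m; exact: grid_survival_lipschitz.
Qed.

Lemma survival_renewal l : 0 <= l ->
  sv l = sv 0 + kappa * \int[leb]_(s in `[0, l]) ((1 - FX (l - s)) * sv s).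
Proof.
rewrite le_eqVlt => /predU1P[<-|l0].
  by rewrite set_itv1 Rintegral_set1 mulr0 addr0.
have msv : measurable_fun `[0, l] sv.
  by apply: nondecreasing_measurable => //; exact: survival_probability_homo.
have mF : measurable_fun `[0, l] (fun s => FX (l - s)).
  apply: measurableT_comp; first exact: measurable_claim_cdf.
  by apply: measurable_funB => //; exact: measurable_id.
have g01 m u : 0 <= grid_survival_probability l m u <= 1.
  rewrite -!lee_fin fineK; last by apply: fin_num_measure; exact: measurable_grid_survival.
  by rewrite measure_ge0/=; apply: probability_le1; exact: measurable_grid_survival.
have mg m : measurable_fun `[0, l] (grid_survival_probability l m).
  by apply: nondecreasing_measurable => //; exact: grid_survival_homo_level.
have i1 : leb.-integrable `[0, l] (EFin \o sv).
  apply: (@itv_bounded_integrable _ _ _ _ 1) => // s _.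
  by have := survival_probability01 s; rewrite ler_norml; lra.
have i2 : leb.-integrable `[0, l] (EFin \o (fun s => FX (l - s) * sv s)).
  apply: (@itv_bounded_integrable _ _ _ _ 1) => [|s _]; first exact: measurable_funM.
  have /andP[? ?] := survival_probability01 s; have /andP[? ?] := claim_cdf01 (l - s).
  by rewrite ger0_norm ?mulr_ge0// mulr_ile1.
have -> : \int[leb]_(s in `[0, l]) ((1 - FX (l - s)) * sv s) =
    \int[leb]_(s in `[0, l]) sv s - \int[leb]_(s in `[0, l]) (FX (l - s) * sv s).
  by rewrite -RintegralB//; apply: eq_Rintegral => s _; rewrite mulrBl mul1r.
have c1 : (fun m => \int[leb]_(s in `[0, l]) grid_survival_probability l m s) @ \oo
    --> \int[leb]_(s in `[0, l]) sv s.
  apply: (@Rintegral_itv_dominated _ _ _ _ _ 1) => [//|s _|m s _].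
    exact: cvg_grid_survival.
  by have := g01 m s; rewrite ler_norml; lra.
have c2 : (fun m => \int[leb]_(s in `[0, l]) (FX (l - s) * grid_survival_probability l m s))
    @ \oo --> \int[leb]_(s in `[0, l]) (FX (l - s) * sv s).
  apply: (@Rintegral_itv_dominated _ _ _ _ _ 1) => [m|s _|m s _].
  - exact: measurable_funM.
  - by apply: cvgMr; exact: cvg_grid_survival.
  - have /andP[? ?] := g01 m s; have /andP[? ?] := claim_cdf01 (l - s).
    by rewrite ger0_norm ?mulr_ge0// mulr_ile1.
(* This quantity is the limit in [m] of the grid defects, which [grid_survival_renewal] bounds by a
   constant over [2 ^+ m]. *)
set A := (X in sv l = _ + _ * X); suff : `|sv l - sv 0 - kappa * A| <= 0.
  by rewrite normr_le0 => /eqP; lra.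
have c3 : (fun m => `|grid_survival_probability l m l - grid_survival_probability l m 0 -
   kappa * (\int[leb]_(s in `[0, l]) grid_survival_probability l m s -
     \int[leb]_(s in `[0, l]) (FX (l - s) * grid_survival_probability l m s))|) @ \oo -->
   `|sv l - sv 0 - kappa * A|.
  apply: cvg_norm; apply: cvgB.
    by apply: cvgB; exact: cvg_grid_survival.
  by apply: cvgMr; exact: cvgB.
have c4 : (fun m => (2 * (kappa * l) ^+ 2 + kappa * l) / 2 ^+ m) @ \oo --> (0 : R).
  rewrite -(mulr0 (2 * (kappa * l) ^+ 2 + kappa * l)); apply: cvgMr.
  under eq_fun do rewrite -exprVn.
  by apply: cvg_expr; rewrite ger0_norm ?invr_ge0// invf_lt1// ltr1n.
apply: (cvgn_homo c3 c4) => m; exact: grid_survival_renewal.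
Qed.

End renewal.

(** * Convolutions and primitives on the half-line *)

Section reflection.
Context (R : realType).
Local Notation mu := (@lebesgue_measure R).

(** A named function, so that a measurable-function instance can be attached to it for the change of
    variables in convolutions. *)
Definition mirror (c : R) (x : measurableTypeR R) : measurableTypeR R := c - x.

Lemma measurable_reflect (c : R) : measurable_fun setT (mirror c).
Proof. by apply: measurable_funB => //; exact: measurable_id. Qed.

HB.instance Definition _ (c : R) :=
  isMeasurableFun.Build _ _ _ _ (mirror c) (@measurable_reflect c).

Lemma lebesgue_measure_reflect (c : R) (A : set R) : measurable A ->
  pushforward mu (mirror c) A = mu A.
Proof.
move=> mA; apply/esym/lebesgue_measure_unique => //= _ [[a b]] _ <-.
rewrite /pushforward/=.
have -> : mirror c @^-1` `]a, b] = `[c - b, c - a[%classic.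
  by apply/seteqP; split => x; rewrite /mirror/= !in_itv/= => /andP[? ?]; apply/andP; split; lra.
rewrite !lebesgue_measure_itv/= !lte_fin.
have -> : (c - b < c - a) = (a < b) by lra.
by case: ifP => // _; rewrite -!EFinB; congr EFin; ring.
Qed.

Lemma ge0_integral_reflect (c : R) (D : set R) (f : R -> \bar R) : measurable D ->
  measurable_fun D f -> (forall x, D x -> 0 <= f x)%E ->
  (\int[mu]_(x in mirror c @^-1` D) f (c - x)%R = \int[mu]_(x in D) f x)%E.
Proof.
move=> mD mf f0; rewrite -(@ge0_integral_pushforward _ _ _ _ _ _ (measurable_reflect c) mu)//=.
- by apply: eq_measure_integral => A mA _; exact: lebesgue_measure_reflect.
- by move=> x; rewrite inE; exact: f0.
Qed.

Lemma integral_reflect (c : R) (D : set R) (f : R -> \bar R) : measurable D ->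
  measurable_fun D f ->
  (\int[mu]_(x in mirror c @^-1` D) f (c - x)%R = \int[mu]_(x in D) f x)%E.
Proof.
move=> mD mf; rewrite integralE [RHS]integralE; congr (_ - _)%E.
- have := @ge0_integral_reflect c D (f^\+)%E mD (measurable_funepos mf).
  by move=> <- //; apply: eq_integral => x _; rewrite ?funeposE ?funenegE.
- have := @ge0_integral_reflect c D (f^\-)%E mD (measurable_funeneg mf).
  by move=> <- //; apply: eq_integral => x _; rewrite ?funeposE ?funenegE.
Qed.

Lemma reflect_preimage_itv (c a b : R) :
  mirror c @^-1` `[a, b] = `[c - b, c - a]%classic.
Proof.
by apply/seteqP; split => x; rewrite /mirror/= !in_itv/= => /andP[? ?]; apply/andP; split; lra.
Qed.

Lemma Rintegral_reflect (c a b : R) (f : R -> R) : measurable_fun `[a, b] f ->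
  \int[mu]_(x in `[c - b, c - a]) f (c - x) = \int[mu]_(x in `[a, b]) f x.
Proof.
move=> mf; rewrite /Rintegral -reflect_preimage_itv.
rewrite (@integral_reflect c `[a, b] (EFin \o f))//.
exact/measurable_EFinP.
Qed.

Lemma measurable_fun_reflect (c a b : R) (f : R -> R) : measurable_fun `[a, b] f ->
  measurable_fun `[c - b, c - a] (fun x => f (c - x)).
Proof.
move=> mf; apply: (measurable_comp _ _ mf) => //.
  by move=> y [x /= + <-]; rewrite !in_itv/= => /andP[? ?]; apply/andP; split; lra.
by apply: measurable_funB => //; exact: measurable_id.
Qed.

Lemma integrable_reflect (c a b : R) (f : R -> R) :
  mu.-integrable `[a, b] (EFin \o f) ->
  mu.-integrable `[c - b, c - a] (EFin \o (fun x => f (c - x))).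
Proof.
move=> /integrableP[/measurable_EFinP mf fi]; apply/integrableP; split.
  by apply/measurable_EFinP; exact: measurable_fun_reflect.
rewrite -reflect_preimage_itv.
rewrite (@integral_reflect c `[a, b] (fun x => `|(f x)%:E|)%E)//.
by apply: measurableT_comp => //; exact/measurable_EFinP.
Qed.

End reflection.

Section convolution.
Context (R : realType).
Local Notation mu := (@lebesgue_measure R).
Implicit Types (a b f : R -> R) (u v : R).

Definition convol a b u := \int[mu]_(y in `[0, u]) (a (u - y) * b y).
Definition prim a u := \int[mu]_(y in `[0, u]) a y.
Definition locint a := forall u, mu.-integrable `[0, u] (EFin \o a).

Lemma convC a b u : measurable_fun `[0, u] a -> measurable_fun `[0, u] b ->
  convol a b u = convol b a u.
Proof.
move=> ma mb; rewrite /convol -(@Rintegral_reflect _ u 0 u); last first.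
  apply: measurable_funM => //.
  by have := @measurable_fun_reflect _ u _ _ _ ma; rewrite subrr subr0.
rewrite subrr subr0; apply: eq_Rintegral => y _.
by rewrite mulrC; congr (_ * _); congr a; ring.
Qed.

Lemma Rintegral_translate a (s u : R) : measurable_fun `[0, u - s] a ->
  \int[mu]_(v in `[s, u]) a (v - s) = prim a (u - s).
Proof.
move=> ma; have m2 : measurable_fun `[s, u] (fun v => a (v - s)).
  have -> : (fun v => a (v - s)) = (fun v => a ((u - s) - (u - v))).
    by apply/funext => v; congr a; ring.
  have m1 := @measurable_fun_reflect _ (u - s) _ _ _ ma.
  rewrite subrr subr0 in m1.
  have := @measurable_fun_reflect _ u _ _ _ m1; have -> : u - (u - s) = s by ring.
  by rewrite subr0.
rewrite -(@Rintegral_reflect _ u)// subrr /prim.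
rewrite -(@Rintegral_reflect _ (u - s) 0 (u - s) a)// subrr subr0.
by apply: eq_Rintegral => z _; congr a; ring.
Qed.

Let trunc u a v : R := (a \_ `[0%R, u]) v.

(** The convolution integrand [a (v - y) * b y] on the triangle [0 <= y <= v <= u], extended by 0 so
    that Fubini can be used on the whole plane. *)
Let kernel a b u (z : R * R) : R :=
  \1_(`]-oo, u]%classic : set R) z.1 * trunc u a (z.1 - z.2) * trunc u b z.2.

Let measurable_trunc u a : measurable_fun `[0, u] a -> measurable_fun setT (trunc u a).
Proof.
move=> ma; have mD : measurable (`[0, u]%classic : set R) by [].
exact: (measurable_restrictT a mD).1 ma.
Qed.

Let measurable_kernel a b u : measurable_fun `[0, u] a -> measurable_fun `[0, u] b ->
  measurable_fun setT (kernel a b u).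
Proof.
move=> ma mb; apply: measurable_funM; first apply: measurable_funM.
- by apply: (measurableT_comp (measurable_indic _)) => //; exact: measurable_fst.
- apply: (measurableT_comp (measurable_trunc ma)).
  by apply: measurable_funB; [exact: measurable_fst|exact: measurable_snd].
- by apply: (measurableT_comp (measurable_trunc mb)); exact: measurable_snd.
Qed.

Let kernel_left a b u y v : kernel a b u (v, y) =
  if 0 <= y <= u then ((fun v => a (v - y) * b y) \_ `[y, u]) v else 0.
Proof.
have pt0 : point = 0 :> R by [].
rewrite /kernel /trunc !patchE/= !mem_setE !indicE mem_setE/= !in_itv/= !pt0.
case: (boolP (0 <= y <= u)) => yu; last by rewrite mulr0.
case: (boolP (0 <= v - y <= u)) => h1; case: (boolP (y <= v <= u)) => h2;
  case: (boolP (v <= u)) => h3; rewrite ?mul1r ?mul0r ?mulr0 ?mul0r//; exfalso; lra.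
Qed.

Let kernel_right a b u y v : kernel a b u (v, y) =
  if 0 <= v <= u then ((fun y => a (v - y) * b y) \_ `[0, v]) y else 0.
Proof.
have pt0 : point = 0 :> R by [].
rewrite /kernel /trunc !patchE/= !mem_setE !indicE mem_setE/= !in_itv/= !pt0.
case: (boolP (0 <= v <= u)) => vu; case: (boolP (0 <= y <= u)) => yu;
case: (boolP (0 <= v - y <= u)) => h1; case: (boolP (0 <= y <= v)) => h2;
  case: (boolP (v <= u)) => h3; rewrite ?mul1r ?mul0r ?mulr0 ?mul0r//; exfalso; lra.
Qed.

Let EFin_Rintegral f D : measurable D -> mu.-integrable D (EFin \o f) ->
  (\int[mu]_(x in D) (f x)%:E = (\int[mu]_(x in D) f x)%:E)%E.
Proof. by move=> mD fi; rewrite /Rintegral fineK//; exact: integrable_fin_num. Qed.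

Let integrable_shift a u y : 0 <= y <= u -> mu.-integrable `[0, u] (EFin \o a) ->
  mu.-integrable `[y, u] (EFin \o (fun v => a (v - y))).
Proof.
move=> yu ai.
have i0 : mu.-integrable `[0, u - y] (EFin \o a).
  by apply: integrableS ai => //; apply: subset_itvl; rewrite bnd_simp; lra.
have := integrable_reflect u (integrable_reflect (u - y) i0).
rewrite subrr !subr0; have -> : u - (u - y) = y by ring.
by congr (_.-integrable _ _); apply/funext => v /=; congr (a _)%:E; ring.
Qed.

Let kernel_int_left a b u y :
  mu.-integrable `[0, u] (EFin \o a) ->
  (\int[mu]_v (kernel a b u (v, y))%:E =
   (if (0 <= y <= u)%R then (prim a (u - y) * b y)%:E else 0))%E.
Proof.
move=> ai; under eq_integral do rewrite kernel_left.
case: ifPn => yu; last by rewrite integral0.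
have iy := integrable_shift yu ai.
transitivity (\int[mu]_(v in `[y, u]) (a (v - y) * b y)%R%:E)%E.
  rewrite [RHS]integral_mkcond; apply: eq_integral => v _.
  by rewrite !patchE; case: ifP.
rewrite EFin_Rintegral//; last first.
  have -> : EFin \o (fun v => a (v - y) * b y) = (fun v => (EFin \o (fun v => a (v - y)%R)) v * (b y)%:E)%E.
    by apply/funext => v /=; rewrite EFinM.
  exact: integrableZr.
rewrite RintegralZr// Rintegral_translate//.
have i0 : mu.-integrable `[0, u - y] (EFin \o a).
  by apply: integrableS ai => //; apply: subset_itvl; rewrite bnd_simp; lra.
by apply/measurable_EFinP; exact: (measurable_int _ i0).
Qed.

(** Fubini on the triangle. Neither factor is assumed bounded, which leaves room for a singularity
    at 0. *)
Lemma prim_conv a b u :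
  mu.-integrable `[0, u] (EFin \o a) -> mu.-integrable `[0, u] (EFin \o b) ->
  (forall v, 0 <= v <= u ->
    mu.-integrable `[0, v] (EFin \o (fun y => a (v - y) * b y))) ->
  prim (convol a b) u = convol (prim a) b u.
Proof.
move=> ai bi abi.
have ma : measurable_fun `[0, u] a by apply/measurable_EFinP; exact: (measurable_int _ ai).
have mb : measurable_fun `[0, u] b by apply/measurable_EFinP; exact: (measurable_int _ bi).
have mK := measurable_kernel ma mb.
have nai : mu.-integrable `[0, u] (EFin \o (fun x => `|a x|)) by exact: integrable_norm.
have nbi : mu.-integrable `[0, u] (EFin \o (fun x => `|b x|)) by exact: integrable_norm.
have Kabs z : `|kernel a b u z| = kernel (fun x => `|a x|) (fun x => `|b x|) u z.
  rewrite /kernel !normrM; congr (_ * _ * _).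
  - by rewrite ger0_norm.
  - by rewrite /trunc !patchE; case: ifP => //; rewrite normr0.
  - by rewrite /trunc !patchE; case: ifP => //; rewrite normr0.
(* By Tonelli: the iterated integral of the absolute value is at most the product of the integrals
   of [|a|] and [|b|] over [[0, u]]. *)
have Ki : (mu \x mu)%E.-integrable setT (EFin \o kernel a b u).
  apply/integrable21ltyP; first exact/measurable_EFinP.
  under eq_integral => y _.
    under eq_integral => v _ do rewrite /= Kabs.
    rewrite kernel_int_left//; over.
  apply: (@le_lt_trans _ _ (\int[mu]_(y in `[0%R, u])
      (prim (fun x => `|a x|) u * `|b y|)%R%:E)%E).
    rewrite [leRHS]integral_mkcond; apply: ge0_le_integral => //=.
    + move=> y _; case: ifP => // _; rewrite lee_fin mulr_ge0//.
      exact: Rintegral_ge0.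
    + have := measurable_fun_fubini_tonelli_G (m1 := mu)
        (fun z => (kernel (fun x => `|a x|) (fun x => `|b x|) u z)%:E).
      have -> : fubini_G mu (fun z => (kernel (fun x => `|a x|) (fun x => `|b x|) u z)%:E) =
          (fun y => if (0 <= y <= u)%R then (prim (fun x => `|a x|) (u - y) * `|b y|)%:E else 0%E).
        by apply/funext => y; exact: kernel_int_left.
      apply.
        apply/measurable_EFinP; apply: measurable_kernel; exact: measurableT_comp.
      by move=> z; rewrite lee_fin -Kabs.
    + apply: (measurable_restrictT _ _).1 => //; apply/measurable_EFinP.
      by apply: measurable_funM => //; exact: measurableT_comp.
    + move=> y _; rewrite patchE mem_setE/= in_itv/=; case: ifP => // yu.
      rewrite lee_fin ler_wpM2r// /prim [leRHS](@Rintegral_itv_split _ _ _ (u - y))//; try lra.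
      by rewrite lerDl; exact: Rintegral_ge0.
  have : mu.-integrable `[0, u] (EFin \o (fun y => prim (fun x => `|a x|) u * `|b y|)).
    have -> : EFin \o (fun y => prim (fun x => `|a x|) u * `|b y|) =
      (fun y => (prim (fun x => `|a x|%R) u)%:E * (EFin \o (fun x => `|b x|%R)) y)%E.
      by apply/funext => y /=; rewrite EFinM.
    exact: integrableZl.
  move=> /integrable_fin_num h; have := h _; rewrite ltey_eq => -> //.
have := @Fubini _ _ _ _ R mu mu _ Ki.
have -> : (\int[mu]_y \int[mu]_v (EFin \o kernel a b u) (v, y) =
    \int[mu]_(y in `[0%R, u]) (prim a (u - y)%R * b y)%:E)%E.
  rewrite [RHS]integral_mkcond; apply: eq_integral => y _.
  by rewrite /= kernel_int_left// patchE mem_setE/= in_itv/=.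
have -> : (\int[mu]_v \int[mu]_y (EFin \o kernel a b u) (v, y) =
    \int[mu]_(v in `[0%R, u]) (convol a b v)%:E)%E.
  rewrite [RHS]integral_mkcond; apply: eq_integral => v _.
  under eq_integral do rewrite /= kernel_right.
  rewrite patchE mem_setE/= in_itv/=; case: ifP => vu; last by rewrite integral0.
  rewrite -EFin_Rintegral//; last exact: abi.
  rewrite [RHS]integral_mkcond; apply: eq_integral => y _.
  by rewrite !patchE; case: ifP.
by rewrite /prim /convol /Rintegral => ->.
Qed.

End convolution.

Section continuity_tools.
Context (R : realType).
Implicit Types (f g : R -> R) (c : R).

Lemma continuous_compose f g : continuous f -> continuous g ->
  continuous (fun x => f (g x)).
Proof. by move=> cf cg x; apply: continuous_comp; [exact: cg|exact: cf]. Qed.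

Lemma continuous_reflect c : continuous (fun x : R => c - x).
Proof. by move=> x; apply: cvgB; [exact: cvg_cst|exact: cvg_id]. Qed.

Lemma continuous_addl c : continuous (fun x : R => c + x).
Proof. by move=> x; apply: cvgD; [exact: cvg_cst|exact: cvg_id]. Qed.

Lemma continuous_max0 : continuous (fun x : R => Num.max x 0).
Proof.
by move=> x; apply: (@continuous_max _ _ id (fun=> 0)); [exact: cvg_id|exact: cvg_cst].
Qed.

Lemma continuous_expRM c : continuous (fun x : R => expR (c * x)).
Proof.
apply: continuous_compose; first exact: continuous_expR.
by move=> x; apply: cvgMr; exact: cvg_id.
Qed.

End continuity_tools.

Section primitives.
Context (R : realType).
Local Notation mu := (@lebesgue_measure R).
Implicit Types (a b f : R -> R) (u v c : R).

Lemma continuous_locint a : continuous a -> locint a.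
Proof.
move=> ca u; apply: itv_continuous_integrable.
exact: continuous_subspaceT.
Qed.

Lemma locint_measurable a u : locint a -> measurable_fun `[0, u] a.
Proof. by move=> ai; apply/measurable_EFinP; exact: (measurable_int _ (ai u)). Qed.

Lemma locintD a b : locint a -> locint b -> locint (fun y => a y + b y).
Proof.
move=> ai bi u.
have -> : EFin \o (fun y => a y + b y) = (EFin \o a) \+ (EFin \o b) by apply/funext.
exact: integrableD (ai u) (bi u).
Qed.

Lemma locintZ c a : locint a -> locint (fun y => c * a y).
Proof.
move=> ai u.
have -> : EFin \o (fun y => c * a y) = (fun y => c%:E * (EFin \o a) y)%E by apply/funext.
exact: integrableZl (ai u).
Qed.

Lemma locint_norm a : locint a -> locint (fun y => `|a y|).
Proof. by move=> ai u; exact: integrable_norm (ai u). Qed.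

Lemma primD a b u : locint a -> locint b ->
  prim (fun y => a y + b y) u = prim a u + prim b u.
Proof. by move=> ai bi; rewrite /prim RintegralD. Qed.

Lemma primZ c a u : locint a -> prim (fun y => c * a y) u = c * prim a u.
Proof. by move=> ai; rewrite /prim RintegralZl. Qed.

Lemma prim_neg a u : u < 0 -> prim a u = 0.
Proof.
move=> u0; rewrite /prim set_itv_ge ?Rintegral_set0//.
by rewrite bnd_simp -ltNge.
Qed.

Lemma prim0 a : prim a 0 = 0.
Proof. by rewrite /prim set_itv1 Rintegral_set1. Qed.

Lemma eq_prim a b u : (forall y, 0 <= y <= u -> a y = b y) -> prim a u = prim b u.
Proof.
move=> ab; apply: eq_Rintegral => y; rewrite inE/= in_itv/=; exact: ab.
Qed.

Lemma eq_conv a a' b b' u : (forall y, 0 <= y <= u -> a y = a' y) ->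
  (forall y, 0 <= y <= u -> b y = b' y) -> convol a b u = convol a' b' u.
Proof.
move=> aa bb; apply: eq_Rintegral => y; rewrite inE/= in_itv/= => /andP[? ?].
by rewrite aa ?bb//; lra.
Qed.

Lemma prim_derive a u : locint a -> 0 < u -> {for u, continuous a} ->
  is_derive u (1 : R) (prim a) (a u).
Proof.
move=> ai u0 ca.
have uu : u < u + 1 by rewrite ltrDl.
have [d e] := @continuous_FTC1_closed R a 0 u (u + 1) uu (ai _) u0 ca.
by apply: DeriveDef; [exact: d|rewrite -derive1E e].
Qed.

Lemma prim_continuous a : locint a -> continuous (prim a).
Proof.
move=> ai u; have [u0|u0|->] := ltgtP u 0.
- apply: (@near_cst_continuous _ _ 0); near=> v; apply: prim_neg.
  by near: v; exact: lt_nbhsl.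
- have ui : u \in `]0, (u + 1)[ by rewrite in_itv/= u0 ltrDl ltr01.
  have u1 : 0 < u + 1 by rewrite addr_gt0.
  exact: (within_continuous_continuous u1
    (parameterized_integral_continuous (ltW u1) (ai _)) ui).
- suff : prim a x @[x --> (0 : R)] --> prim a 0 by [].
  rewrite prim0.
  exact: (@parameterized_integral_cvg_left R 0 1 a ltr01 (ai 1)).
Unshelve. all: by end_near. Qed.

Lemma continuous_itv_bounded a u v : continuous a ->
  exists2 M, 0 <= M & forall y, u <= y <= v -> `|a y| <= M.
Proof.
move=> ca; have [M [_ hM]] : bounded_set (a @` `[u, v]%classic).
  apply: compact_bounded.
  apply: continuous_compact; last exact: segment_compact.
  exact: continuous_subspaceT.
exists (`|M| + 1); first by rewrite addr_ge0.
move=> y yuv; apply: hM; first by rewrite (le_lt_trans (ler_norm M))// ltrDl.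
by exists y => //=; rewrite in_itv.
Qed.

Lemma integrable_conv a b v : continuous a -> locint b ->
  mu.-integrable `[0, v] (EFin \o (fun y => a (v - y) * b y)).
Proof.
move=> ca bi; have [M M0 hM] := continuous_itv_bounded 0 v ca.
have ca' : continuous (fun y => a (v - y)).
  exact: continuous_compose ca (@continuous_reflect _ v).
apply: (@le_integrable _ _ _ mu _ _ _ (EFin \o (fun y => M * `|b y|))) => //.
- apply/measurable_EFinP; apply: measurable_funM; last exact: locint_measurable.
  by apply: measurable_funTS; apply: continuous_measurable_fun; exact: ca'.
- move=> y /=; rewrite in_itv/= => /andP[y0 yv]; rewrite lee_fin normrM.
  rewrite [leRHS]ger0_norm ?mulr_ge0//; apply: ler_wpM2r => //.
  by apply: hM; lra.
- exact: (locintZ _ (locint_norm bi)).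
Qed.

(** Differentiates a convolution through its second factor, whose derivative [b] may be singular at
    0. *)
Lemma conv_primr a b u : continuous a -> locint b ->
  convol a (prim b) u = prim (convol a b) u.
Proof.
move=> ca bi; have ai := continuous_locint ca.
have cp := prim_continuous bi.
rewrite convC; last 2 first.
- exact: locint_measurable.
- by apply: locint_measurable; exact: continuous_locint cp.
have H v : 0 <= v <= u ->
    mu.-integrable `[0, v] (EFin \o (fun y => b (v - y) * a y)).
  move=> _; have := integrable_reflect v (integrable_conv v ca bi); rewrite subrr subr0.
  congr (_.-integrable _ _); apply/funext => y /=; congr EFin.
  by rewrite mulrC; congr (_ * a _); ring.
rewrite -(prim_conv (bi u) (ai u) H).
apply: eq_prim => v _; rewrite convC//; exact: locint_measurable.
Qed.

Lemma conv_priml a b u : continuous a -> locint b ->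
  convol (prim a) b u = prim (convol a b) u.
Proof.
move=> ca bi; rewrite prim_conv//; [exact: continuous_locint|].
by move=> v _; exact: integrable_conv.
Qed.

Lemma conv_cstr a c u : locint a -> convol a (fun=> c) u = c * prim a u.
Proof.
move=> ai; rewrite convC; [|exact: locint_measurable|exact: measurable_cst].
by rewrite /convol -primZ.
Qed.

Lemma convDr a b b' u : continuous a -> locint b -> locint b' ->
  convol a (fun y => b y + b' y) u = convol a b u + convol a b' u.
Proof.
move=> ca bi bi'; rewrite /convol -RintegralD//; [|exact: integrable_conv|exact: integrable_conv].
by apply: eq_Rintegral => y _; rewrite mulrDr.
Qed.

Lemma convDl a a' b u : continuous a -> continuous a' -> locint b ->
  convol (fun y => a y + a' y) b u = convol a b u + convol a' b u.
Proof.
move=> ca ca' bi; rewrite /convol -RintegralD//; [|exact: integrable_conv|exact: integrable_conv].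
by apply: eq_Rintegral => y _; rewrite mulrDl.
Qed.

Lemma conv_cstl b c u : locint b -> convol (fun=> c) b u = c * prim b u.
Proof. by move=> bi; rewrite /convol -primZ. Qed.

(** The domain of integration moves with [u]. Subtracting [a 0] and extending by 0 to negative
    arguments gives a continuous integrand on a fixed interval; the subtracted part is a multiple of
    [prim b]. *)
Lemma conv_continuous a b : continuous a -> locint b -> continuous (convol a b).
Proof.
move=> ca bi u0.
pose M := `|u0| + 1.
have M0 : 0 < M by rewrite ltr_wpDl.
(* Continuous and zero for [s <= 0], so points [y > u] contribute nothing. *)
pose at0 (s : R) := a (Num.max s 0) - a 0.
have cat0 : continuous at0.
  have cm := continuous_compose ca (@continuous_max0 R).
  by move=> s; exact: (cvgB (cm s) (cvg_cst _)).
have cat u : continuous (fun y => at0 (u - y)).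
  exact: continuous_compose cat0 (@continuous_reflect _ u).
have iat u v : mu.-integrable `[0, v] (EFin \o (fun y => at0 (u - y) * b y)).
  have c1 : continuous (fun z => at0 (u - v + z)).
    exact: continuous_compose cat0 (@continuous_addl _ (u - v)).
  have := integrable_conv v c1 bi.
  by congr (_.-integrable _ _); apply/funext => y /=; congr (at0 _ * _)%:E; ring.
have at0_neg s : s <= 0 -> at0 s = 0.
  by move=> s0; rewrite /at0; have /max_idPr -> := s0; rewrite subrr.
have at0_pos s : 0 <= s -> at0 s = a s - a 0.
  by move=> s0; rewrite /at0; have /max_idPl -> := s0.
pose F u := \int[mu]_(y in `[0, M]) (at0 (u - y) * b y).
have E u : u \in `]-M, M[ -> convol a b u = F u + a 0 * prim b u.
  rewrite in_itv/= => /andP[Mu uM].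
  have [u_neg|u_pos] := ltP u 0.
    rewrite (prim_neg _ u_neg) mulr0 addr0 /convol set_itv_ge ?Rintegral_set0; last first.
      by rewrite bnd_simp -ltNge.
    rewrite /F (@eq_Rintegral _ _ _ mu _ (fun=> 0)) ?Rintegral_itv_cst ?mul0r// ?ltW//.
    by move=> y; rewrite inE/= in_itv/= => /andP[y0 _]; rewrite at0_neg ?mul0r//; lra.
  rewrite /F (Rintegral_itv_split u_pos (ltW uM) (iat u M)).
  rewrite [X in _ + X + _](@eq_Rintegral _ _ _ mu _ (fun=> 0)); last first.
    by move=> y; rewrite inE/= in_itv/= => /andP[uy _]; rewrite at0_neg ?mul0r//; lra.
  rewrite Rintegral_itv_cst ?mul0r ?addr0// ?(ltW uM)// -primZ// /prim -RintegralD//; last exact: (locintZ _ bi).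
  apply: eq_Rintegral => y; rewrite inE/= in_itv/= => /andP[y0 yu].
  by rewrite at0_pos; [ring|lra].
have Iu0 : u0 \in `]-M, M[.
  by rewrite in_itv/= -ltr_norml /M ltrDl.
have [C C0 hC] := continuous_itv_bounded (- (2 * M)) (2 * M) cat0.
have cF : {for u0, continuous F}.
  have := @continuity_under_integral R _ _ mu (fun u y => at0 (u - y) * b y) `[0, M]
    _ (- M) M _ _ (fun y => C * `|b y|) _ _ u0.
  apply => //.
  - apply: aeW => y _ u _; apply: cvgMl.
    have cs : {for u, continuous (fun u => u - y)}.
      by apply: cvgB; [exact: cvg_id|exact: cvg_cst].
    exact: (@continuous_comp _ _ _ (fun u => u - y) at0 u cs (@cat0 _)).
  - exact: (locintZ _ (locint_norm bi)).
  - move=> u; rewrite /= in_itv/= => /andP[u1 u2]; apply: aeW => y; rewrite /= in_itv/= => /andP[y0 yM].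
    by rewrite normrM ler_wpM2r// hC//; lra.
  - by rewrite inE.
suff : convol a b x @[x --> u0] --> convol a b u0 by [].
rewrite (E u0 Iu0).
have c2 : {for u0, continuous (fun u => F u + a 0 * prim b u)}.
  by apply: cvgD; [exact: cF|apply: cvgMr; exact: prim_continuous].
apply: cvg_trans c2; apply: near_eq_cvg; near=> u; apply/esym/E.
by near: u; exact: near_in_itvoo.
Unshelve. all: by end_near. Qed.

(** Young's inequality, sup norm against an integral, survives an exponential weight because
    [expR (g * u)] factors as [expR (g * (u - y)) * expR (g * y)]. *)
Lemma conv_le a b u (g A I : R) : continuous a -> locint b -> 0 <= A ->
  (forall y, 0 <= y <= u -> `|a y| * expR (g * y) <= A) ->
  prim (fun y => `|b y| * expR (g * y)) u <= I ->
  `|convol a b u| * expR (g * u) <= A * I.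
Proof.
move=> ca bi A0 hA hI.
have cexp : continuous (fun y => expR (g * y)).
  exact: continuous_expRM.
have bei : locint (fun y => `|b y| * expR (g * y)).
  move=> v; have c1 : continuous (fun y => expR (g * (v - y))).
    exact: continuous_compose cexp (@continuous_reflect _ v).
  have := integrable_conv v c1 (locint_norm bi).
  congr (_.-integrable _ _); apply/funext => y /=; congr EFin.
  by rewrite mulrC; congr (_ * expR (g * _)); ring.
have hi := integrable_conv u ca bi.
apply: (@le_trans _ _ (expR (g * u) * \int[mu]_(y in `[0, u]) `|a (u - y) * b y|)).
  by rewrite mulrC ler_wpM2l ?expR_ge0//; exact: le_normr_Rintegral.
have ni := integrable_norm hi.
rewrite -RintegralZl//; apply: (@le_trans _ _ (A * prim (fun y => `|b y| * expR (g * y)) u)).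
  rewrite -primZ//; apply: le_Rintegral => //.
  - have -> : EFin \o (fun y => expR (g * u) * `|a (u - y) * b y|) =
      (fun y => (expR (g * u))%:E * (EFin \o (fun y => `|a (u - y) * b y|%R)) y)%E.
      by apply/funext => y /=; rewrite EFinM.
    exact: integrableZl.
  - exact: (locintZ _ bei).
  - move=> y /=; rewrite in_itv/= => /andP[y0 yu].
    have -> : expR (g * u) = expR (g * (u - y)) * expR (g * y).
      by rewrite -expRD; congr expR; ring.
    rewrite normrM.
    have -> : expR (g * (u - y)) * expR (g * y) * (`|a (u - y)| * `|b y|) =
       (`|a (u - y)| * expR (g * (u - y))) * (`|b y| * expR (g * y)) by ring.
    apply: ler_wpM2r; first by rewrite mulr_ge0// expR_ge0.
    by apply: hA; lra.
exact: ler_wpM2l.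
Qed.

End primitives.

Section singular_primitive.
Context (R : realType).
Local Notation mu := (@lebesgue_measure R).
Implicit Types (b B : R -> R) (u : R).

Lemma is_derive_continuous b u l : is_derive u (1 : R) b l -> {for u, continuous b}.
Proof.
by move=> db; apply/differentiable_continuous/derivable1_diffP; exact: ex_derive.
Qed.

(* Fundamental theorem of calculus for a derivative that may blow up at 0. *)
Lemma singular_FTC b B : continuous B ->
  (forall u, 0 < u -> is_derive u (1 : R) B (b u)) ->
  (forall u, 0 < u -> {for u, continuous b}) ->
  (forall u, 0 <= u -> 0 <= b u) ->
  locint b /\ (forall u, 0 <= u -> prim b u = B u - B 0).
Proof.
move=> cB dB cb b0.
have mb0 : measurable_fun (`]0, +oo[%classic : set R) b.
  apply: open_continuous_measurable_fun; first exact: interval_open.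
  by move=> y; rewrite inE/= in_itv/= andbT; exact: cb.
have mb u : measurable_fun `]0, u] b.
  by apply: measurable_funS mb0 => //; apply: subset_itvl; rewrite bnd_simp.
suff H u : 0 < u -> (\int[mu]_(y in `[0%R, u]) (b y)%:E = (B u - B 0)%:E)%E.
  split=> [u|u u0].
  - have [u0|u0|->] := ltgtP u 0.
    + rewrite set_itv_ge ?bnd_simp -?ltNge//; exact: integrable_set0.
    + apply/integrableP; split.
        by apply/measurable_EFinP/measurable_fun_itv_obnd_cbndP.
      rewrite (@eq_integral _ _ _ mu _ (fun y => (b y)%:E)); first by rewrite H// ltry.
      by move=> y; rewrite inE/= in_itv/= => /andP[y0 _]; rewrite ger0_norm// b0.
    + rewrite set_itv1; apply/integrableP; split.
        exact/measurable_EFinP/measurable_fun_set1.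
      by rewrite integral_set1.
  - move: u0; rewrite le_eqVlt => /predU1P[<-|u0]; first by rewrite prim0 subrr.
    by rewrite /prim /Rintegral H.
move=> u0; rewrite -integral_itv_obnd_cbnd//; last first.
  exact/measurable_EFinP.
(* Intervals away from 0 that exhaust []0, u]]; nonnegativity of [b] gives monotone convergence. The
   shift to [n.+2] keeps the left end strictly below [u]. *)
pose F n := (`[u / n.+2%:R, u]%classic : set R).
have un n : 0 < u / n.+2%:R < u.
  by rewrite divr_gt0//= ltr_pdivrMr// ltr_pMr// ltr1n.
have UF : \bigcup_n F n = `]0, u]%classic.
  apply/seteqP; split => y /=.
    move=> [n _]; rewrite /F/= !in_itv/= => /andP[h yu]; rewrite yu andbT.
    by have /andP[h1 _] := un n; exact: lt_le_trans h.
  rewrite in_itv/= => /andP[y0 yu].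
  exists (Num.bound (u / y)) => //; rewrite /F/= in_itv/= yu andbT.
  rewrite ler_pdivrMr// mulrC -ler_pdivrMr//.
  have h : u / y < (Num.bound (u / y))%:R.
    by apply: archi_boundP; rewrite divr_ge0// ltW.
  by apply: le_trans (ltW h) _; rewrite ler_nat (leq_trans (leqnSn _)).
have nF : nondecreasing_seq F.
  move=> m n mn; apply/subsetPset => y; rewrite /F/= !in_itv/= => /andP[h yu].
  rewrite yu andbT; apply: le_trans h; rewrite ler_pM2l// lef_pV2 ?posrE//.
  by rewrite ler_nat !ltnS.
have FTC n : (\int[mu]_(y in F n) (b y)%:E = (B u)%:E - (B (u / n.+2%:R)%R)%:E)%E.
  have /andP[h1 h2] := un n; apply: continuous_FTC2 => //.
  - apply: continuous_in_subspaceT => y; rewrite inE/= in_itv/= => /andP[h _].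
    by apply: cb; exact: lt_le_trans h.
  - split=> [y||].
    + by rewrite in_itv/= => /andP[h _]; have [d _] := dB y (lt_trans h1 h).
    + by apply: cvg_at_right_filter; exact: cB.
    + by apply: cvg_at_left_filter; exact: cB.
  - move=> y; rewrite in_itv/= => /andP[h _].
    by rewrite derive1E; have [_ ->] := dB y (lt_trans h1 h).
have c1 := @ge0_nondecreasing_set_cvg_integral _ (measurableTypeR R) R F (fun y => (b y)%:E) mu nF.
have c2 : (\int[mu]_(y in F n) (b y)%:E)%E @[n --> \oo] --> (B u - B 0)%:E.
  under eq_fun do rewrite FTC -EFinB.
  apply: cvg_EFin; first exact: nearW.
  apply: cvgB; first exact: cvg_cst.
  have e0 : u / n.+2%:R @[n --> \oo] --> (0 : R).
    rewrite -(mulr0 u); apply: cvgMr.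
    by have := @cvg_harmonic R; rewrite -(@cvg_shiftS R (fun n => n.+1%:R^-1 : R)).
  by apply: continuous_cvg; [exact: cB|exact: e0].
have mbF n : measurable_fun (F n) b.
  by apply: measurable_funS (mb u) => //; rewrite -UF; exact: bigcup_sup.
rewrite -UF -(cvg_lim _ c2)//; apply/esym/cvg_lim => //; apply: c1 => [n|n|n y].
- exact: measurable_itv.
- by apply/measurable_EFinP; exact: mbF.
- rewrite /F/= in_itv/= lee_fin => /andP[h _]; apply: b0.
  by have /andP[h1 _] := un n; exact: le_trans (ltW h1) h.
Qed.

End singular_primitive.

(** * Gamma densities and exponential decay *)

Section gamma_functions.
Context (R : realType).
Implicit Types (a beta theta u c : R).

Definition gam a beta u : R := u `^ a * expR (- (beta * u)).

(** Frozen at its value at 0 on the negative axis, which makes it continuous on the whole line for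
    [a >= 0]. *)
Definition gam0 a beta u : R := gam a beta (Num.max u 0).

Lemma gam0E a beta u : 0 <= u -> gam0 a beta u = gam a beta u.
Proof. by move=> u0; rewrite /gam0; have /max_idPl -> := u0. Qed.

Lemma gam_ge0 a beta u : 0 <= gam a beta u.
Proof. by rewrite mulr_ge0// ?powR_ge0// expR_ge0. Qed.

Lemma gam_tilt a beta theta u :
  gam a beta u * expR (theta * u) = gam a (beta - theta) u.
Proof. by rewrite /gam -mulrA -expRD; congr (_ * expR _); ring. Qed.

Lemma gam_mul a beta u : 0 < u -> u * gam (a - 1) beta u = gam a beta u.
Proof.
move=> u0; rewrite /gam mulrA -{1}(powRr1 (ltW u0)) -powRD ?(gt_eqF u0) ?implybT//.
by rewrite addrC subrK.
Qed.

Lemma is_derive_gam a beta u : 0 < u ->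
  is_derive u (1 : R) (gam a beta) (a * gam (a - 1) beta u - beta * gam a beta u).
Proof.
move=> u0; have d1 := is_derive1_powR a u0.
have d2 : is_derive u (1 : R) (fun x => expR (- (beta * x))) (- beta * expR (- (beta * u))).
  apply: is_derive_eq; rewrite /GRing.scale/=; ring.
apply: is_derive_eq; rewrite /GRing.scale/= /gam; ring.
Qed.

Lemma is_derive_gam0 a beta u : 0 < u ->
  is_derive u (1 : R) (gam0 a beta) (a * gam (a - 1) beta u - beta * gam a beta u).
Proof.
move=> u0; apply: (near_eq_is_derive _ (is_derive_gam a beta u0)).
by near=> v; rewrite gam0E//; apply: ltW; near: v; exact: lt_nbhsr.
Unshelve. all: by end_near. Qed.

Lemma gam0_continuous a beta : 0 <= a -> continuous (gam0 a beta).
Proof.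
move=> a0.
have cm := @continuous_max0 R.
have cp : continuous (fun u => (Num.max u 0) `^ a).
  move: a0; rewrite le_eqVlt => /predU1P[<- u|a0 u].
    by under eq_fun do rewrite powRr0; exact: cvg_cst.
  have [u0|u0|->] := ltgtP u 0.
  - apply: (@near_cst_continuous _ _ 0); near=> v.
    have /max_idPr -> : v <= 0 by apply: ltW; near: v; exact: lt_nbhsl.
    by rewrite powR0// gt_eqF.
  - have d := is_derive1_powR a u0.
    have cp : {for Num.max u 0, continuous (fun x : R => x `^ a)}.
      by have /max_idPl -> := ltW u0; exact: is_derive_continuous d.
    exact: (@continuous_comp _ _ _ (fun u => Num.max u 0) (fun x : R => x `^ a) u (cm u) cp).
  - suff : (Num.max v 0) `^ a @[v --> (0 : R)] --> (Num.max 0 0) `^ a by [].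
    rewrite maxxx powR0 ?gt_eqF//; apply/cvgrPdist_le => e e0; near=> v.
    rewrite sub0r normrN ger0_norm ?powR_ge0//.
    have -> : e = (e `^ a^-1) `^ a by rewrite -powRrM mulVf ?gt_eqF// powRr1// ltW.
    apply: ge0_ler_powR; [exact: ltW|by rewrite nnegrE le_max lexx orbT|
      by rewrite nnegrE powR_ge0|].
    rewrite ge_max powR_ge0 andbT.
    by apply: ltW; near: v; apply: lt_nbhsl; rewrite powR_gt0.
have ce : continuous (fun u => expR (- beta * Num.max u 0)).
  exact: (@continuous_compose _ (fun x => expR (- beta * x)) (fun u => Num.max u 0)
    (@continuous_expRM _ (- beta)) cm).
by move=> u; rewrite /gam0 /gam; under eq_fun do rewrite -mulNr; apply: cvgM; [exact: cp|exact: ce].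
Unshelve. all: by end_near. Qed.

Lemma gam_bounded a beta : 0 <= a -> 0 < beta ->
  exists2 K, 0 <= K & forall u, 0 <= u -> gam a beta u <= K.
Proof.
move=> a0 b0; move: a0; rewrite le_eqVlt => /predU1P[<-|a0].
  exists 1 => // u u0; rewrite /gam powRr0 mul1r.
  by rewrite -[leRHS]expR0 ler_expR oppr_le0 mulr_ge0// ltW.
exists ((a / beta) `^ a); first exact: powR_ge0.
move=> u; rewrite le_eqVlt => /predU1P[<-|u0].
  by rewrite /gam powR0 ?gt_eqF// mul0r powR_ge0.
(* Rescaling by the maximiser [a / beta] reduces the claim to [ln x <= x]. *)
have -> : u = (a / beta) * (beta * u / a) by field; rewrite !gt_eqF.
set x := beta * u / a; have x0 : 0 < x by rewrite divr_gt0// mulr_gt0.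
have ab0 : 0 < a / beta by rewrite divr_gt0.
rewrite /gam (powRM _ (ltW ab0) (ltW x0)) -mulrA -[leRHS]mulr1.
apply: ler_wpM2l; first exact: powR_ge0.
rewrite expRN ler_pdivrMr ?expR_gt0// mul1r /powR gt_eqF// ler_expR.
have -> : beta * (a / beta * x) = a * x by field; rewrite gt_eqF.
by rewrite ler_pM2l// ltW// ln_sublinear.
Qed.

Lemma locint_expRN c : locint (fun y : R => expR (- c * y)).
Proof. by apply: continuous_locint; exact: continuous_expRM. Qed.

Lemma prim_expRN c u : 0 < c -> prim (fun y => expR (- c * y)) u <= c^-1.
Proof.
move=> c0; have [u0|u0] := ltP u 0; first by rewrite prim_neg// invr_ge0 ltW.
have [||||_ ->//] := @singular_FTC R (fun y => expR (- c * y)) (fun y => - c^-1 * expR (- c * y)).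
- by move=> y; apply: cvgMr; exact: continuous_expRM.
- move=> y y0; apply: is_derive_eq; rewrite /GRing.scale/=; field.
  by rewrite gt_eqF.
- by move=> y _; exact: continuous_expRM.
- by move=> y _; exact: expR_ge0.
rewrite mulr0 expR0 mulr1 opprK addrC mulNr lerBlDr lerDl.
by rewrite mulr_ge0 ?expR_ge0// invr_ge0 ltW.
Qed.

Lemma prim_le (a b : R -> R) u : locint a -> locint b -> (forall y, 0 <= y <= u -> a y <= b y) ->
  prim a u <= prim b u.
Proof.
by move=> ai bi ab; apply: le_Rintegral.
Qed.

Lemma gam0_prim_bounded a beta : 0 <= a -> 0 < beta ->
  exists2 K, 0 <= K & forall u, prim (gam0 a beta) u <= K.
Proof.
move=> a0 b0; have b20 : 0 < beta / 2 by rewrite divr_gt0.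
have [K K0 hK] := gam_bounded a0 b20.
exists (K / (beta / 2)); first by rewrite divr_ge0// ltW.
move=> u; apply: (@le_trans _ _ (prim (fun y => K * expR (- (beta / 2) * y)) u)).
  apply: prim_le.
  - by apply: continuous_locint; exact: gam0_continuous.
  - by apply: locintZ; exact: locint_expRN.
  move=> y /andP[y0 _]; rewrite gam0E//.
  have -> : gam a beta y = gam a (beta / 2) y * expR (- (beta / 2) * y).
    by rewrite gam_tilt; congr gam; field.
  by rewrite ler_wpM2r ?expR_ge0// hK.
by rewrite primZ; [rewrite ler_wpM2l// prim_expRN|exact: locint_expRN].
Qed.

(* The derivative of [gam] is integrable at 0 because adding [beta * gam]
   makes it nonnegative. *)
Lemma gam_derivative_prim a beta : 0 <= a ->
  locint (fun y => a * gam (a - 1) beta y) /\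
  forall u, 0 <= u -> prim (fun y => a * gam (a - 1) beta y) u =
    gam a beta u - gam a beta 0 + beta * prim (gam0 a beta) u.
Proof.
move=> a0; have cg := @gam0_continuous a beta a0.
have [||||li E] := @singular_FTC R (fun y => a * gam (a - 1) beta y)
  (fun y => gam0 a beta y + beta * prim (gam0 a beta) y).
- move=> y; apply: cvgD; first exact: cg.
  by apply: cvgMr; apply: prim_continuous; exact: continuous_locint.
- move=> y y0; have d1 := is_derive_gam0 a beta y0.
  have d2 := prim_derive (continuous_locint cg) y0 (@cg y).
  apply: is_derive_eq; rewrite /GRing.scale/= gam0E; [ring|exact: ltW].
- move=> y y0; apply: cvgMr.
  exact: is_derive_continuous (is_derive_gam (a - 1) beta y0).
- by move=> y _; rewrite mulr_ge0// gam_ge0.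
split=> // u u0; rewrite E// prim0 mulr0 addr0 !gam0E//; ring.
Qed.

End gamma_functions.

Section decaying_functions.
Context (R : realType).
Implicit Types (theta c u : R) (h : R -> R).

(** The form of a density [h1] with derivatives [h2] and [h3]. For [u ^ a] with [0 < a < 1] near 0,
    [h2] is unbounded but integrable and [h3] is not integrable: hence [h1] is a primitive of [h2]
    from 0, while the derivatives carry the weights [u] and [u ^+ 2]. *)
Record decaying theta (h1 h2 h3 : R -> R) : Prop := Decaying {
  decaying_continuous : continuous h1 ;
  decaying_locint : locint h2 ;
  decaying_prim : forall u, 0 <= u -> h1 u = h1 0 + prim h2 u ;
  decaying_derive : forall u, 0 < u -> is_derive u (1 : R) h2 (h3 u) ;
  decaying_continuous3 : forall u, 0 < u -> {for u, continuous h3} ;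
  decaying_bound1 : exists2 K, 0 <= K &
    forall u, 0 <= u -> `|h1 u| * expR (theta * u) <= K ;
  decaying_bound2 : exists2 K, 0 <= K &
    forall u, 0 < u -> u * `|h2 u| * expR (theta * u) <= K ;
  decaying_bound3 : exists2 K, 0 <= K &
    forall u, 0 < u -> u ^+ 2 * `|h3 u| * expR (theta * u) <= K ;
  decaying_integral : exists2 K, 0 <= K &
    forall u, prim (fun y => `|h2 y| * expR (theta * y)) u <= K }.

Lemma locint_mul_expR c h : locint h -> locint (fun y => h y * expR (c * y)).
Proof.
move=> hi v; have c1 := continuous_compose (@continuous_expRM _ c) (@continuous_reflect _ v).
have := integrable_conv v c1 hi.
congr (_.-integrable _ _); apply/funext => y /=; congr EFin.
by rewrite mulrC; congr (_ * expR (c * _)); ring.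
Qed.

Lemma decayingD theta h1 h2 h3 k1 k2 k3 : decaying theta h1 h2 h3 ->
  decaying theta k1 k2 k3 -> decaying theta (fun u => h1 u + k1 u)
    (fun u => h2 u + k2 u) (fun u => h3 u + k3 u).
Proof.
move=> [hc hl hp hd hc3 [A A0 hA] [B B0 hB] [C C0 hC] [I I0 hI]]
  [kc kl kp kd kc3 [A' A0' kA] [B' B0' kB] [C' C0' kC] [I' I0' kI]].
have tri (x y e : R) : 0 <= e -> `|x + y| * e <= `|x| * e + `|y| * e.
  by move=> e0; rewrite -mulrDl ler_wpM2r// ler_normD.
split.
- by move=> u; apply: cvgD; [exact: hc|exact: kc].
- exact: locintD.
- by move=> u u0; rewrite primD// hp// kp//; ring.
- by move=> u u0; have d1 := hd u u0; have d2 := kd u u0; apply: is_deriveD.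
- by move=> u u0; apply: cvgD; [exact: hc3|exact: kc3].
- exists (A + A'); first exact: addr_ge0.
  by move=> u u0; apply: le_trans (tri _ _ _ (expR_ge0 _)) _; rewrite lerD// ?hA ?kA.
- exists (B + B'); first exact: addr_ge0.
  move=> u u0; rewrite -mulrA mulrCA.
  apply: le_trans (tri _ _ _ _) _; first by rewrite mulr_ge0 ?expR_ge0// ltW.
  rewrite -!(mulrCA u) !mulrA; exact: lerD (hB u u0) (kB u u0).
- exists (C + C'); first exact: addr_ge0.
  move=> u u0; rewrite -mulrA mulrCA.
  apply: le_trans (tri _ _ _ _) _; first by rewrite mulr_ge0 ?expR_ge0// sqr_ge0.
  rewrite -!(mulrCA (u ^+ 2)) !mulrA; exact: lerD (hC u u0) (kC u u0).
- exists (I + I'); first exact: addr_ge0.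
  move=> u; have i1 := locint_mul_expR theta (locint_norm hl).
  have i2 := locint_mul_expR theta (locint_norm kl).
  apply: (@le_trans _ _ (prim (fun y => `|h2 y| * expR (theta * y) + `|k2 y| * expR (theta * y)) u)).
    apply: prim_le.
    + by apply: locint_mul_expR; apply: locint_norm; exact: locintD.
    + exact: locintD.
    + by move=> y _; exact: tri (expR_ge0 _).
  by rewrite primD// lerD.
Qed.

Lemma decayingZ theta c h1 h2 h3 : decaying theta h1 h2 h3 ->
  decaying theta (fun u => c * h1 u) (fun u => c * h2 u) (fun u => c * h3 u).
Proof.
move=> [hc hl hp hd hc3 [A A0 hA] [B B0 hB] [C C0 hC] [I I0 hI]].
split.
- by move=> u; apply: cvgMr; exact: hc.
- exact: locintZ.
- by move=> u u0; rewrite primZ// hp// mulrDr.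
- move=> u u0; have d1 := hd u u0; apply: is_derive_eq.
  by rewrite /GRing.scale/=; ring.
- by move=> u u0; apply: cvgMr; exact: hc3.
- exists (`|c| * A); first by rewrite mulr_ge0.
  by move=> u u0; rewrite normrM -mulrA ler_wpM2l// hA.
- exists (`|c| * B); first by rewrite mulr_ge0.
  move=> u u0; rewrite normrM; have := hB u u0.
  have -> : u * (`|c| * `|h2 u|) * expR (theta * u) = `|c| * (u * `|h2 u| * expR (theta * u)) by ring.
  by move=> h; rewrite ler_wpM2l.
- exists (`|c| * C); first by rewrite mulr_ge0.
  move=> u u0; rewrite normrM; have := hC u u0.
  have -> : u ^+ 2 * (`|c| * `|h3 u|) * expR (theta * u) =
    `|c| * (u ^+ 2 * `|h3 u| * expR (theta * u)) by ring.
  by move=> h; rewrite ler_wpM2l.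
- exists (`|c| * I); first by rewrite mulr_ge0.
  move=> u; have i1 := locint_mul_expR theta (locint_norm hl).
  under [X in prim X]eq_fun do rewrite normrM -mulrA.
  by rewrite primZ// ler_wpM2l.
Qed.

Lemma decaying0 theta : decaying theta (fun=> 0) (fun=> 0) (fun=> 0).
Proof.
have p0 (u : R) : prim (fun=> 0) u = 0 :> R by rewrite /prim /Rintegral integral0.
split.
- by move=> u; exact: cvg_cst.
- by apply: continuous_locint => u; exact: cvg_cst.
- by move=> u _; rewrite p0 addr0.
- by move=> u _; exact: is_derive_cst.
- by move=> u _; exact: cvg_cst.
- by exists 0 => // u _; rewrite normr0 mul0r.
- by exists 0 => // u _; rewrite normr0 mulr0 mul0r.
- by exists 0 => // u _; rewrite normr0 mulr0 mul0r.
- by exists 0 => // u; under eq_prim do rewrite normr0 mul0r; rewrite p0.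
Qed.

Lemma decaying_sum theta (n : nat) (h1 h2 h3 : 'I_n -> R -> R) :
  (forall i, decaying theta (h1 i) (h2 i) (h3 i)) ->
  decaying theta (fun u => \sum_i h1 i u) (fun u => \sum_i h2 i u)
    (fun u => \sum_i h3 i u).
Proof.
elim: n h1 h2 h3 => [|n IH] h1 h2 h3 dh.
  have E (h : 'I_0 -> R -> R) : (fun u => \sum_i h i u) = (fun=> 0).
    by apply/funext => u; rewrite big_ord0.
  by rewrite !E; exact: decaying0.
have E (h : 'I_n.+1 -> R -> R) : (fun u => \sum_i h i u) =
   (fun u => \sum_(i < n) h (widen_ord (leqnSn n) i) u + h ord_max u).
  by apply/funext => u; rewrite big_ord_recr.
by rewrite !E; apply: decayingD => //; exact: IH.
Qed.

Lemma decaying_weaken theta gamma h1 h2 h3 : gamma <= theta ->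
  decaying theta h1 h2 h3 -> decaying gamma h1 h2 h3.
Proof.
move=> gt [hc hl hp hd hc3 [A A0 hA] [B B0 hB] [C C0 hC] [I I0 hI]].
have e u : 0 <= u -> expR (gamma * u) <= expR (theta * u).
  by move=> u0; rewrite ler_expR ler_wpM2r.
split => //.
- exists A => // u u0; apply: le_trans (hA u u0).
  by rewrite ler_wpM2l// e.
- exists B => // u u0; apply: le_trans (hB u u0).
  by rewrite ler_wpM2l ?e ?mulr_ge0// ltW.
- exists C => // u u0; apply: le_trans (hC u u0).
  by rewrite ler_wpM2l ?e ?mulr_ge0 ?sqr_ge0// ltW.
- exists I => // u; apply: le_trans (hI u); apply: prim_le.
  + by apply: locint_mul_expR; exact: locint_norm.
  + by apply: locint_mul_expR; exact: locint_norm.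
  + by move=> y /andP[y0 _]; rewrite ler_wpM2l// e.
Qed.

(** Each weight [u] raises the exponent of [gam] by one, and the factor [expR (theta * u)] lowers
    its rate to [beta - theta > 0]; all bounds reduce to [gam] with exponent [a], [a + 1] or
    [a + 2]. *)
Lemma decaying_gam theta a beta : 0 <= a -> theta < beta ->
  decaying theta (gam0 a beta)
    (fun u => a * gam (a - 1) beta u - beta * gam0 a beta u)
    (fun u => a * ((a - 1) * gam (a - 1 - 1) beta u - beta * gam (a - 1) beta u)
              - beta * (a * gam (a - 1) beta u - beta * gam a beta u)).
Proof.
move=> a0 tb; have bt0 : 0 < beta - theta by rewrite subr_gt0.
have cg := @gam0_continuous R a beta a0.
have lg := continuous_locint cg.
have [li E] := @gam_derivative_prim R a beta a0.
have lN c h : locint h -> locint (fun y => - (c * h y)).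
  by move=> hi; under eq_fun do rewrite -mulNr; exact: locintZ.
have [K K0 hK] := gam_bounded a0 bt0.
have a1 : 0 <= a + 1 by rewrite addr_ge0.
have [K1 K10 hK1] := gam_bounded a1 bt0.
have a2 : 0 <= a + 1 + 1 by rewrite addr_ge0.
have [K2 K20 hK2] := gam_bounded a2 bt0.
have normM3 (x y e : R) : 0 <= x -> 0 <= e -> x * `|y| * e = `|x * y * e|.
  by move=> x0 e0; rewrite !normrM (ger0_norm x0) (ger0_norm e0).
have ng c b (be u : R) : `|c * gam b be u| = `|c| * gam b be u.
  by rewrite normrM (ger0_norm (gam_ge0 b be u)).
have mul1 b (u : R) : 0 < u -> u * gam b beta u = gam (b + 1) beta u.
  by move=> u0; rewrite -(gam_mul (b + 1) beta u0) addrK.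
split.
- exact: cg.
- by apply: locintD => //; exact: lN.
- move=> u u0; rewrite primD//; last exact: lN.
  under [prim (fun y => - _) u]eq_prim do rewrite -mulNr.
  by rewrite E// primZ// !gam0E//; ring.
- move=> u u0; have d1 := is_derive_gam (a - 1) beta u0.
  have d2 := is_derive_gam0 a beta u0; apply: is_derive_eq.
  by rewrite /GRing.scale/=.
- move=> u u0.
  have c1 b := is_derive_continuous (is_derive_gam b beta u0).
  apply: cvgB; apply: cvgMr; apply: cvgB; apply: cvgMr; exact: c1.
- exists K => // u u0; rewrite gam0E// ger0_norm ?gam_ge0// gam_tilt; exact: hK.
- exists (a * K + `|beta| * K1); first by rewrite addr_ge0// mulr_ge0.
  move=> u u0; rewrite (gam0E _ _ (ltW u0)) (normM3 _ _ _ (ltW u0) (expR_ge0 _)).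
  have -> : u * (a * gam (a - 1) beta u - beta * gam a beta u) * expR (theta * u) =
    a * gam a (beta - theta) u - beta * gam (a + 1) (beta - theta) u.
    by rewrite -!gam_tilt -!(mul1 _ _ u0) -(gam_mul a _ u0); ring.
  apply: le_trans (ler_normB _ _) _; rewrite !ng (ger0_norm a0).
  by rewrite lerD// ler_wpM2l// ?hK ?hK1// ltW.
- exists (a * `|a - 1| * K + a * `|beta| * K1 + `|beta| * a * K1 + `|beta| * `|beta| * K2).
    by rewrite !addr_ge0// !mulr_ge0.
  move=> u u0; rewrite (normM3 _ _ _ (sqr_ge0 u) (expR_ge0 _)).
  have -> : u ^+ 2 * (a * ((a - 1) * gam (a - 1 - 1) beta u - beta * gam (a - 1) beta u) -
     beta * (a * gam (a - 1) beta u - beta * gam a beta u)) * expR (theta * u) =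
    a * (a - 1) * gam a (beta - theta) u - a * beta * gam (a + 1) (beta - theta) u
    - beta * a * gam (a + 1) (beta - theta) u + beta * beta * gam (a + 1 + 1) (beta - theta) u.
    rewrite -!gam_tilt -!(mul1 _ _ u0) -(gam_mul a _ u0) -(gam_mul (a - 1) _ u0); ring.
  apply: le_trans (ler_normD _ _) _; rewrite ng normrM.
  apply: lerD; last by rewrite ler_wpM2l ?mulr_ge0// hK2// ltW.
  apply: le_trans (ler_normB _ _) _; rewrite ng normrM (ger0_norm a0).
  apply: lerD; last by rewrite ler_wpM2l ?mulr_ge0// hK1// ltW.
  apply: le_trans (ler_normB _ _) _; rewrite !ng !normrM (ger0_norm a0).
  by apply: lerD; rewrite ler_wpM2l ?mulr_ge0// ?hK ?hK1// ltW.
- have [li' E'] := @gam_derivative_prim R a (beta - theta) a0.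
  have [I I0 hI] := gam0_prim_bounded a0 bt0.
  have lg' := continuous_locint (@gam0_continuous R a (beta - theta) a0).
  exists (K + (beta - theta) * I + `|beta| * I).
    by rewrite !addr_ge0// mulr_ge0// ltW.
  move=> u; have [u0|u0] := ltP u 0.
    by rewrite prim_neg// !addr_ge0// mulr_ge0// ltW.
  (* The two terms of [h2] are bounded separately; the first, singular at 0, is integrated exactly
     by [gam_derivative_prim] at the tilted rate. *)
  apply: (@le_trans _ _ (prim (fun y => a * gam (a - 1) (beta - theta) y +
     `|beta| * gam0 a (beta - theta) y) u)).
    apply: prim_le.
    + by apply: locint_mul_expR; apply: locint_norm; apply: locintD => //; exact: lN.
    + by apply: locintD => //; exact: locintZ.
    + move=> y /andP[y0 _].
      apply: (@le_trans _ _ ((a * gam (a - 1) beta y + `|beta| * gam0 a beta y) * expR (theta * y))).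
        rewrite ler_wpM2r ?expR_ge0//; apply: le_trans (ler_normB _ _) _.
        by rewrite !ng (ger0_norm a0).
      rewrite !(gam0E _ _ y0) -!gam_tilt le_eqVlt; apply/orP; left; apply/eqP.
      by ring.
  rewrite primD//; last exact: locintZ.
  rewrite E'// primZ//; apply: lerD; last by rewrite ler_wpM2l.
  apply: lerD; last by rewrite ler_wpM2l// ltW.
  by rewrite lerBlDr; apply: le_trans (hK u u0) _; rewrite lerDl gam_ge0.
Qed.

End decaying_functions.

(** * Regularity of solutions of the renewal equation *)

Section renewal_equation.
Context (R : realType) (theta kappa d0 phi : R) (D k1 k2 k3 : R -> R).
Let k u := kappa + prim k1 u.
Hypotheses (theta0 : 0 < theta) (kappa0 : 0 <= kappa)
  (hk : decaying theta k1 k2 k3)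
  (k_ge0 : forall u, 0 <= u -> 0 <= k u)
  (k_decay : exists2 K, 0 <= K & forall u, 0 <= u -> k u * expR (theta * u) <= K)
  (k_int : forall u, prim k u <= phi) (phi1 : phi < 1)
  (cD : continuous D) (D_eq : forall u, 0 <= u -> D u = d0 + convol D k u).

Let ck1 : continuous k1. Proof. exact: decaying_continuous hk. Qed.
Let lk1 : locint k1. Proof. exact: continuous_locint. Qed.
Let lk2 : locint k2. Proof. exact: decaying_locint hk. Qed.

Let ck : continuous k.
Proof. by move=> u; apply: cvgD; [exact: cvg_cst|exact: prim_continuous]. Qed.

Let lk : locint k. Proof. exact: continuous_locint. Qed.

Let lcst c : locint (fun=> c : R).
Proof. by apply: continuous_locint => u; exact: cvg_cst. Qed.

Let convk (a : R -> R) (u : R) : continuous a ->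
  convol a k u = prim (fun v => kappa * a v + convol a k1 v) u.
Proof.
move=> ca; have la := continuous_locint ca.
have lp : locint (prim k1) by apply: continuous_locint; exact: prim_continuous.
have cc := conv_continuous ca lk1.
rewrite (convDr _ ca (lcst kappa) lp) conv_cstr// conv_primr//.
by rewrite (primD _ (locintZ kappa la) (continuous_locint cc)) (primZ _ _ la).
Qed.

(** [y1] to [y4] are explicit formulas for the first four derivatives of [D]. Each differentiation
    of a convolution is placed on the factor that can bear it. *)
Let y1 u := kappa * D u + convol D k1 u.

Let cy1 : continuous y1.
Proof.
move=> u; apply: cvgD; first by apply: cvgMr; exact: cD.
exact: conv_continuous.
Qed.

Let ly1 : locint y1. Proof. exact: continuous_locint. Qed.

Let D_prim u : 0 <= u -> D u = d0 + prim y1 u.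
Proof. by move=> u0; rewrite D_eq// convk. Qed.

(* If [z = z0 + prim z'] on [0, oo[, one derivative falls on [z] in [convol z b]. *)
Let conv_derivl (z : R -> R) (z0 : R) (z' b : R -> R) (u : R) : continuous z' -> locint b ->
  (forall v, 0 <= v -> z v = z0 + prim z' v) -> 0 <= u ->
  convol z b u = z0 * prim b u + prim (convol z' b) u.
Proof.
move=> cz' lb zE u0.
have cp := prim_continuous (continuous_locint cz').
rewrite (@eq_conv _ _ (fun v => z0 + prim z' v) _ b); last 2 first.
- by move=> y /andP[h _]; exact: zE.
- by [].
rewrite convDl//; last by move=> v; exact: cvg_cst.
by rewrite conv_cstl// conv_priml.
Qed.

(** Now the derivative falls on [D]. The inhomogeneous term [d0 * k] decays, unlike the constant
    [d0] in the equation of [D], and this makes an exponential bound on [y1] possible. *)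
Let y1_renewal u : 0 <= u -> y1 u = d0 * k u + convol y1 k u.
Proof.
move=> u0; rewrite /y1 D_prim// (conv_derivl cy1 lk1 D_prim u0).
have lcc := continuous_locint (conv_continuous cy1 lk1).
by rewrite convk// (primD _ (locintZ kappa ly1) lcc) (primZ _ _ ly1) /k; ring.
Qed.

Let y2 u := d0 * k1 u + kappa * y1 u + convol y1 k1 u.

Let cy2 : continuous y2.
Proof.
move=> u; apply: cvgD; last exact: conv_continuous.
by apply: cvgD; apply: cvgMr; [exact: ck1|exact: cy1].
Qed.

Let ly2 : locint y2. Proof. exact: continuous_locint. Qed.
Let lc1 : locint (convol y1 k1).
Proof. by apply: continuous_locint; exact: conv_continuous. Qed.
Let lc2 : locint (convol y1 k2).
Proof. by apply: continuous_locint; exact: conv_continuous. Qed.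

Let y1_prim u : 0 <= u -> y1 u = d0 * kappa + prim y2 u.
Proof.
move=> u0; rewrite y1_renewal// convk// /y2.
have l1 := locintZ d0 lk1; have l2 := locintZ kappa ly1.
rewrite (primD _ (locintD l1 l2) lc1) (primD _ l1 l2) (primD _ l2 lc1).
by rewrite (primZ _ _ lk1) (primZ _ _ ly1) /k; ring.
Qed.

Let y3 u := d0 * k2 u + kappa * y2 u + k1 0 * y1 u + convol y1 k2 u.

Let ly3 : locint y3.
Proof.
exact: (locintD (locintD (locintD (locintZ d0 lk2) (locintZ kappa ly2))
  (locintZ (k1 0) ly1)) lc2).
Qed.

Let k1_prim u : 0 <= u -> k1 u = k1 0 + prim k2 u.
Proof. exact: decaying_prim hk u. Qed.

Let y2_prim u : 0 <= u -> y2 u = (d0 * k1 0 + kappa * (d0 * kappa)) + prim y3 u.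
Proof.
move=> u0; rewrite /y2.
have -> : convol y1 k1 u = k1 0 * prim y1 u + prim (convol y1 k2) u.
  have lp : locint (prim k2) by apply: continuous_locint; exact: prim_continuous.
  rewrite (@eq_conv _ _ y1 _ (fun v => k1 0 + prim k2 v)); last 2 first.
  - by [].
  - by move=> y /andP[h _]; exact: k1_prim.
  by rewrite convDr// conv_cstr// conv_primr.
rewrite (y1_prim u0) (k1_prim u0) /y3.
have l1 := locintZ d0 lk2; have l2 := locintZ kappa ly2; have l3 := locintZ (k1 0) ly1.
rewrite (primD _ (locintD (locintD l1 l2) l3) lc2) (primD _ (locintD l1 l2) l3).
by rewrite (primD _ l1 l2) (primZ _ _ lk2) (primZ _ _ ly2) (primZ _ _ ly1); ring.
Qed.

(** In [convol y1 k2] the derivative falls on [y1], whose value at 0 is [d0 * kappa], since [k3]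
    need not be integrable at 0. *)
Let y4 u := d0 * k3 u + kappa * y3 u + k1 0 * y2 u +
  (d0 * kappa * k2 u + convol y2 k2 u).

Let ck2 (u : R) : 0 < u -> {for u, continuous k2}.
Proof. by move=> u0; exact: is_derive_continuous (decaying_derive hk u0). Qed.

Let cy3 (u : R) : 0 < u -> {for u, continuous y3}.
Proof.
move=> u0; apply: cvgD; last exact: conv_continuous.
apply: cvgD; last by apply: cvgMr; exact: cy1.
by apply: cvgD; apply: cvgMr; [exact: ck2|exact: cy2].
Qed.

Let cy4 (u : R) : 0 < u -> {for u, continuous y4}.
Proof.
move=> u0; apply: cvgD.
  apply: cvgD; last by apply: cvgMr; exact: cy2.
  apply: cvgD; apply: cvgMr; last exact: cy3.
  exact: decaying_continuous3 hk u u0.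
apply: cvgD; last exact: conv_continuous.
by apply: cvgMr; exact: ck2.
Qed.

Let derive_of_prim (z z' : R -> R) (c u : R) : locint z' -> 0 < u -> {for u, continuous z'} ->
  (forall v, 0 <= v -> z v = c + prim z' v) -> is_derive u (1 : R) z (z' u).
Proof.
move=> lz u0 cz zE; have d := prim_derive lz u0 cz.
apply: (@near_eq_is_derive _ _ _ (fun v => c + prim z' v)).
  by near=> v; rewrite zE//; apply: ltW; near: v; exact: lt_nbhsr.
by have := is_deriveD (is_derive_cst c u (1 : R)) d; rewrite add0r.
Unshelve. all: by end_near. Qed.

Let dy3 (u : R) : 0 < u -> is_derive u (1 : R) y3 (y4 u).
Proof.
move=> u0.
have d1 := decaying_derive hk u0.
have d2 := derive_of_prim ly3 u0 (cy3 u0) y2_prim.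
have d3 := derive_of_prim ly2 u0 (@cy2 u) y1_prim.
have d4 := prim_derive lk2 u0 (ck2 u0).
have cc := conv_continuous cy2 lk2.
have d5 := prim_derive (continuous_locint cc) u0 (@cc u).
apply: (@near_eq_is_derive _ _ _ (fun v => d0 * k2 v + kappa * y2 v + k1 0 * y1 v +
   (d0 * kappa * prim k2 v + prim (convol y2 k2) v))).
  near=> v; rewrite /y3 (@conv_derivl y1 _ y2 k2 v cy2 lk2 y1_prim)//.
  by apply: ltW; near: v; exact: lt_nbhsr.
Unshelve. all: by end_near. Qed.

Let mul_expRN (c u : R) : 0 < c -> 0 <= u -> u * expR (- c * u) <= c^-1.
Proof.
move=> c0 u0; rewrite mulNr expRN ler_pdivrMr ?expR_gt0//.
rewrite -ler_pdivrMl ?invr_gt0// invrK.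
by apply: le_trans (expR_ge1Dx _); rewrite lerDr.
Qed.

(** The kernel has mass at most [phi < 1]. As [expR (gamma * y) <= 1 + gamma * y * expR (gamma *
    y)], a small exponential weight adds at most [gamma * M] to it. *)
Let tilt : exists gamma q, [/\ 0 < gamma, gamma <= theta, 0 <= q < 1 &
  forall u, prim (fun y => `|k y| * expR (gamma * y)) u <= q].
Proof.
have [K K0 hK] := k_decay.
(* [K] times [4 / theta], a bound of [y * expR (- (theta / 4) * y)], times [2 / theta], a bound of
   the integral of [expR (- (theta / 2) * y)]. *)
pose M := 8 * K / theta ^+ 2.
have M0 : 0 <= M by rewrite divr_ge0 ?sqr_ge0// mulr_ge0.
(* The first entry leaves the rate [theta / 2] for integration, the second gives
   [gamma * M <= (1 - phi) / 2]; the added 1 covers [M = 0]. *)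
pose gamma := Num.min (theta / 4) ((1 - phi) / (2 * M + 1)).
have phi_ge0 : 0 <= phi by have := k_int (-1); rewrite prim_neg.
have M1 : 0 < 2 * M + 1 by rewrite ltr_wpDl// mulr_ge0.
have g0 : 0 < gamma by rewrite lt_min !divr_gt0// subr_gt0.
have gt4 : gamma <= theta / 4 by rewrite ge_min lexx.
have gM : gamma * M <= (1 - phi) / 2.
  have : gamma <= (1 - phi) / (2 * M + 1) by rewrite ge_min lexx orbT.
  rewrite ler_pdivlMr// => h; have : 0 <= gamma := ltW g0; lra.
exists gamma, ((1 + phi) / 2); split => //.
- by apply: le_trans gt4 _; rewrite ler_pdivrMr// ler_peMr ?ltW// ltr1n.
- by rewrite divr_ge0 ?addr_ge0//= ltr_pdivrMr// mul1r ltrD2l.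
move=> u; have [u0|u0] := ltP u 0; first by rewrite prim_neg// divr_ge0// addr_ge0.
have t2 : 0 < theta / 2 by rewrite divr_gt0.
have t4 : 0 < theta / 4 by rewrite divr_gt0.
apply: (@le_trans _ _ (prim (fun y => k y + gamma * (K * (4 / theta)) * expR (- (theta / 2) * y)) u)).
  apply: prim_le.
  - by apply: locint_mul_expR; exact: locint_norm.
  - by apply: locintD => //; apply: locintZ; exact: locint_expRN.
  move=> y /andP[y0 _]; rewrite ger0_norm ?k_ge0//.
  have e1 : expR (gamma * y) <= 1 + gamma * y * expR (gamma * y).
    have := expR_ge1Dx (- (gamma * y)); rewrite expRN -(ler_pM2r (expR_gt0 (gamma * y))).
    by rewrite mulVf ?gt_eqF ?expR_gt0//; lra.
  apply: (@le_trans _ _ (k y * (1 + gamma * y * expR (gamma * y)))).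
    by rewrite ler_wpM2l// k_ge0.
  rewrite mulrDr mulr1 lerD2l.
  have -> : k y * (gamma * y * expR (gamma * y)) =
     gamma * (k y * expR (theta * y)) * (y * expR (- (theta / 4) * y)) *
       expR (- (theta * (3 / 4) - gamma) * y).
    have -> : expR (gamma * y) = expR (theta * y) * expR (- (theta / 4) * y) *
       expR (- (theta * (3 / 4) - gamma) * y).
      by rewrite -!expRD; congr expR; field.
    ring.
  have -> : gamma * (K * (4 / theta)) = gamma * K * (theta / 4)^-1.
    by rewrite invf_div; ring.
  apply: ler_pM; rewrite ?expR_ge0//.
  - by rewrite !mulr_ge0 ?expR_ge0 ?k_ge0// ltW.
  - apply: ler_pM; rewrite ?mulr_ge0 ?expR_ge0 ?k_ge0 ?(ltW g0)//.
      by rewrite ler_wpM2l ?hK// ltW.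
    exact: mul_expRN.
  - rewrite ler_expR ler_wpM2r// lerN2; lra.
rewrite primD//; last by apply: locintZ; exact: locint_expRN.
rewrite primZ; last exact: locint_expRN.
have h1 : gamma * (K * (4 / theta)) * prim (fun y => expR (- (theta / 2) * y)) u <=
   gamma * (K * (4 / theta)) * (theta / 2)^-1.
  apply: ler_wpM2l; first by rewrite !mulr_ge0 ?invr_ge0// ltW.
  exact: prim_expRN.
have h2 : gamma * (K * (4 / theta)) * (theta / 2)^-1 = gamma * M.
  by rewrite /M; field; rewrite gt_eqF.
have := k_int u; lra.
Qed.

(** At a maximum point [c] of the weighted [|y1|] on [[0, u]], the renewal equation bounds the
    maximum by [|d0| * K] plus [q] times itself. As [q < 1] it can be absorbed, and the bound does
    not depend on [u]. *)
Let y1_decay gamma q : 0 < gamma -> gamma <= theta -> 0 <= q < 1 ->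
  (forall u, prim (fun y => `|k y| * expR (gamma * y)) u <= q) ->
  exists2 C, 0 <= C & forall u, 0 <= u -> `|y1 u| * expR (gamma * u) <= C.
Proof.
move=> g0 gt /andP[q0 q1] hq; have [K K0 hK] := k_decay.
have q10 : 0 < 1 - q by rewrite subr_gt0.
exists (`|d0| * K / (1 - q)); first by rewrite divr_ge0 ?mulr_ge0// ltW.
move=> u u0.
pose g v := `|y1 v| * expR (gamma * v).
have cg : continuous g.
  by move=> v; apply: cvgM; [apply: cvg_norm; exact: cy1|exact: continuous_expRM].
have [c cu hc] := @EVT_max _ g 0 u u0 (continuous_subspaceT cg).
move: cu; rewrite in_itv/= => /andP[c0 cu].
apply: (@le_trans _ _ (g c)); first by apply: hc; rewrite in_itv/= u0 lexx.
rewrite ler_pdivlMr//.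
suff : g c <= `|d0| * K + g c * q by lra.
rewrite {1}/g y1_renewal//.
apply: (@le_trans _ _ (`|d0 * k c| * expR (gamma * c) + `|convol y1 k c| * expR (gamma * c))).
  by rewrite -mulrDl ler_wpM2r ?expR_ge0// ler_normD.
apply: lerD.
  rewrite normrM -mulrA ler_wpM2l// ger0_norm ?k_ge0//.
  apply: le_trans (hK c c0); rewrite ler_wpM2l ?k_ge0// ler_expR.
  by rewrite ler_wpM2r.
apply: conv_le => //; first by rewrite mulr_ge0// expR_ge0.
move=> y /andP[y0 yc]; apply: hc; rewrite in_itv/= y0/=.
exact: le_trans cu.
Qed.

Let bounds : exists2 K, 0 <= K & forall u, 0 < u ->
  [/\ `|y2 u| <= K, u * `|y3 u| <= K & u ^+ 2 * `|y4 u| <= K].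
Proof.
have [gamma [q [g0 gt q01 hq]]] := tilt.
have [C1 C10 hC1'] := y1_decay g0 gt q01 hq.
(* Half of the decay rate pays for the integrability of [k1]; the other half stays as a weight. *)
have [eta [e0 eg etaE]] : exists eta, [/\ 0 < eta, eta <= gamma & gamma = eta + eta].
  exists (gamma / 2); split; [by rewrite divr_gt0| |by field].
  by rewrite ler_pdivrMr// ler_peMr ?ltW// ltr1n.
have hC1 u : 0 <= u -> `|y1 u| * expR (eta * u) <= C1.
  move=> u0; apply: le_trans (hC1' u u0).
  by rewrite ler_wpM2l// ler_expR ler_wpM2r.
have [A' A0' hA'] := decaying_bound1 (decaying_weaken gt hk).
have [_ _ _ _ _ [A A0 hA] [B B0 hB] [C C0 hC] [I2 I20 hI2]] :=
  decaying_weaken (le_trans eg gt) hk.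
have [I1 I10 hI1] : exists2 I1, 0 <= I1 &
    forall u, prim (fun y => `|k1 y| * expR (eta * y)) u <= I1.
  exists (A' * eta^-1); first by rewrite mulr_ge0// invr_ge0 ltW.
  move=> u; apply: (@le_trans _ _ (prim (fun y => A' * expR (- eta * y)) u)).
    apply: prim_le.
    - by apply: locint_mul_expR; exact: locint_norm.
    - by apply: locintZ; exact: locint_expRN.
    move=> y /andP[y0 _].
    have -> : expR (eta * y) = expR (gamma * y) * expR (- eta * y).
      by rewrite -expRD; congr expR; rewrite etaE; ring.
    by rewrite mulrA ler_wpM2r ?expR_ge0// hA'.
  by rewrite primZ; [rewrite ler_wpM2l// prim_expRN|exact: locint_expRN].
have tri (x y e : R) : 0 <= e -> `|x + y| * e <= `|x| * e + `|y| * e.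
  by move=> e0'; rewrite -mulrDl ler_wpM2r// ler_normD.
pose C2 := `|d0| * A + kappa * C1 + C1 * I1.
have C20 : 0 <= C2 by rewrite !addr_ge0// mulr_ge0.
have hC2 u : 0 <= u -> `|y2 u| * expR (eta * u) <= C2.
  move=> u0; apply: le_trans (tri _ _ _ (expR_ge0 _)) _; apply: lerD.
    apply: le_trans (tri _ _ _ (expR_ge0 _)) _; rewrite !normrM -!mulrA.
    rewrite (ger0_norm kappa0); apply: lerD; rewrite ler_wpM2l//; [exact: hA|exact: hC1].
  by apply: conv_le => // y /andP[y0 _]; exact: hC1.
pose S := kappa * C2 + `|k1 0| * C1 + C1 * I2.
have S0 : 0 <= S by rewrite !addr_ge0// mulr_ge0.
(* [y3] without its term [d0 * k2], the only one that may blow up at 0. *)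
pose r u := kappa * y2 u + k1 0 * y1 u + convol y1 k2 u.
have hS u : 0 <= u -> `|r u| * expR (eta * u) <= S.
  move=> u0; apply: le_trans (tri _ _ _ (expR_ge0 _)) _; apply: lerD.
    apply: le_trans (tri _ _ _ (expR_ge0 _)) _; rewrite !normrM -!mulrA.
    rewrite (ger0_norm kappa0); apply: lerD; rewrite ler_wpM2l//; [exact: hC2|exact: hC1].
  by apply: conv_le => // y /andP[y0 _]; exact: hC1.
have y3E u : y3 u = d0 * k2 u + r u by rewrite /y3 /r; ring.
pose T u := convol y2 k2 u.
have hT u : 0 <= u -> `|T u| * expR (eta * u) <= C2 * I2.
  by move=> u0; apply: conv_le => // y /andP[y0 _]; exact: hC2.
(* Bounds for [u * expR (- eta * u)] and [u ^+ 2 * expR (- eta * u)], the latter being the square of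
   [u * expR (- (eta / 2) * u)]. They absorb the weights on terms that decay. *)
pose E1 := eta^-1; pose E2 := ((eta / 2)^-1) ^+ 2.
have E10 : 0 <= E1 by rewrite invr_ge0 ltW.
have E20 : 0 <= E2 by rewrite sqr_ge0.
have drop0 u z M : 0 <= u -> z * expR (eta * u) <= M -> 0 <= z -> z <= M.
  move=> u0 h z0; apply: le_trans h; rewrite ler_peMr//.
  by rewrite -[leLHS]expR0 ler_expR mulr_ge0// ltW.
have split_e u z M : z * expR (eta * u) <= M -> z <= M * expR (- eta * u).
  by rewrite mulNr expRN ler_pdivlMr ?expR_gt0.
have drop1 u z M : 0 <= u -> 0 <= M -> z * expR (eta * u) <= M -> u * z <= M * E1.
  move=> u0 M0 /split_e h; apply: (@le_trans _ _ (u * (M * expR (- eta * u)))).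
    by rewrite ler_wpM2l.
  by rewrite mulrCA ler_wpM2l// mul_expRN.
have drop2 u z M : 0 <= u -> 0 <= M -> z * expR (eta * u) <= M -> u ^+ 2 * z <= M * E2.
  move=> u0 M0 /split_e h; apply: (@le_trans _ _ (u ^+ 2 * (M * expR (- eta * u)))).
    by rewrite ler_wpM2l// sqr_ge0.
  rewrite mulrCA ler_wpM2l//.
  have -> : expR (- eta * u) = expR (- (eta / 2) * u) ^+ 2.
    by rewrite expr2 -expRD; congr expR; field.
  rewrite -exprMn; apply: lerXn2r; rewrite ?nnegrE ?mulr_ge0 ?expR_ge0 ?invr_ge0//.
  - by rewrite divr_ge0// ltW.
  - by apply: mul_expRN => //; rewrite divr_gt0.
have hk2 u : 0 < u -> u * `|k2 u| <= B.
  by move=> u0; apply: (drop0 u) => //; [exact: ltW|exact: hB|rewrite mulr_ge0// ltW].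
have hk2' u : 0 < u -> u ^+ 2 * `|k2 u| <= B * E1.
  move=> u0; rewrite expr2 -mulrA; apply: drop1 => //; [exact: ltW|exact: hB].
have hk3 u : 0 < u -> u ^+ 2 * `|k3 u| <= C.
  move=> u0; apply: (drop0 u) => //; [exact: ltW|exact: hC|].
  by rewrite mulr_ge0// sqr_ge0.
have hy3 u : 0 < u -> u * `|y3 u| <= `|d0| * B + S * E1.
  move=> u0; rewrite y3E; apply: (@le_trans _ _ (u * (`|d0 * k2 u| + `|r u|))).
    by rewrite ler_wpM2l ?ler_normD// ltW.
  rewrite mulrDr normrM mulrCA; apply: lerD; first by rewrite ler_wpM2l// hk2.
  by apply: drop1 => //; [exact: ltW|apply: hS; exact: ltW].
have hy3' u : 0 < u -> u ^+ 2 * `|y3 u| <= `|d0| * (B * E1) + S * E2.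
  move=> u0; rewrite y3E; apply: (@le_trans _ _ (u ^+ 2 * (`|d0 * k2 u| + `|r u|))).
    by rewrite ler_wpM2l ?ler_normD// sqr_ge0.
  rewrite mulrDr normrM mulrCA; apply: lerD; first by rewrite ler_wpM2l// hk2'.
  by apply: drop2 => //; [exact: ltW|apply: hS; exact: ltW].
pose Y4 := `|d0| * C + kappa * (`|d0| * (B * E1) + S * E2) + `|k1 0| * (C2 * E2) +
  (`|d0| * kappa * (B * E1) + C2 * I2 * E2).
have hy4 u : 0 < u -> u ^+ 2 * `|y4 u| <= Y4.
  move=> u0; have u0' := ltW u0.
  apply: (@le_trans _ _ (u ^+ 2 * (`|d0 * k3 u| + `|kappa * y3 u| + `|k1 0 * y2 u| +
     (`|d0 * kappa * k2 u| + `|T u|)))).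
    rewrite ler_wpM2l ?sqr_ge0//; apply: le_trans (ler_normD _ _) _.
    apply: lerD; last exact: ler_normD.
    apply: le_trans (ler_normD _ _) _; apply: lerD => //; exact: ler_normD.
  have cm (c z : R) : u ^+ 2 * `|c * z| = `|c| * (u ^+ 2 * `|z|).
    by rewrite normrM mulrCA.
  have dist (x a b c d e : R) :
    x * (a + b + c + (d + e)) = x * a + x * b + x * c + (x * d + x * e) by ring.
  rewrite dist (cm d0) (cm kappa) (cm (k1 0)) (cm (d0 * kappa)) (normrM d0).
  rewrite (ger0_norm kappa0).
  apply: lerD; last apply: lerD.
  - apply: lerD; last first.
      by rewrite ler_wpM2l//; apply: drop2 => //; exact: hC2.
    by apply: lerD; rewrite ler_wpM2l//; [exact: hk3|exact: hy3'].
  - by rewrite ler_wpM2l ?mulr_ge0// hk2'.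
  - by apply: drop2 => //; [exact: mulr_ge0|exact: hT].
have Y40 : 0 <= Y4 by repeat (assumption || apply: normr_ge0 || apply: addr_ge0 || apply: mulr_ge0).
have Y30 : 0 <= `|d0| * B + S * E1 by repeat (assumption || apply: normr_ge0 || apply: addr_ge0 || apply: mulr_ge0).
exists (C2 + (`|d0| * B + S * E1) + Y4); first by exact: addr_ge0 (addr_ge0 C20 Y30) Y40.
move=> u u0; split.
- apply: (@le_trans _ _ C2); last by rewrite -addrA lerDl (addr_ge0 Y30 Y40).
  by apply: (drop0 u) => //; [exact: ltW|apply: hC2; exact: ltW].
- by apply: le_trans (hy3 u u0) _; rewrite addrAC lerDr (addr_ge0 C20 Y40).
- by apply: le_trans (hy4 u u0) _; rewrite lerDr (addr_ge0 C20 Y30).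
Qed.

Theorem renewal_regularity : exists z1 z2 z3 z4 : R -> R,
  [/\ forall u : R, 0 < u -> is_derive u (1 : R) D (z1 u),
      forall u : R, 0 < u -> is_derive u (1 : R) z1 (z2 u),
      forall u : R, 0 < u -> is_derive u (1 : R) z2 (z3 u),
      forall u : R, 0 < u -> is_derive u (1 : R) z3 (z4 u) &
      forall u : R, 0 < u -> {for u, continuous z4}] /\
  exists2 K, 0 <= K & forall u : R, 0 < u ->
    [/\ `|z2 u| <= K, u * `|z3 u| <= K & u ^+ 2 * `|z4 u| <= K].
Proof.
exists y1, y2, y3, y4; split; last exact: bounds.
split.
- by move=> u u0; exact: derive_of_prim ly1 u0 (@cy1 u) D_prim.
- by move=> u u0; exact: derive_of_prim ly2 u0 (@cy2 u) y1_prim.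
- by move=> u u0; exact: derive_of_prim ly3 u0 (cy3 u0) y2_prim.
- exact: dy3.
- exact: cy4.
Qed.

End renewal_equation.

Section iterated_derivatives.
Context (R : realType).
Implicit Types (g : R -> R) (z : nat -> R -> R).

(** Agreement on the open half-line is enough, since derivatives at positive points are local. *)
Lemma derive1n_pos g z n : (forall u : R, 0 < u -> g u = z 0%N u) ->
  (forall k (u : R), (k < n)%N -> 0 < u -> is_derive u (1 : R) (z k) (z k.+1 u)) ->
  forall k (u : R), (k <= n)%N -> 0 < u ->
    g^`(k)%classic u = z k u /\
    ((k < n)%N -> is_derive u (1 : R) (g^`(k)%classic) (z k.+1 u)).
Proof.
move=> g0 dz; elim=> [|k IH] u kn u0.
  split=> [|n0]; first by rewrite derive1n0 g0.
  rewrite derive1n0; apply: (near_eq_is_derive _ (dz 0%N u n0 u0)).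
  by near=> v; rewrite g0//; near: v; exact: lt_nbhsr.
have E v : 0 < v -> g^`(k.+1)%classic v = z k.+1 v.
  move=> v0; have [_ /(_ kn) [_ <-]] := IH v (ltnW kn) v0.
  by rewrite derive1nS derive1E.
split=> [|n0]; first exact: E.
apply: (near_eq_is_derive _ (dz k.+1 u n0 u0)).
by near=> v; rewrite E//; near: v; exact: lt_nbhsr.
Unshelve. all: by end_near. Qed.

End iterated_derivatives.

(** * The renewal kernel of a gamma mixture and the derivatives of the ruin probability *)

Section gamma_mixture_model.
Context (R : realType) (d : measure_display)
    (T : measurableType d) (P : probability T R) (lambda c mu : R)
    (FX : R -> R) (N : R -> {RV P >-> nat}) (X : nat -> {RV P >-> R})
    (hmodel : classical_risk_model lambda c mu FX N X)
    (n : nat) (p alpha beta : 'I_n -> R)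
    (hbeta : forall i, 0 < beta i) (halpha : forall i, 1 <= alpha i)
    (hFX : forall u, FX u = \sum_(i < n) p i * gamma_cdf (alpha i) (beta i) u).
Local Notation leb := (@lebesgue_measure R).
Local Notation kappa := (lambda / c).
Local Notation sv := (survival_probability c N X).

Let kappa0 : 0 < kappa.
Proof. exact: divr_gt0 (risk_lambda_gt0 hmodel) (risk_c_gt0 hmodel). Qed.

Let a i := alpha i - 1.
Let a0 i : 0 <= a i. Proof. by rewrite subr_ge0. Qed.
Let w i := p i * ((Gamma (alpha i))^-1 * beta i `^ alpha i).

Let gamma_cdfE i u :
  p i * gamma_cdf (alpha i) (beta i) u = prim (fun y => w i * gam0 (a i) (beta i) y) u.
Proof.
have lg : locint (gam0 (a i) (beta i)) by apply: continuous_locint; exact: gam0_continuous.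
rewrite /w primZ// -mulrA; congr (_ * _); rewrite -primZ//.
apply: eq_prim => y /andP[y0 _]; rewrite gam0E// /gamma_pdf /gam /a.
by rewrite !mulrA.
Qed.

Let theta_ex : exists2 theta, 0 < theta & forall i, theta < beta i.
Proof.
elim: n beta hbeta => [|m IH] b hb; first by exists 1 => // -[].
have [t t0 ht] := IH (fun i => b (widen_ord (leqnSn m) i)) (fun i => hb _).
exists (Num.min t (b ord_max / 2)); first by rewrite lt_min t0 divr_gt0.
move=> i; have [im|im] := ltnP i m.
  rewrite gt_min; apply/orP; left; have := ht (Ordinal im).
  by congr (_ < b _); exact: val_inj.
have -> : i = ord_max by apply: val_inj => /=; apply/eqP; rewrite eqn_leq im -ltnS ltn_ord.
by rewrite gt_min ltr_pdivrMr// ltr_pMr// ltr1n orbT.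
Qed.

Let f1 u := \sum_(i < n) w i * gam0 (a i) (beta i) u.

Let cdf_prim u : FX u = prim f1 u.
Proof.
rewrite hFX /f1; under eq_bigr do rewrite gamma_cdfE.
have lg i : locint (fun y => w i * gam0 (a i) (beta i) y).
  by apply: locintZ; apply: continuous_locint; exact: gam0_continuous.
suff H (s : seq 'I_n) : locint (fun y => \sum_(i <- s) w i * gam0 (a i) (beta i) y) /\
    \sum_(i <- s) prim (fun y => w i * gam0 (a i) (beta i) y) u =
    prim (fun y => \sum_(i <- s) w i * gam0 (a i) (beta i) y) u.
  by case: (H (index_enum _)).
elim: s => [|i s [ls IH]].
  split.
    under eq_fun do rewrite big_nil.
    by apply: continuous_locint => y; exact: cvg_cst.
  rewrite big_nil; under eq_prim do rewrite big_nil.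
  by rewrite /prim /Rintegral integral0.
split; first by under eq_fun do rewrite big_cons; exact: locintD.
by rewrite big_cons IH -primD//; apply: eq_prim => y _; rewrite big_cons.
Qed.

(** The mean is the integral of the tail over the half-line. With the net profit condition this
    bounds the kernel mass by [kappa * mu < 1]. *)
Let prim_ccdf_mean u : prim (fun y => 1 - FX y) u <= mu.
Proof.
have mX0 : measurable_fun setT (X 0%N : T -> R) by exact: measurable_funP.
(* Claims are positive almost surely only; truncation at 0 makes the variable nonnegative everywhere
   without changing the mean or the tail on [[0, +oo[]. *)
have mXp : measurable_fun setT (fun x => Num.max (X 0%N x) 0).
  by apply: measurable_maxr => //; exact: measurable_cst.
pose X' : {RV P >-> R} := mfun_Sub (mem_set mXp).
have EX : ('E_P[X'] = mu%:E)%E.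
  rewrite -(risk_claims_mean hmodel) !unlock; apply: ae_eq_integral => //.
  - exact/measurable_EFinP.
  - exact/measurable_EFinP.
  - apply: filterS (risk_claims_pos hmodel 0) => x Xx _ /=.
    by congr EFin; rewrite /X'/=; have /max_idPl := ltW Xx.
have X'0 x : 0 <= X' x by rewrite /X'/= le_max lexx orbT.
have mF : measurable_fun `[0, u] (fun y => 1 - FX y).
  apply: measurable_funB; first exact: measurable_cst.
  exact: measurable_funTS (measurable_claim_cdf hmodel).
have F01 := claim_cdf01 hmodel.
have cE r : 0 <= r -> ccdf X' r = (1 - FX r)%:E.
  move=> r0; rewrite ccdf_1_cdf EFinB; congr (_ - _)%E.
  rewrite -(claim_cdf hmodel 0) /cdf /distribution /pushforward; congr (P _).
  apply/seteqP; split => x /=; rewrite in_itv/= ge_max ?r0 ?andbT//.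
have ub : (\int[leb]_(y in `[0%R, u]) (1 - FX y)%:E <= mu%:E)%E.
  rewrite -EX ge0_expectation_ccdf//.
  rewrite [leRHS](@eq_integral _ _ _ leb _ (fun y => (1 - FX y)%:E)); last first.
    by move=> y; rewrite inE/= in_itv/= andbT => /cE.
  apply: ge0_subset_integral => //.
  - apply/measurable_EFinP/measurable_funTS; apply: measurable_funB; first exact: measurable_cst.
    exact: measurable_claim_cdf hmodel.
  - by move=> y _; rewrite lee_fin subr_ge0; case/andP: (F01 y).
  - by apply: subset_itvl; rewrite bnd_simp.
have ui : leb.-integrable `[0, u] (EFin \o (fun y => 1 - FX y)).
  apply: (@itv_bounded_integrable _ _ _ _ 1) => // y _.
  by have := F01 y; rewrite ler_norml; lra.
by rewrite -lee_fin /prim /Rintegral fineK//; exact: integrable_fin_num.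
Qed.

Let prim_expRNE t (u : R) : 0 < t -> 0 <= u ->
  prim (fun y => expR (- t * y)) u = t^-1 - t^-1 * expR (- t * u).
Proof.
move=> t0 u0.
have [||||_ ->//] := @singular_FTC R (fun y => expR (- t * y)) (fun y => - t^-1 * expR (- t * y)).
- by move=> y; apply: cvgMr; exact: continuous_expRM.
- move=> y y0; apply: is_derive_eq; rewrite /GRing.scale/=; field.
  by rewrite gt_eqF.
- by move=> y _; exact: continuous_expRM.
- by move=> y _; exact: expR_ge0.
by rewrite mulr0 expR0; ring.
Qed.

(** Integrating the density bound over [[u, M]] bounds [FX M - FX u] by
    [K / theta * expR (- theta * u)]; then [M] tends to infinity and [FX M] to 1, as for any
    distribution function. *)
Let ccdf_decay theta K : 0 < theta -> 0 <= K ->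
  (forall u, 0 <= u -> `|f1 u| * expR (theta * u) <= K) ->
  forall u, 0 <= u -> (1 - FX u) * expR (theta * u) <= K / theta.
Proof.
move=> t0 K0 hK u u0.
have cf : continuous f1.
  have [theta' _ ht'] := theta_ex.
  exact: (decaying_continuous (decaying_sum (fun i => decayingZ (w i) (decaying_gam (a0 i) (ht' i))))).
have lf := continuous_locint cf.
have le := locintZ K (@locint_expRN R theta).
have step M : u <= M -> FX M <= FX u + K / theta * expR (- theta * u).
  move=> uM; have M0 := le_trans u0 uM.
  rewrite !cdf_prim /prim (Rintegral_itv_split u0 uM (lf M)) lerD2l.
  apply: (@le_trans _ _ (\int[leb]_(y in `[u, M]) (K * expR (- theta * y)))).
    apply: le_Rintegral => //.
    + by apply: integrableS (lf M) => //; apply: subset_itvr; rewrite bnd_simp.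
    + by apply: integrableS (le M) => //; apply: subset_itvr; rewrite bnd_simp.
    move=> y /=; rewrite in_itv/= => /andP[uy _]; apply: le_trans (ler_norm _) _.
    by rewrite mulNr expRN ler_pdivlMr ?expR_gt0// hK// (le_trans u0).
  have := Rintegral_itv_split u0 uM (le M).
  rewrite -[in LHS]/(prim _ _) -[X in _ = X + _]/(prim _ _) !primZ; try exact: locint_expRN.
  rewrite !prim_expRNE// => E.
  have : 0 <= K * (theta^-1 * expR (- theta * M)).
    by rewrite !mulr_ge0 ?expR_ge0// invr_ge0 ltW.
  rewrite -[X in _ -> X <= _]/(\int[leb]_(y in `[u, M]) (K * expR (- theta * y))).
  by move: E; rewrite !mulrBr !mulrA; lra.
have lim1 : FX y @[y --> +oo] --> (1 : R).
  have := cvg_cdfy1 (X 0%N).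
  have -> : cdf (X 0%N) = (fun y => (FX y)%:E) by apply/funext => y; exact: risk_claims_cdf hmodel 0%N y.
  by move/fine_cvg.
have h1 : 1 <= FX u + K / theta * expR (- theta * u).
  apply: (@cvgr_to_le _ (pinfty_nbhs R) _ _ _ _ _ lim1).
  near=> M; apply: step.
  by near: M; apply: nbhs_pinfty_ge; exact: num_real.
rewrite -ler_pdivlMr ?expR_gt0// -expRN -mulNr; lra.
Unshelve. all: by end_near. Qed.

Lemma ruin_regularity :
  let psi := ruin_probability c N X in
  C4 psi /\ exists2 K, 0 <= K & forall u : R, 0 < u ->
    [/\ `|psi^`(2)%classic u| <= K, u * `|psi^`(3)%classic u| <= K &
        u ^+ 2 * `|psi^`(4)%classic u| <= K].
Proof.
move=> psi.
have [theta t0 ht] := theta_ex.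
have df := decaying_sum (fun i => decayingZ (w i) (decaying_gam (a0 i) (ht i))).
have dk := decayingZ (- kappa) df.
set k1 := (fun u => - kappa * _) in dk.
set k2 := (fun u => - kappa * _) in dk.
set k3 := (fun u => - kappa * _) in dk.
have lf : locint f1.
  by apply: continuous_locint; exact: (decaying_continuous df).
have kE u : kappa + prim k1 u = kappa * (1 - FX u).
  by rewrite /k1 primZ// cdf_prim; ring.
have F01 := claim_cdf01 hmodel.
(* Survival has probability 0 for negative capital and may jump at 0; freezing it to the left of 0
   gives a function continuous on the whole line. *)
pose D u := sv (Num.max u 0).
have cD : continuous D.
  have lip u v : 0 <= u -> u <= v -> `|sv v - sv u| <= kappa * (v - u).
    move=> u0 uv; rewrite ger0_norm ?subr_ge0; last exact: (survival_probability_homo hmodel).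
    have vu : 0 <= v - u by rewrite subr_ge0.
    have := survival_probability_lipschitz hmodel u0 vu.
    by have -> : u + (v - u) = v by ring.
  have lip2 u v : 0 <= u -> 0 <= v -> `|sv v - sv u| <= kappa * `|v - u|.
    move=> u0 v0; have [uv|vu] := leP u v.
      by rewrite [X in _ <= _ * X]ger0_norm ?subr_ge0// lip.
    by rewrite distrC [X in _ <= _ * X]distrC [X in _ <= _ * X]ger0_norm ?subr_ge0 ?(ltW vu)// lip// ltW.
  move=> u; apply/cvgrPdist_le => e e0.
  have cm := @continuous_max0 R u.
  near=> v; apply: le_trans (lip2 _ _ _ _) _; rewrite ?le_max ?lexx ?orbT//.
  rewrite -ler_pdivlMl//; near: v.
  by move/cvgrPdist_le : cm; apply; rewrite mulr_gt0 ?invr_gt0.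
have D_eq u : 0 <= u -> D u = sv 0 + convol D (fun u => kappa + prim k1 u) u.
  move=> u0; have /max_idPl E := u0; rewrite /D E (survival_renewal hmodel u0).
  congr (_ + _).
  have mD : measurable_fun `[0, u] D.
    by apply: locint_measurable; exact: continuous_locint.
  have mk : measurable_fun `[0, u] (fun u => kappa + prim k1 u).
    apply: measurable_funD; first exact: measurable_cst.
    apply: locint_measurable; apply: continuous_locint; apply: prim_continuous.
    by apply: locintZ.
  rewrite -[RHS]/(convol D _ u) convC// /convol -RintegralZl//.
    apply: eq_Rintegral => y; rewrite inE/= in_itv/= => /andP[y0 _].
    by rewrite kE /D; have /max_idPl -> := y0; rewrite mulrA.
  apply: (@itv_bounded_integrable _ _ _ _ 1) => [|y _].
    apply: measurable_funM.
      apply: measurable_funB; first exact: measurable_cst.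
      apply: (@measurableT_comp _ _ _ _ _ _ FX); first exact: measurable_claim_cdf hmodel.
      by apply: measurable_funB => //; exact: measurable_id.
    by apply: nondecreasing_measurable => //; exact: (survival_probability_homo hmodel).
  have /andP[? ?] := survival_probability01 hmodel y.
  have /andP[h1 h2] := F01 (u - y).
  by rewrite ger0_norm ?mulr_ge0 ?subr_ge0// mulr_ile1 ?subr_ge0// lerBlDr lerDl.
have k_ge0 u : 0 <= u -> 0 <= kappa + prim k1 u.
  move=> _; rewrite kE mulr_ge0 ?(ltW kappa0)// subr_ge0; by case/andP: (F01 u).
have k_decay : exists2 K, 0 <= K & forall u, 0 <= u ->
    (kappa + prim k1 u) * expR (theta * u) <= K.
  have [K K0 hK] := decaying_bound1 df.
  exists (kappa * (K / theta)); first by apply: mulr_ge0; [exact: ltW|exact: divr_ge0 K0 (ltW t0)].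
  by move=> u u0; rewrite kE -mulrA; apply: ler_wpM2l; [exact: ltW|exact: (ccdf_decay t0 K0 hK)].
have k_int u : prim (fun u => kappa + prim k1 u) u <= kappa * mu.
  under eq_prim do rewrite kE.
  rewrite primZ; first by rewrite ler_wpM2l ?(ltW kappa0)// prim_ccdf_mean.
  move=> v; apply: (@itv_bounded_integrable _ _ _ _ 1).
    apply: measurable_funB; first exact: measurable_cst.
    exact: measurable_funTS (measurable_claim_cdf hmodel).
  by move=> y _; have := F01 y; rewrite ler_norml; lra.
have phi1 : kappa * mu < 1.
  by have := risk_net_profit hmodel; rewrite mulrAC.
have [z1 [z2 [z3 [z4 [[d1 d2 d3 d4 c4] [K K0 hK]]]]]] := renewal_regularity t0 (ltW kappa0)
  dk k_ge0 k_decay k_int phi1 cD D_eq.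
pose z (k : nat) : R -> R := match k with 0%N => (fun u => 1 - D u) | 1%N => (fun u => - z1 u)
  | 2%N => (fun u => - z2 u) | 3%N => (fun u => - z3 u) | _ => (fun u => - z4 u) end.
have psi0 u : 0 <= u -> psi u = z 0%N u.
  move=> u0; rewrite /psi (ruin_probabilityE hmodel) /z /D.
  by have /max_idPl -> := u0.
have dz k (u : R) : (k < 4)%N -> 0 < u -> is_derive u (1 : R) (z k) (z k.+1 u).
  have dN (g : R -> R) l : is_derive u (1 : R) g l ->
      is_derive u (1 : R) (fun x => - g x) (- l) by exact: is_deriveN.
  case: k => [|[|[|[|//]]]] _ u0.
  - have dd := d1 u u0.
    by have := is_deriveD (is_derive_cst (1 : R) u (1 : R)) (dN _ _ dd); rewrite add0r.
  - by apply: dN; exact: d2.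
  - by apply: dN; exact: d3.
  - by apply: dN; exact: d4.
have H := @derive1n_pos R psi z 4 (fun u u0 => psi0 u (ltW u0)) dz.
split; last first.
  exists K => // u u0; have [h1 h2 h3] := hK u u0.
  by have [-> _] := H 2%N u isT u0; have [-> _] := H 3%N u isT u0; have [-> _] := H 4%N u isT u0;
    rewrite /z !normrN.
split.
- apply: (@subspace_eq_continuous _ _ _ (fun u => 1 - D u)).
    by move=> u; rewrite inE/= in_itv/= andbT => u0; first [exact: psi0|exact/esym/psi0].
  apply: continuous_subspaceT => u; apply: cvgB; [exact: cvg_cst|exact: cD].
- move=> k u k4 u0; have [_ /(_ k4) [dd _]] := H k u (ltnW k4) u0.
  exact: dd.
- apply: (@subspace_eq_continuous _ _ _ (fun u => - z4 u)).
    by move=> u; rewrite inE/= in_itv/= andbT => u0; have [E4 _] := H 4%N u isT u0; first [exact: E4|exact/esym/E4].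
  apply: continuous_in_subspaceT => u; rewrite inE/= in_itv/= andbT => u0.
  by apply: cvgN; exact: c4.
Unshelve. all: by end_near. Qed.

End gamma_mixture_model.

(** * Weighted Taylor expansion and linear interpolation *)

Section taylor.
Context (R : realType).
Implicit Types (f g h : R -> R) (x y u : R).

Lemma pos_derive_incr f g x y : (forall u, 0 < u -> is_derive u (1 : R) f (g u)) ->
  0 < x -> x <= y -> (forall u, x <= u <= y -> 0 <= g u) -> f x <= f y.
Proof.
move=> fg x0; rewrite le_eqVlt => /predU1P[->//|xy] g0.
have [u||z] := @MVT R f g x y xy.
- by rewrite in_itv/= => /andP[xu _]; apply: fg; exact: lt_trans xu.
- apply: continuous_in_subspaceT => v; rewrite inE/= in_itv/= => /andP[xv _].
  exact: is_derive_continuous (fg v (lt_le_trans x0 xv)).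
rewrite in_itv/= => /andP[xz zy] E; rewrite -subr_ge0 E mulr_ge0 ?subr_ge0 ?(ltW xy)//.
by apply: g0; rewrite !ltW.
Qed.

Lemma pos_derive_sign f g x : (forall u, 0 < u -> is_derive u (1 : R) f (g u)) ->
  0 < x -> f x = 0 -> (forall u, 0 < u -> 0 <= g u) ->
  forall u, 0 < u -> 0 <= (u - x) * f u.
Proof.
move=> fg x0 fx g0 u u0; have [xu|ux] := leP x u.
  rewrite mulr_ge0 ?subr_ge0// -fx (pos_derive_incr fg)// => v /andP[xv _].
  by apply: g0; exact: lt_le_trans xv.
rewrite mulr_le0 ?subr_le0 ?(ltW ux)// -fx (pos_derive_incr fg u0 (ltW ux))//.
by move=> v /andP[uv _]; apply: g0; exact: lt_le_trans uv.
Qed.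

Lemma pos_derive_min f g x : (forall u, 0 < u -> is_derive u (1 : R) f (g u)) ->
  0 < x -> f x = 0 -> (forall u, 0 < u -> 0 <= (u - x) * g u) ->
  forall u, 0 < u -> 0 <= f u.
Proof.
move=> fg x0 fx g0 u u0; have [->|ux] := eqVneq u x; first by rewrite fx.
have {}g0 v : 0 < v -> (v < x -> g v <= 0) /\ (x < v -> 0 <= g v).
  move=> v0; have := g0 v v0; split => vx.
    by rewrite -(@nmulr_rge0 _ (v - x)) ?subr_lt0.
  by rewrite -(@pmulr_rge0 _ (v - x)) ?subr_gt0.
have fc v : 0 < v -> {for v, continuous f}.
  by move=> v0; exact: is_derive_continuous (fg v v0).
move: ux; rewrite neq_lt => /orP[ux|xu].
  have [v||z] := @MVT R f g u x ux.
  - by rewrite in_itv/= => /andP[uv _]; apply: fg; exact: lt_trans uv.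
  - apply: continuous_in_subspaceT => v; rewrite inE/= in_itv/= => /andP[uv _].
    exact: fc (lt_le_trans u0 uv).
  rewrite in_itv/= fx sub0r => /andP[uz zx] E.
  rewrite -oppr_le0 E mulr_le0_ge0 ?subr_ge0 ?(ltW ux)//.
  by apply: (g0 z _).1 => //; exact: lt_trans uz.
have [v||z] := @MVT R f g x u xu.
- by rewrite in_itv/= => /andP[xv _]; apply: fg; exact: lt_trans xv.
- apply: continuous_in_subspaceT => v; rewrite inE/= in_itv/= => /andP[xv _].
  exact: fc (lt_le_trans x0 xv).
rewrite in_itv/= fx subr0 => /andP[xz zu] ->.
rewrite mulr_ge0 ?subr_ge0 ?(ltW xu)//.
by apply: (g0 z _).2 => //; exact: lt_trans xz.
Qed.

(** Four integrations with alternating signs: from [f4 >= 0], the remainder of [f3] has the sign of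
    [u - x], that of [f2] is nonnegative, that of [f1] has the sign of [u - x], that of [f0] is
    nonnegative. *)
Lemma pos_taylor3_ge f0 f1 f2 f3 f4 x :
  (forall u, 0 < u -> is_derive u (1 : R) f0 (f1 u)) ->
  (forall u, 0 < u -> is_derive u (1 : R) f1 (f2 u)) ->
  (forall u, 0 < u -> is_derive u (1 : R) f2 (f3 u)) ->
  (forall u, 0 < u -> is_derive u (1 : R) f3 (f4 u)) ->
  (forall u, 0 < u -> 0 <= f4 u) -> 0 < x ->
  forall u, 0 < u -> f0 x + f1 x * (u - x) + f2 x / 2 * (u - x) ^+ 2
    + f3 x / 6 * (u - x) ^+ 3 <= f0 u.
Proof.
move=> d1 d2 d3 d4 p4 x0.
have s3 : forall u, 0 < u -> 0 <= (u - x) * (f3 u - f3 x).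
  apply: (pos_derive_sign _ x0 _ p4); last by rewrite subrr.
  by move=> u u0; have d := d4 u u0; apply: is_derive_eq; rewrite subr0.
have s2 : forall u, 0 < u -> 0 <= f2 u - (f2 x + f3 x * (u - x)).
  apply: (pos_derive_min _ x0 _ s3); last by rewrite subrr mulr0 addr0 subrr.
  move=> u u0; have d := d3 u u0; apply: is_derive_eq.
  by rewrite /GRing.scale/=; ring.
have s1 : forall u, 0 < u ->
    0 <= (u - x) * (f1 u - (f1 x + f2 x * (u - x) + f3 x / 2 * (u - x) ^+ 2)).
  apply: (pos_derive_sign _ x0 _ s2); last by ring.
  move=> u u0; have d := d2 u u0; apply: is_derive_eq.
  by rewrite /GRing.scale/=; field.
have s0 : forall u, 0 < u -> 0 <= f0 u - (f0 x + f1 x * (u - x) +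
    f2 x / 2 * (u - x) ^+ 2 + f3 x / 6 * (u - x) ^+ 3).
  apply: (pos_derive_min _ x0 _ s1); last by ring.
  move=> u u0; have d := d1 u u0; apply: is_derive_eq.
  by rewrite /GRing.scale/=; field.
by move=> u u0; rewrite -subr_ge0 s0.
Qed.

End taylor.

Section log_remainder.
Context (R : realType).
Implicit Types x y u : R.

Let is_derive_ln u : 0 < u -> is_derive u (1 : R) (@ln R) u^-1.
Proof. exact: is_derive1_ln. Qed.

Lemma is_derive_invr u : 0 < u -> is_derive u (1 : R) (fun v => v^-1) (- (u ^+ 2)^-1).
Proof.
move=> u0; have := @is_deriveV R (fun v => v) u 1 1 _ (is_derive_id _ _).
rewrite gt_eqF// => /(_ isT) d.
by apply: is_derive_eq; rewrite /GRing.scale/= mulr1.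
Qed.

(** The excess of [q * (u - 1) ^+ 4] over [ln_rem], divided by [u ^+ 2] so that the logarithm stands
    alone and the derivative is rational. [q = 1/24] makes that derivative nonnegative; [q = 1/12]
    gives it the sign of [u - 1]. *)
Let rem (q : R) u := (q * (u - 1) ^+ 4 - (u - 1) / 2 - 3 / 4 * (u - 1) ^+ 2
    - (u - 1) ^+ 3 / 6) / u ^+ 2 + ln u / 2.

Let rem1 q : rem q 1 = 0.
Proof. by rewrite /rem subrr !expr0n/= ln1; ring. Qed.

Let is_derive_rem q u : 0 < u -> is_derive u (1 : R) (rem q)
  ((2 * q * (u - 1) ^+ 4 + (4 * q - 1 / 6) * (u - 1) ^+ 3) / u ^+ 3).
Proof.
move=> u0; have dl := is_derive_ln u0; have di := is_derive_invr u0.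
have -> : rem q = (fun v => (q * (v - 1) ^+ 4 - (v - 1) * 2^-1 - 3 / 4 * (v - 1) ^+ 2
    - (v - 1) ^+ 3 * 6^-1) * (v^-1) ^+ 2 + ln v * 2^-1).
  by apply/funext => v; rewrite /rem exprVn.
apply: is_derive_eq; rewrite /GRing.scale/=; field.
by rewrite gt_eqF.
Qed.

Let rem_sign u : 0 < u -> 0 <= (u - 1) * rem 24^-1 u.
Proof.
move: u; apply: (@pos_derive_sign R (rem 24^-1) _ 1 (@is_derive_rem 24^-1)) => // u u0.
rewrite (_ : 4 / 24 - 1 / 6 = 0); last by field.
by rewrite mul0r addr0 divr_ge0 ?exprn_ge0 ?(ltW u0)// mulr_ge0 ?exprn_even_ge0.
Qed.

Let rem_ge0 u : 0 < u -> 0 <= rem 12^-1 u.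
Proof.
move: u; apply: (@pos_derive_min R (rem 12^-1) _ 1 (@is_derive_rem 12^-1)) => // u u0.
rewrite mulrA divr_ge0 ?exprn_ge0 ?(ltW u0)//.
have -> : (u - 1) * (2 / 12 * (u - 1) ^+ 4 + (4 / 12 - 1 / 6) * (u - 1) ^+ 3) =
  6^-1 * (u * (u - 1) ^+ 4) by field.
by apply: mulr_ge0; rewrite ?invr_ge0// mulr_ge0 ?(ltW u0) ?exprn_even_ge0.
Qed.

(** Third-order Taylor remainder at 1 of [- (u ^+ 2 * ln u) / 2]. *)
Definition ln_rem u := - (u ^+ 2 * ln u) / 2 + (u - 1) / 2 + 3 / 4 * (u - 1) ^+ 2
    + (u - 1) ^+ 3 / 6.

(** With [z = u - 1], the remainder is at most [z ^+ 4 / 24] for [z >= 0] and [z ^+ 4 / 12] for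
    [z < 0]. One polynomial covers both: for [-1 < z < 0] the line [e - (1 - e) * z] is above [- z],
    their difference being [e * u]. *)
Lemma ln_rem_le (e u : R) : 0 <= e -> 0 < u ->
  ln_rem u <= ((u - 1) ^+ 4 + (u - 1) ^+ 2 * (e - (1 - e) * (u - 1)) ^+ 2) / 24.
Proof.
move=> e0 u0.
have E q : ln_rem u = q * (u - 1) ^+ 4 - u ^+ 2 * rem q u.
  by rewrite /ln_rem /rem; field; rewrite gt_eqF.
have [u1|u1] := leP 1 u.
  apply: (@le_trans _ _ (24^-1 * (u - 1) ^+ 4)); last first.
    by rewrite [leRHS]mulrC ler_pM2l ?invr_gt0// lerDl mulr_ge0// sqr_ge0.
  rewrite (E 24^-1) gerBl mulr_ge0 ?sqr_ge0//.
  move: u1; rewrite le_eqVlt => /predU1P[<-|u1]; first by rewrite rem1.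
  by have := rem_sign u0; rewrite pmulr_rge0// subr_gt0.
apply: (@le_trans _ _ (12^-1 * (u - 1) ^+ 4)).
  by rewrite (E 12^-1) gerBl mulr_ge0 ?sqr_ge0// rem_ge0.
have h : (1 - u) ^+ 2 <= (e - (1 - e) * (u - 1)) ^+ 2.
  have eu := mulr_ge0 e0 (ltW u0); rewrite ler_pXn2r ?nnegrE//; lra.
have := ler_wpM2l (sqr_ge0 (u - 1)) h; lra.
Qed.

End log_remainder.

Section weighted_taylor.
Context (R : realType).
Implicit Types (x y u : R).

Lemma weighted_taylor_half (f0 f1 f2 f3 f4 : R -> R) (B x : R) :
  (forall u, 0 < u -> is_derive u (1 : R) f0 (f1 u)) ->
  (forall u, 0 < u -> is_derive u (1 : R) f1 (f2 u)) ->
  (forall u, 0 < u -> is_derive u (1 : R) f2 (f3 u)) ->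
  (forall u, 0 < u -> is_derive u (1 : R) f3 (f4 u)) ->
  (forall u, 0 < u -> - B <= u ^+ 2 * f4 u) -> 0 < x ->
  forall u, 0 < u -> f0 x + f1 x * (u - x) + f2 x / 2 * (u - x) ^+ 2
    + f3 x / 6 * (u - x) ^+ 3 - f0 u <= B * x ^+ 2 * ln_rem (u / x).
Proof.
move=> d1 d2 d3 d4 p4 x0 u u0.
(* The added function makes the fourth derivative [f4 v + B / v ^+ 2], which is nonnegative.
   Normalising the logarithm at [x] leaves [x ^+ 2] times a function of [u / x]. *)
have := @pos_taylor3_ge R (fun v => f0 v + B * (- (v ^+ 2 * (ln v - ln x)) / 2))
  (fun v => f1 v + B * (- v * (ln v - ln x) - v / 2))
  (fun v => f2 v + B * (- (ln v - ln x) - 3 / 2))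
  (fun v => f3 v + B * (- v^-1))
  (fun v => f4 v + B * (v ^+ 2)^-1) x _ _ _ _ _ x0 u u0.
rewrite !subrr => H.
suff : f0 x + B * (- (x ^+ 2 * 0) / 2) + (f1 x + B * (- x * 0 - x / 2)) * (u - x)
   + (f2 x + B * (- 0 - 3 / 2)) / 2 * (u - x) ^+ 2
   + (f3 x + B * - x^-1) / 6 * (u - x) ^+ 3 <=
   f0 u + B * (- (u ^+ 2 * (ln u - ln x)) / 2).
  rewrite -subr_ge0 => h; rewrite -subr_ge0; apply: le_trans h _.
  rewrite le_eqVlt; apply/orP; left; apply/eqP.
  by rewrite /ln_rem ln_div ?posrE//; field; rewrite gt_eqF.
apply: H => v v0; have dl := is_derive1_ln v0.
- have d := d1 v v0; apply: is_derive_eq; rewrite /GRing.scale/=; field.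
  by rewrite gt_eqF.
- have d := d2 v v0; apply: is_derive_eq; rewrite /GRing.scale/=; field.
  by rewrite gt_eqF.
- have d := d3 v v0; apply: is_derive_eq; rewrite /GRing.scale/=; ring.
- have d := d4 v v0; have di := is_derive_invr v0; apply: is_derive_eq; rewrite /GRing.scale/=; ring.
- have := p4 v v0; rewrite -(ler_pM2l (_ : 0 < (v ^+ 2)^-1)) ?invr_gt0 ?exprn_gt0//.
  by rewrite mulKf ?sqrf_eq0 ?gt_eqF//; lra.
Qed.

Lemma weighted_taylor (f0 f1 f2 f3 f4 : R -> R) (B e x : R) :
  (forall u, 0 < u -> is_derive u (1 : R) f0 (f1 u)) ->
  (forall u, 0 < u -> is_derive u (1 : R) f1 (f2 u)) ->
  (forall u, 0 < u -> is_derive u (1 : R) f2 (f3 u)) ->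
  (forall u, 0 < u -> is_derive u (1 : R) f3 (f4 u)) ->
  0 <= B -> (forall u, 0 < u -> u ^+ 2 * `|f4 u| <= B) -> 0 <= e -> 0 < x ->
  forall u, 0 < u ->
  `|f0 u - (f0 x + f1 x * (u - x) + f2 x / 2 * (u - x) ^+ 2 + f3 x / 6 * (u - x) ^+ 3)|
  <= B * x ^+ 2 * (((u / x - 1) ^+ 4
       + (u / x - 1) ^+ 2 * (e - (1 - e) * (u / x - 1)) ^+ 2) / 24).
Proof.
move=> d1 d2 d3 d4 B0 p4 e0 x0 u u0.
have hx : B * x ^+ 2 * ln_rem (u / x) <= B * x ^+ 2 * (((u / x - 1) ^+ 4
       + (u / x - 1) ^+ 2 * (e - (1 - e) * (u / x - 1)) ^+ 2) / 24).
  apply: ler_wpM2l; first exact: mulr_ge0 B0 (sqr_ge0 x).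
  by apply: ln_rem_le => //; exact: divr_gt0.
apply: le_trans hx; rewrite ler_norml; apply/andP; split.
  have := weighted_taylor_half d1 d2 d3 d4 (B := B) _ x0 u0.
  suff H v : 0 < v -> - B <= v ^+ 2 * f4 v by move=> /(_ H); lra.
  move=> v0; rewrite lerNl -mulrN; apply: le_trans (p4 v v0).
  by rewrite ler_wpM2l ?sqr_ge0// -normrN ler_norm.
have dN (g : R -> R) l v : is_derive v (1 : R) g l ->
    is_derive v (1 : R) (fun x => - g x) (- l) by exact: is_deriveN.
have := @weighted_taylor_half (fun v => - f0 v) (fun v => - f1 v) (fun v => - f2 v)
  (fun v => - f3 v) (fun v => - f4 v) B x _ _ _ _ _ x0 u u0.
move=> H; suff : - f0 x + - f1 x * (u - x) + - f2 x / 2 * (u - x) ^+ 2 +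
    - f3 x / 6 * (u - x) ^+ 3 - - f0 u <= B * x ^+ 2 * ln_rem (u / x) by lra.
apply: H => v v0; try (apply: dN; by [exact: d1|exact: d2|exact: d3|exact: d4]).
rewrite mulrN lerNl opprK; apply: le_trans (p4 v v0).
by rewrite ler_wpM2l ?sqr_ge0// ler_norm.
Qed.

End weighted_taylor.

Section interpolation.
Context (R : realType).
Implicit Types (f : R -> R) (a b u v x y : R).

(** Mean slopes on [[a, u]] and [[u, b]] are values of the nondecreasing [f1]. Only continuity is
    asked at [a], because the first chord starts at 0. *)
Lemma chord_ge f (f1 f2 : R -> R) a b u : {within `[0, +oo[, continuous f} ->
  (forall v : R, 0 < v -> is_derive v (1 : R) f (f1 v)) ->
  (forall v : R, 0 < v -> is_derive v (1 : R) f1 (f2 v)) ->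
  (forall v, 0 < v -> 0 <= f2 v) -> 0 <= a -> a < u < b ->
  f u * (b - a) <= f a * (b - u) + f b * (u - a).
Proof.
move=> fc d1 d2 p2 a0 /andP[au ub]; have u0 := le_lt_trans a0 au.
have [v||x] := @MVT R f f1 a u au.
- by rewrite in_itv/= => /andP[av _]; apply: d1; exact: le_lt_trans av.
- by apply: continuous_subspaceW fc; exact: subset_itv.
rewrite in_itv/= => /andP[ax xu] Ex.
have [v||y] := @MVT R f f1 u b ub.
- by rewrite in_itv/= => /andP[uv _]; apply: d1; exact: lt_trans uv.
- by apply: continuous_subspaceW fc; apply: subset_itv; rewrite bnd_simp// ltW.
rewrite in_itv/= => /andP[uy yb] Ey.
have xy : f1 x <= f1 y.
  apply: (pos_derive_incr d2 (le_lt_trans a0 ax)); first by rewrite ltW// (lt_trans xu).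
  by move=> v /andP[xv _]; apply: p2; apply: lt_le_trans xv; exact: le_lt_trans ax.
have : (f u - f a) * (b - u) <= (f b - f u) * (u - a).
  rewrite Ex Ey -!mulrA [(b - u) * _]mulrC ler_wpM2r//.
  by rewrite mulr_ge0// subr_ge0 ltW.
lra.
Qed.

Lemma chord_error f (f1 f2 : R -> R) C a b u : {within `[0, +oo[, continuous f} ->
  (forall v : R, 0 < v -> is_derive v (1 : R) f (f1 v)) ->
  (forall v : R, 0 < v -> is_derive v (1 : R) f1 (f2 v)) ->
  (forall v, 0 < v -> `|f2 v| <= C) -> 0 <= a -> a < b -> a <= u < b ->
  `|((u - a) * f b + (b - u) * f a) / (b - a) - f u| <= C / 8 * (b - a) ^+ 2.
Proof.
move=> fc d1 d2 p2 a0 ab /andP[+ ub].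
have ba0 : b - a != 0 by rewrite subr_eq0 gt_eqF.
have C0 : 0 <= C by apply: le_trans (p2 1 _).
rewrite le_eqVlt => /predU1P[<-|au].
  rewrite subrr mul0r add0r mulrAC divff// mul1r subrr normr0.
  by rewrite mulr_ge0 ?divr_ge0 ?sqr_ge0.
have sq : continuous (fun v : R => C / 2 * v ^+ 2).
  by move=> v; apply: cvgMr; exact: exprn_continuous.
(* Adding [C / 2 * v ^+ 2] makes both [f] and [- f] convex; the chord gap of the added parabola is
   [C / 2 * (u - a) * (b - u)]. *)
have key (s : R) : s = 1 \/ s = -1 -> s * (f u * (b - a) - (f a * (b - u) + f b * (u - a))) <=
    C / 2 * ((b - a) * (u - a) * (b - u)).
  move=> hs.
  have := @chord_ge (fun v => C / 2 * v ^+ 2 + s * f v) (fun v => C * v + s * f1 v)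
    (fun v => C + s * f2 v) a b u.
  move=> H; suff : (C / 2 * u ^+ 2 + s * f u) * (b - a) <=
    (C / 2 * a ^+ 2 + s * f a) * (b - u) + (C / 2 * b ^+ 2 + s * f b) * (u - a).
    rewrite -subr_ge0 => h; rewrite -subr_ge0; apply: le_trans h _.
    by rewrite le_eqVlt; apply/orP; left; apply/eqP; field.
  apply: H => //.
  - move=> v; apply: cvgD; first exact: (continuous_subspaceT sq).
    by apply: cvgMr; exact: fc.
  - move=> v v0; have d := d1 v v0; by apply: is_derive_eq; rewrite /GRing.scale/=; field.
  - move=> v v0; have d := d2 v v0; apply: is_derive_eq; rewrite /GRing.scale/=; ring.
  - by move=> v v0; have := p2 v v0; rewrite ler_norml => /andP[]; case: hs => ->; lra.
  - by rewrite au.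
have -> : ((u - a) * f b + (b - u) * f a) / (b - a) - f u =
    - (f u * (b - a) - (f a * (b - u) + f b * (u - a))) / (b - a) by field.
rewrite normrM normfV (ger0_norm (_ : 0 <= b - a)) ?subr_ge0 ?(ltW ab)//.
rewrite ler_pdivrMr ?subr_gt0// normrN.
apply: (@le_trans _ _ (C / 2 * ((b - a) * (u - a) * (b - u)))).
  have := key 1 (or_introl erefl); have := key (-1) (or_intror erefl).
  by rewrite ler_norml mul1r mulN1r => h1 h2; apply/andP; split; lra.
rewrite -subr_ge0.
have -> : C / 8 * (b - a) ^+ 2 * (b - a) - C / 2 * ((b - a) * (u - a) * (b - u)) =
   C / 8 * ((b - a) * (2 * u - a - b) ^+ 2) by field.
by rewrite mulr_ge0 ?divr_ge0// mulr_ge0 ?sqr_ge0// subr_ge0 ltW.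
Qed.

End interpolation.

(** * Laplace transforms and gamma means *)

Section laplace_derivatives.
Context (R : realType).
Local Notation leb := (@lebesgue_measure R).
Implicit Types (g : R -> R) (t u : R).

Lemma continuous_expRNM t : continuous (fun u => expR (- (t * u))).
Proof.
have -> : (fun u => expR (- (t * u))) = (fun u => expR (- t * u)).
  by apply/funext => u; rewrite mulNr.
exact: continuous_expRM.
Qed.

Lemma expRN_integral t : 0 < t ->
  leb.-integrable `[0, +oo[ (EFin \o (fun u => expR (- (t * u)))) /\
  \int[leb]_(u in `[0, +oo[) expR (- (t * u)) = t^-1.
Proof.
move=> t0.
have E : (\int[leb]_(u in `[0%R, +oo[) (expR (- (t * u)))%:E = (t^-1)%:E)%E.
  rewrite (@ge0_continuous_FTC2y _ _ (fun u => - (t^-1 * expR (- (t * u)))) _ 0)//.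
  - by rewrite mulr0 oppr0 expR0 mulr1 EFinN oppeK add0e.
  - apply: continuous_subspaceT => u; exact: continuous_expRNM.
  - rewrite -oppr0 -(mulr0 t^-1); apply: cvgN; apply: cvgMr.
    rewrite (_ : (fun x => expR (- (t * x))) =
               (fun z => expR (- z)) \o (fun z => t * z))//.
    apply: (@cvg_comp _ _ _ _ _ _ (pinfty_nbhs R)); last exact: cvgr_expR.
    exact: gt0_cvgMry.
  - apply: cvgN; apply: cvgMr; apply: cvg_at_right_filter.
    exact: (@continuous_expRNM t 0).
  - move=> u _; rewrite derive1E.
    suff : is_derive u (1 : R) (fun u => - (t^-1 * expR (- (t * u)))) (expR (- (t * u))) by case.
    by apply: is_derive_eq; rewrite /GRing.scale/=; field; rewrite gt_eqF.
have m : measurable_fun (`[0, +oo[%classic : set R) (fun u => expR (- (t * u))).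
  apply: measurable_funTS; apply: continuous_measurable_fun => u.
  exact: continuous_expRNM.
split; last by rewrite /Rintegral E.
apply/integrableP; split; first exact/measurable_EFinP.
under eq_integral do rewrite /= ger0_norm ?expR_ge0//.
by rewrite E ltry.
Qed.

Lemma powM_expRN_le n t u : 0 < t -> 0 <= u ->
  u ^+ n * expR (- (t * u)) <= (2 * n.+1%:R / t) ^+ n * expR (- (t / 2 * u)).
Proof.
move=> t0 u0; move: (ltr0Sn R n) (ler_nat R n n.+1).
set m : R := n.+1%:R; move: m => m m_gt0 nm; have m0 : m != 0 by rewrite gt_eqF.
(* Then [(s * u) ^+ n <= expR (n%:R * s * u) <= expR (t / 2 * u)]; taking [m] as [n + 1] keeps [s]
   meaningful for [n = 0]. *)
pose s := t / (2 * m).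
have s0 : 0 < s by apply: divr_gt0 => //; exact: mulr_gt0.
have h : (s * u) ^+ n <= expR (t / 2 * u).
  apply: (@le_trans _ _ (expR (s * u) ^+ n)).
    apply: lerXn2r; rewrite ?nnegrE ?expR_ge0//; first exact: mulr_ge0 (ltW s0) u0.
    by apply: le_trans (expR_ge1Dx _); rewrite lerDr.
  rewrite -expRM_natl ler_expR mulrA; apply: ler_wpM2r => //.
  have -> : t / 2 = m * s by rewrite /s; field; exact: m0.
  by apply: ler_wpM2r; [exact: ltW|rewrite nm].
have -> : u ^+ n = (2 * m / t) ^+ n * (s * u) ^+ n.
  rewrite -exprMn; congr (_ ^+ _); rewrite /s; field.
  by rewrite m0 gt_eqF.
rewrite -[leLHS]mulrA; apply: ler_wpM2l.
  by apply: exprn_ge0; apply: divr_ge0 (ltW t0); apply: mulr_ge0 (ltW m_gt0).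
apply: le_trans (ler_wpM2r (expR_ge0 _) h) _.
by rewrite -expRD ler_expR; lra.
Qed.

Let mI : measurable (`[0, +oo[%classic : set (measurableTypeR R)).
Proof. exact: measurable_itv. Qed.

Let integrableZ c (f : R -> R) : leb.-integrable `[0, +oo[ (EFin \o f) ->
  leb.-integrable `[0, +oo[ (EFin \o (fun u => c * f u)).
Proof. by move=> i; have := integrableZl mI c i; exact: eq_integrable. Qed.

Let dominated (f h : R -> R) : measurable_fun (`[0, +oo[%classic : set R) f ->
  leb.-integrable `[0, +oo[ (EFin \o h) -> (forall u, 0 <= u -> `|f u| <= h u) ->
  leb.-integrable `[0, +oo[ (EFin \o f).
Proof.
move=> mf ih fh; apply: le_integrable ih => //; first exact/measurable_EFinP.
move=> u /=; rewrite in_itv/= andbT => u0; rewrite lee_fin.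
exact: le_trans (fh u u0) (ler_norm _).
Qed.

Let measurable_powM_expRN n t :
  measurable_fun (`[0, +oo[%classic : set R) (fun u => u ^+ n * expR (- (t * u))).
Proof.
apply: measurable_funM; first exact: measurable_funX.
apply: measurable_funTS; apply: continuous_measurable_fun => u.
exact: continuous_expRNM.
Qed.

Lemma powM_expRN_integrable n t : 0 < t ->
  leb.-integrable `[0, +oo[ (EFin \o (fun u => u ^+ n * expR (- (t * u)))).
Proof.
move=> t0.
have [i _] := expRN_integral (divr_gt0 t0 (ltr0n _ 2)).
apply: (dominated _ (integrableZ ((2 * n.+1%:R / t) ^+ n) i)) => //.
move=> u u0; rewrite ger0_norm ?powM_expRN_le//.
by apply: mulr_ge0; rewrite ?exprn_ge0 ?expR_ge0.
Qed.

Lemma laplace_integrable n t g b : 0 < t -> measurable_fun setT g ->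
  (forall u, `|g u| <= b) ->
  leb.-integrable `[0, +oo[ (EFin \o (fun u => u ^+ n * expR (- (t * u)) * g u)).
Proof.
move=> t0 mg gb; have b0 : 0 <= b by apply: le_trans (gb 0).
apply: (dominated _ (integrableZ b (powM_expRN_integrable n t0))).
  by apply: measurable_funM; last exact: measurable_funTS.
move=> u u0; rewrite normrM mulrC; apply: ler_pM => //.
by rewrite ger0_norm// mulr_ge0 ?exprn_ge0 ?expR_ge0.
Qed.

Lemma is_derive_laplace n t g b : 0 < t -> measurable_fun setT g ->
  (forall u, `|g u| <= b) ->
  is_derive t (1 : R)
    (fun s => \int[leb]_(u in `[0, +oo[) ((- u) ^+ n * expR (- (s * u)) * g u))
    (\int[leb]_(u in `[0, +oo[) ((- u) ^+ n.+1 * expR (- (t * u)) * g u)).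
Proof.
move=> t0 mg gb; have b0 : 0 <= b by apply: le_trans (gb 0).
pose f s u := (- u) ^+ n * expR (- (s * u)) * g u.
(* Dominates the differentiated integrand uniformly for [s] in [](t / 2), (2 * t)[]. *)
pose G u := `|u| ^+ n.+1 * expR (- (t / 2 * u)) * b.
have It : (`](t / 2), (2 * t)[%classic : set R) t by rewrite /= in_itv/=; lra.
have df s u : is_derive s (1 : R) (f ^~ u) ((- u) ^+ n.+1 * expR (- (s * u)) * g u).
  rewrite /f; apply: is_derive_eq; rewrite /GRing.scale/= exprS; ring.
have intf s : (`](t / 2), (2 * t)[%classic : set R) s -> leb.-integrable `[0, +oo[ (EFin \o f s).
  rewrite /= in_itv/= => /andP[ts _].
  have s0 : 0 < s by apply: lt_trans ts; rewrite divr_gt0.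
  have := integrableZ ((-1) ^+ n) (laplace_integrable n s0 mg gb).
  apply: eq_integrable => // u _ /=.
  by rewrite /f [(- u) ^+ _]exprNn !mulrA.
have G0 u : 0 <= G u by rewrite !mulr_ge0 ?exprn_ge0 ?expR_ge0.
have intG : leb.-integrable `[0, +oo[ (EFin \o G).
  have t2 : 0 < t / 2 by rewrite divr_gt0.
  have := integrableZ b (powM_expRN_integrable n.+1 t2).
  apply: eq_integrable => // u; rewrite inE/= in_itv/= andbT => u0.
  by rewrite /G ger0_norm// mulrC.
have dE s u : partial1of2 f s u = (- u) ^+ n.+1 * expR (- (s * u)) * g u.
  by rewrite partial1of2E; case: (df s u).
have Gub s u : (`](t / 2), (2 * t)[%classic : set R) s -> (`[0, +oo[%classic : set R) u -> `|partial1of2 f s u| <= G u.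
  rewrite /= !in_itv/= andbT => /andP[ts _] u0; rewrite dE /G !normrM normrX normrN.
  rewrite (ger0_norm (expR_ge0 _)); apply: ler_pM => //.
  apply: ler_wpM2l; first exact: exprn_ge0.
  by rewrite ler_expR lerN2; apply: ler_wpM2r => //; exact: ltW.
have dv s u : (`](t / 2), (2 * t)[%classic : set R) s -> (`[0, +oo[%classic : set R) u -> derivable (f ^~ u) s 1.
  by move=> _ _; case: (df s u).
split.
  exact: (@derivable_under_integral R _ _ leb f _ mI t _ _ It intf dv G G0 intG Gub).
rewrite -derive1E (@differentiation_under_integral R _ _ leb f _ mI t _ _ It intf dv G G0 intG Gub).
by apply: eq_Rintegral => u _; rewrite dE.
Qed.

Lemma laplace_derive1n n t g b : 0 < t -> measurable_fun setT g ->
  (forall u, `|g u| <= b) ->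
  (laplace g)^`(n)%classic t =
  (-1) ^+ n * \int[leb]_(u in `[0, +oo[) (u ^+ n * expR (- (t * u)) * g u).
Proof.
move=> t0 mg gb.
pose z n s := \int[leb]_(u in `[0, +oo[) ((- u) ^+ n * expR (- (s * u)) * g u).
have [||-> _] := @derive1n_pos R (laplace g) z n _ _ n t (leqnn n) t0.
- move=> s _; apply: eq_Rintegral => u _; by rewrite expr0 mul1r.
- by move=> k s _ s0; exact: is_derive_laplace s0 mg gb.
rewrite -RintegralZl//; last exact: laplace_integrable t0 mg gb.
by apply: eq_Rintegral => u _; rewrite [(- u) ^+ _]exprNn !mulrA.
Qed.

(** The [n]-th derivative of the Laplace transform of 1, which is [s^-1], is computed both under the
    integral and in closed form. *)
Lemma powM_expRN_integral n t : 0 < t ->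
  \int[leb]_(u in `[0, +oo[) (u ^+ n * expR (- (t * u))) = n`!%:R / t ^+ n.+1.
Proof.
move=> t0; have m1 : measurable_fun setT (cst 1 : R -> R) by [].
have b1 (u : R) : `|(cst 1 : R -> R) u| <= 1 by rewrite normr1.
have := laplace_derive1n n t0 m1 b1.
under eq_Rintegral do rewrite mulr1.
move=> E; apply: (mulfI (_ : (-1) ^+ n != 0)); first by rewrite expf_neq0// oppr_eq0.
rewrite -E.
pose z k s : R := (-1) ^+ k * (k`!%:R * (s^-1) ^+ k.+1).
have [||-> _] := @derive1n_pos R (laplace (cst 1)) z n _ _ n t (leqnn n) t0.
- move=> s s0; rewrite /z !mul1r expr1 -(expRN_integral s0).2.
  by apply: eq_Rintegral => u _; rewrite mulr1.
- move=> k s _ s0; rewrite /z; have sn : s != 0 by rewrite gt_eqF.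
  have di : is_derive s (1 : R) (fun v => v^-1 ^+ k.+1)
      (k.+1%:R * s^-1 ^+ k * - (s ^+ 2)^-1).
    have := @is_deriveX R _ (fun v : R => v^-1) k.+1 s 1 _ (is_derive_invr s0).
    by rewrite exprfctE.
  apply: is_derive_eq.
  rewrite factS natrM /GRing.scale/= -exprVn [s^-1 ^+ k.+2]exprS [s^-1 ^+ k.+1]exprS [_ ^+ k.+1]exprS.
  ring.
by rewrite /z exprVn.
Qed.

Lemma Gamma_nat n : Gamma (n.+1%:R : R) = n`!%:R.
Proof.
transitivity (\int[leb]_(u in `]0, +oo[) (u ^+ n * expR (- (1 * u)))).
  apply: eq_Rintegral => u; rewrite inE/= in_itv/= andbT => u0.
  have -> : n.+1%:R - 1 = n%:R :> R by rewrite -natr1 addrK.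
  by rewrite mul1r powR_mulrn// ltW.
rewrite Rintegral_itv_obnd_cbnd.
  by rewrite powM_expRN_integral// expr1n divr1.
apply: integrableS (powM_expRN_integrable n (@ltr01 R)) => //.
by apply: subset_itvr; rewrite bnd_simp.
Qed.

End laplace_derivatives.

(** * Moments of gamma variables and the error at the nodes *)

Section gamma_means.
Context (R : realType).
Local Notation leb := (@lebesgue_measure R).
Implicit Types (g f h : R -> R) (t u b : R).

(** The expectation of [g (S / t)] for a gamma variable [S] of shape [m + 1] and scale 1. *)
Definition gamma_mean m t g : R :=
  t ^+ m.+1 / m`!%:R * \int[leb]_(u in `[0, +oo[) (u ^+ m * expR (- (t * u)) * g u).

Definition gamma_integrable m t g :=
  leb.-integrable `[0, +oo[ (EFin \o (fun u => u ^+ m * expR (- (t * u)) * g u)).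

Let gamma_integrableD m t f h : gamma_integrable m t f -> gamma_integrable m t h ->
  gamma_integrable m t (fun u => f u + h u).
Proof.
move=> i j; have := integrableD _ i j; move=> /(_ (measurable_itv _)).
apply: eq_integrable => // u _ /=.
by rewrite -EFinD -mulrDr.
Qed.

Let gamma_meanD m t f h : gamma_integrable m t f -> gamma_integrable m t h ->
  gamma_mean m t (fun u => f u + h u) = gamma_mean m t f + gamma_mean m t h.
Proof.
move=> i j; rewrite /gamma_mean -mulrDr -RintegralD//; congr (_ * _).
by apply: eq_Rintegral => u _; rewrite mulrDr.
Qed.

Lemma gamma_mean_le m t f h : 0 < t -> gamma_integrable m t f -> gamma_integrable m t h ->
  (forall u, 0 < u -> f u <= h u) -> gamma_mean m t f <= gamma_mean m t h.
Proof.
move=> t0 i j fh; apply: ler_wpM2l.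
  by apply: divr_ge0 => //; apply: exprn_ge0; exact: ltW.
have pos g : gamma_integrable m t g ->
    leb.-integrable `]0, +oo[ (EFin \o (fun u => u ^+ m * expR (- (t * u)) * g u)).
  by move=> k; apply: integrableS k => //; apply: subset_itvr; rewrite bnd_simp.
have i0 := pos _ i; have j0 := pos _ j.
rewrite -!Rintegral_itv_obnd_cbnd//; apply: le_Rintegral => // u /=.
rewrite in_itv/= andbT => u0; apply: ler_wpM2l; last exact: fh.
by apply: mulr_ge0; rewrite ?expR_ge0// exprn_ge0// ltW.
Qed.

Let gamma_monomial m t c j : 0 < t ->
  gamma_integrable m t (fun u => c * u ^+ j) /\
  gamma_mean m t (fun u => c * u ^+ j) = c * ((m + j)`!%:R / m`!%:R) / t ^+ j.
Proof.
move=> t0.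
have E u : u ^+ m * expR (- (t * u)) * (c * u ^+ j) = c * (u ^+ (m + j) * expR (- (t * u))).
  by rewrite exprD; ring.
have i := powM_expRN_integrable (m + j) t0.
split.
  have := integrableZl (measurable_itv _ : measurable (`[0, +oo[%classic : set (measurableTypeR R))) c i.
  by apply: eq_integrable => // u _ /=; rewrite E.
rewrite /gamma_mean; under eq_Rintegral do rewrite E.
rewrite RintegralZl// powM_expRN_integral// -addSn exprD.
have f0 : m`!%:R != 0 :> R by rewrite pnatr_eq0 -lt0n fact_gt0.
have tn k : t ^+ k != 0 by rewrite expf_neq0// gt_eqF.
move: (t ^+ m.+1) (t ^+ j) (tn m.+1) (tn j) (m`!%:R) f0 => p q p0 q0 f f0.
by move: ((m + j)`!%:R) => e; field; rewrite p0 q0 f0.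
Qed.

Lemma gamma_mean_poly m t c0 c1 c2 c3 c4 : 0 < t ->
  let f u := c0 + c1 * u + c2 * u ^+ 2 + c3 * u ^+ 3 + c4 * u ^+ 4 in
  let r : R := m.+1%:R in
  gamma_integrable m t f /\
  gamma_mean m t f = c0 + c1 * r / t + c2 * (r * (r + 1)) / t ^+ 2
    + c3 * (r * (r + 1) * (r + 2)) / t ^+ 3
    + c4 * (r * (r + 1) * (r + 2) * (r + 3)) / t ^+ 4.
Proof.
move=> t0 f r.
have [i0 e0] := gamma_monomial m c0 0 t0.
have [i1 e1] := gamma_monomial m c1 1 t0.
have [i2 e2] := gamma_monomial m c2 2 t0.
have [i3 e3] := gamma_monomial m c3 3 t0.
have [i4 e4] := gamma_monomial m c4 4 t0.
have fE : f = (fun u => c0 * u ^+ 0 + c1 * u ^+ 1 + c2 * u ^+ 2 + c3 * u ^+ 3 + c4 * u ^+ 4).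
  by apply/funext => u; rewrite /f expr0 expr1 mulr1.
have i01 := gamma_integrableD i0 i1.
have i012 := gamma_integrableD i01 i2.
have i0123 := gamma_integrableD i012 i3.
rewrite fE; split; first exact: gamma_integrableD.
rewrite !gamma_meanD// e0 e1 e2 e3 e4 !addnS addn0 !factS !natrM.
have f0 : m`!%:R != 0 :> R by rewrite pnatr_eq0 -lt0n fact_gt0.
have r2 : m.+2%:R = r + 1 by rewrite /r -[in LHS]natr1.
have r3 : m.+3%:R = r + 2 by rewrite -[in LHS]natr1 r2; ring.
have r4 : m.+4%:R = r + 3 by rewrite -[in LHS]natr1 r3; ring.
rewrite r2 r3 r4 -/r; move: (m`!%:R) f0 => F F0; move: r {r2 r3 r4} => r.
by field; rewrite F0 gt_eqF.
Qed.

(** A gamma variable of shape [r] divided by its mean has central moments 0, 1/r, 2/r^2 and 3/r^2 +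
    6/r^3. *)
Lemma gamma_mean_central m t b0 b1 b2 b3 b4 : 0 < t ->
  let r : R := m.+1%:R in
  let f u := b0 + b1 * (u / (r / t) - 1) + b2 * (u / (r / t) - 1) ^+ 2
    + b3 * (u / (r / t) - 1) ^+ 3 + b4 * (u / (r / t) - 1) ^+ 4 in
  gamma_integrable m t f /\
  gamma_mean m t f = b0 + b2 / r + 2 * b3 / r ^+ 2 + b4 * (3 / r ^+ 2 + 6 / r ^+ 3).
Proof.
move=> t0 r f; have r0 : r != 0 by rewrite /r pnatr_eq0.
have t0' : t != 0 by rewrite gt_eqF.
have [] := @gamma_mean_poly m t (b0 - b1 + b2 - b3 + b4)
  ((b1 - 2 * b2 + 3 * b3 - 4 * b4) * (t / r)) ((b2 - 3 * b3 + 6 * b4) * (t / r) ^+ 2)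
  ((b3 - 4 * b4) * (t / r) ^+ 3) (b4 * (t / r) ^+ 4) t0.
rewrite -/r; move: r r0 @f => r r0 f.
set g := (fun u => _ : R); have -> : g = f.
  by apply/funext => u; rewrite /g /f; field; rewrite r0 t0'.
by move=> i ->; split => //; field; rewrite r0 t0'.
Qed.

(** [g] is squeezed between two quartic polynomials in [z], whose means are known from the central
    moments. *)
Lemma gamma_mean_dist m t g b b0 b1 b2 b3 q2 q3 q4 : 0 < t ->
  measurable_fun setT g -> (forall u, `|g u| <= b) ->
  let r : R := m.+1%:R in
  (forall u, 0 < u -> let z := u / (r / t) - 1 in
    `|g u - (b0 + b1 * z + b2 * z ^+ 2 + b3 * z ^+ 3)|
    <= q2 * z ^+ 2 + q3 * z ^+ 3 + q4 * z ^+ 4) ->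
  `|gamma_mean m t g - (b0 + b2 / r + 2 * b3 / r ^+ 2)| <=
   q2 / r + 2 * q3 / r ^+ 2 + q4 * (3 / r ^+ 2 + 6 / r ^+ 3).
Proof.
move=> t0 mg gb r H.
have ig : gamma_integrable m t g := laplace_integrable m t0 mg gb.
have [i1 e1] := @gamma_mean_central m t b0 b1 (b2 + q2) (b3 + q3) q4 t0.
have [i2 e2] := @gamma_mean_central m t b0 b1 (b2 - q2) (b3 - q3) (- q4) t0.
have h1 := gamma_mean_le t0 ig i1; have h2 := gamma_mean_le t0 i2 ig.
rewrite e1 -/r in h1; rewrite e2 -/r in h2; move: (gamma_mean m t g) {e1 e2 i1 i2} h1 h2 => M.
move: r H => r H h1 h2.
have {}H u (u0 : 0 < u) := H u u0.
rewrite ler_norml; apply/andP; split.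
  suff /h2 : forall u, 0 < u -> b0 + b1 * (u / (r / t) - 1) + (b2 - q2) * (u / (r / t) - 1) ^+ 2
    + (b3 - q3) * (u / (r / t) - 1) ^+ 3 + - q4 * (u / (r / t) - 1) ^+ 4 <= g u.
    by move=> {h1 h2}h2; lra.
  move=> u u0; have := H u u0; cbv zeta; move: (u / (r / t) - 1) => z.
  by rewrite ler_norml => /andP[+ _]; lra.
suff /h1 : forall u, 0 < u -> g u <= b0 + b1 * (u / (r / t) - 1) + (b2 + q2) * (u / (r / t) - 1) ^+ 2
    + (b3 + q3) * (u / (r / t) - 1) ^+ 3 + q4 * (u / (r / t) - 1) ^+ 4.
  by move=> {h1 h2}h1; lra.
move=> u u0; have := H u u0; cbv zeta; move: (u / (r / t) - 1) => z.
by rewrite ler_norml => /andP[_]; lra.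
Qed.

Lemma Lstar_gamma_mean m t g b u : 0 < t -> measurable_fun setT g ->
  (forall u, `|g u| <= b) -> t * u = m%:R -> Lstar t g u = gamma_mean m t g.
Proof.
move=> t0 mg gb tu; rewrite /Lstar tu natrK.
rewrite (laplace_derive1n m t0 mg gb) Gamma_nat /gamma_mean.
set I := \int[_]_(_ in _) _; have s : (-1) ^+ m * (-1) ^+ m = 1 :> R.
  by rewrite -exprMn mulN1r opprK expr1n.
move: ((-1) ^+ m) s => e s.
by rewrite -[RHS]mul1r -s; ring.
Qed.

Lemma M2_node_gamma_mean k t g b : 0 < t -> measurable_fun setT g ->
  (forall u, `|g u| <= b) ->
  M2_node t g k.+1 = 2 * gamma_mean k.*2.+1 (2 * t) g - gamma_mean k t g.
Proof.
move=> t0 mg gb; have t2 : 0 < 2 * t by rewrite mulr_gt0.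
rewrite /M2_node /= (@Lstar_gamma_mean k.*2.+1 _ _ _ _ t2 mg gb).
  rewrite (@Lstar_gamma_mean k _ _ _ _ t0 mg gb)//.
  by rewrite mulrC divfK ?gt_eqF// -natr1 addrK.
rewrite mulrC divfK ?gt_eqF// -[X in _ = X]natr1 -muln2 natrM -[k.+1%:R]natr1; ring.
Qed.

Lemma M2_node_error (g g1 g2 g3 g4 : R -> R) b A B t k :
  (forall u, 0 < u -> is_derive u (1 : R) g (g1 u)) ->
  (forall u, 0 < u -> is_derive u (1 : R) g1 (g2 u)) ->
  (forall u, 0 < u -> is_derive u (1 : R) g2 (g3 u)) ->
  (forall u, 0 < u -> is_derive u (1 : R) g3 (g4 u)) ->
  measurable_fun setT g -> (forall u, `|g u| <= b) ->
  (forall u, 0 < u -> u * `|g3 u| <= A) -> (forall u, 0 < u -> u ^+ 2 * `|g4 u| <= B) ->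
  0 < t -> (0 < k)%N ->
  `|M2_node t g k - g (k%:R / t)| <= (A / 6 + 9 / 16 * B) / t ^+ 2.
Proof.
case: k => // k d1 d2 d3 d4 mg gb gA gB t0 _; rewrite (M2_node_gamma_mean k t0 mg gb).
have t2 : 0 < 2 * t by rewrite mulr_gt0.
have B0 : 0 <= B by apply: le_trans (gB 1 _) => //; rewrite mulr_ge0.
pose r : R := k.+1%:R; have r1 : 1 <= r by rewrite ler1n.
have r0 : 0 < r by exact: lt_le_trans r1.
pose x := r / t; have x0 : 0 < x by rewrite divr_gt0.
(* This value of [e] balances the fourth moments at large [k] against the second moments at small [k]. *)
pose e := 3 / (4 * r).
have e0 : 0 <= e by rewrite divr_ge0 ?mulr_ge0 ?(ltW r0).
have T := weighted_taylor d1 d2 d3 d4 B0 gB e0 x0.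
(* The dominating quartic in powers of [z]. Since [e < 1] its cubic coefficient is at most 0, and so
   it lowers the mean. *)
have T' u : 0 < u -> let z := u / x - 1 in
  `|g u - (g x + x * g1 x * z + x ^+ 2 * g2 x / 2 * z ^+ 2 + x ^+ 3 * g3 x / 6 * z ^+ 3)|
  <= B * x ^+ 2 * e ^+ 2 / 24 * z ^+ 2 + (- (B * x ^+ 2 * e * (1 - e) / 12)) * z ^+ 3
     + B * x ^+ 2 * (1 + (1 - e) ^+ 2) / 24 * z ^+ 4.
  move=> u0 /=; have := T u u0.
  have -> : u - x = x * (u / x - 1) by field; rewrite gt_eqF.
  move: (u / x - 1) => z h; apply: le_trans (le_trans _ h) _; last first.
    by rewrite le_eqVlt; apply/orP; left; apply/eqP; field.
  by rewrite le_eqVlt; apply/orP; left; apply/eqP; congr `|_|; field.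
have r2 : k.*2.+2%:R = 2 * r :> R by rewrite /r -doubleS -muln2 natrM mulrC.
have m2 := @gamma_mean_dist k t g b _ _ _ _ _ _ _ t0 mg gb T'.
have /(_ (g x) (x * g1 x) (x ^+ 2 * g2 x / 2) (x ^+ 3 * g3 x / 6)
  (B * x ^+ 2 * e ^+ 2 / 24) (- (B * x ^+ 2 * e * (1 - e) / 12))
  (B * x ^+ 2 * (1 + (1 - e) ^+ 2) / 24)) := @gamma_mean_dist k.*2.+1 (2 * t) g b _ _ _ _ _ _ _ t2 mg gb.
have xE : 2 * r / (2 * t) = x by rewrite /x; field; rewrite gt_eqF.
cbv zeta; rewrite r2 xE => /(_ T') m1; move: m2; rewrite -/r -/x => m2.
have gx : `|x ^+ 3 * g3 x / 6 / r ^+ 2| <= A / 6 / t ^+ 2.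
  have -> : x ^+ 3 * g3 x / 6 / r ^+ 2 = x * g3 x / (6 * t ^+ 2).
    by rewrite /x; field; rewrite !gt_eqF.
  have t6 : 0 < 6 * t ^+ 2 by rewrite mulr_gt0 ?exprn_gt0.
  rewrite normf_div (gtr0_norm t6) -mulrA -invfM normrM (gtr0_norm x0).
  by apply: ler_wpM2r; [rewrite invr_ge0 ltW|exact: gA].
have w_le : r^-1 <= 1 by rewrite invf_le1.
have w_ge : 0 <= r^-1 by rewrite invr_ge0 ltW.
(* Times [B / (24 * t ^+ 2)], the left side is twice the remainder bound for shape [2 * r] plus the
   one for shape [r]; and 27/2 is 24 times 9/16. *)
have key : 2 * r * e ^+ 2 - 6 * e * (1 - e) + (1 + (1 - e) ^+ 2) * (9 / 2 + 15 / 2 / r) <= 27 / 2.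
  have -> : 2 * r * e ^+ 2 - 6 * e * (1 - e) + (1 + (1 - e) ^+ 2) * (9 / 2 + 15 / 2 / r) =
    9 + 39 / 8 * r^-1 - 171 / 32 * r^-1 ^+ 2 + 135 / 32 * r^-1 ^+ 3.
    by rewrite /e; field; rewrite gt_eqF.
  move: (r^-1) w_le w_ge => w w_le w_ge.
  (* The gap in the inequality is 135/32 times the quantity of [h1], plus that of [h2], plus 3/4. *)
  have h1 : 0 <= w ^+ 2 * (1 - w) by rewrite mulr_ge0 ?sqr_ge0 ?subr_ge0.
  have h2 : 0 <= (1 - w) * (15 / 4 - 9 / 8 * w) by apply: mulr_ge0; lra.
  lra.
have Bt : 0 <= B / t ^+ 2 / 24.
  by apply: divr_ge0 => //; apply: divr_ge0 => //; exact: sqr_ge0.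
have q := ler_wpM2l Bt key.
set M := gamma_mean k.*2.+1 _ _ in m1 *; set M' := gamma_mean k _ _ in m2 *.
have E : 2 * M - M' - g x = 2 * (M - (g x + x ^+ 2 * g2 x / 2 / (2 * r)
      + 2 * (x ^+ 3 * g3 x / 6) / (2 * r) ^+ 2))
   - (M' - (g x + x ^+ 2 * g2 x / 2 / r + 2 * (x ^+ 3 * g3 x / 6) / r ^+ 2))
   - x ^+ 3 * g3 x / 6 / r ^+ 2 by field; rewrite gt_eqF.
rewrite -/r -/x E.
apply: le_trans (ler_normB _ _) _; rewrite [leRHS]mulrDl [leRHS]addrC; apply: lerD _ gx.
apply: le_trans (ler_normB _ _) _; rewrite normrM (ger0_norm (ler0n _ 2)).
apply: le_trans (lerD (ler_wpM2l (ler0n _ 2) m1) m2) _.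
apply: le_trans (le_trans q _); rewrite le_eqVlt; apply/orP; left; apply/eqP.
  by rewrite /x; field; rewrite !gt_eqF.
by field; rewrite gt_eqF.
Qed.

End gamma_means.

(** * Supremum norms and the uniform error *)

Section supnorm.
Context (R : realType).
Implicit Types (D : set R) (f : R -> R) (K : R).

Lemma supnorm_le D f K : (forall u, D u -> `|f u| <= K) -> (supnorm D f <= K%:E)%E.
Proof. by move=> fK; apply: ge_ereal_sup => _ [u Du <-]; rewrite lee_fin fK. Qed.

Lemma supnorm_finite D f K : D !=set0 -> (forall u, D u -> `|f u| <= K) ->
  exists2 a, supnorm D f = a%:E & forall u, D u -> `|f u| <= a.
Proof.
move=> [v Dv] fK; have le_sup u : D u -> (`|f u|%:E <= supnorm D f)%E.
  by move=> Du; apply: ereal_sup_ubound; exists u.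
have : (supnorm D f <= K%:E)%E by exact: supnorm_le.
have := le_sup v Dv; case: (supnorm D f) le_sup => [a|//|//] le_sup _ _.
by exists a => // u Du; rewrite -lee_fin le_sup.
Qed.

End supnorm.

Section M2_error.
Context (R : realType).

Lemma C4_is_derive (g : R -> R) (k : nat) (u : R) : C4 g -> (k < 4)%N -> 0 < u ->
  is_derive u (1 : R) (g^`(k)%classic) (g^`(k.+1)%classic u).
Proof.
move=> [_ dg _] k4 u0; split; first exact: dg.
by rewrite derive1nS derive1E.
Qed.

Lemma M2_error (g : R -> R) (b a A B t u : R) : C4 g ->
  measurable_fun setT g -> (forall v, `|g v| <= b) ->
  (forall v, 0 < v -> `|g^`(2)%classic v| <= a) ->
  (forall v, 0 < v -> v * `|g^`(3)%classic v| <= A) ->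
  (forall v, 0 < v -> v ^+ 2 * `|g^`(4)%classic v| <= B) ->
  0 < t -> 0 <= u ->
  `|M2 t g u - g u| <= a / 8 / t ^+ 2 + (A / 6 + 9 / 16 * B) / t ^+ 2.
Proof.
move=> C mg gb ga gA gB t0 u0.
have d1 (v : R) : 0 < v -> is_derive v (1 : R) g (g^`(1)%classic v).
  by move=> v0; have := @C4_is_derive g 0 v C isT v0; rewrite derive1n0.
have d2 (v : R) : 0 < v -> is_derive v (1 : R) (g^`(1)%classic) (g^`(2)%classic v).
  exact: C4_is_derive.
have d3 (v : R) : 0 < v -> is_derive v (1 : R) (g^`(2)%classic) (g^`(3)%classic v).
  exact: C4_is_derive.
have d4 (v : R) : 0 < v -> is_derive v (1 : R) (g^`(3)%classic) (g^`(4)%classic v).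
  exact: C4_is_derive.
have node k : (0 < k)%N -> `|M2_node t g k - g (k%:R / t)| <= (A / 6 + 9 / 16 * B) / t ^+ 2.
  exact: (M2_node_error d1 d2 d3 d4 mg gb gA gB t0).
(* At [k = 0] the operator is exact; that the bound is nonnegative is read off from node 1. *)
have {}node k : `|M2_node t g k - g (k%:R / t)| <= (A / 6 + 9 / 16 * B) / t ^+ 2.
  have [->|k0] := posnP k; last exact: node.
  by rewrite /M2_node eqxx mul0r subrr normr0; apply: le_trans (node 1%N isT).
have [cg _ _] := C.
have tu0 : 0 <= t * u by rewrite mulr_ge0// ltW.
rewrite /M2; have := truncn_itv tu0; move: (Num.truncn _) => k /andP[ku uk].
have tn : t != 0 by rewrite gt_eqF.
have ka : k%:R / t <= u by rewrite ler_pdivrMr// mulrC.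
have ub : u < k.+1%:R / t by rewrite ltr_pdivlMr// mulrC.
have ch := @chord_error R g _ _ a (k%:R / t) (k.+1%:R / t) u cg d1 d2 ga.
have {ch} := ch _ (le_lt_trans ka ub) _.
have -> : k.+1%:R / t - k%:R / t = t^-1 by rewrite -mulrBl -natr1 addrC addKr mul1r.
rewrite ka ub divr_ge0 ?(ltW t0)// => /(_ isT isT) ch.
have N1 := node k.+1; have N0 := node k.
set Nk := M2_node t g k in N0 *; set Nk1 := M2_node t g k.+1 in N1 *.
set D := _ / t ^+ 2 in N0 N1 *.
(* The chord error of [g] itself plus an interpolation of the two node errors, whose weights are
   nonnegative with sum 1. *)
have -> : (t * u - k%:R) * Nk1 + (k.+1%:R - t * u) * Nk - g u =
    (((u - k%:R / t) * g (k.+1%:R / t) + (k.+1%:R / t - u) * g (k%:R / t)) / t^-1 - g u)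
    + ((t * u - k%:R) * (Nk1 - g (k.+1%:R / t)) + (k.+1%:R - t * u) * (Nk - g (k%:R / t))).
  move: (g (k.+1%:R / t)) (g (k%:R / t)) => x y; move: (k.+1%:R) (k%:R) => p q.
  by field.
apply: le_trans (ler_normD _ _) _; apply: lerD.
  by rewrite exprVn in ch.
apply: le_trans (ler_normD _ _) _; rewrite !normrM.
rewrite (ger0_norm (_ : 0 <= t * u - k%:R)) ?subr_ge0//.
rewrite (ger0_norm (_ : 0 <= k.+1%:R - t * u)) ?subr_ge0 ?(ltW uk)//.
have -> : D = (t * u - k%:R) * D + (k.+1%:R - t * u) * D by rewrite -natr1; ring.
by apply: lerD; apply: ler_wpM2l; rewrite ?subr_ge0// ltW.
Qed.

End M2_error.

Theorem corollary3p2 (R : realType) (d : measure_display)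
    (T : measurableType d) (P : probability T R) (lambda c mu : R)
    (FX : R -> R) (N : R -> {RV P >-> nat}) (X : nat -> {RV P >-> R})
    (hmodel : classical_risk_model lambda c mu FX N X)
    (n : nat) (p alpha beta : 'I_n -> R)
    (hp : forall i, 0 < p i) (hp1 : \sum_(i < n) p i = 1)
    (hbeta : forall i, 0 < beta i) (halpha : forall i, 1 <= alpha i)
    (hFX : forall u, FX u = \sum_(i < n) p i * gamma_cdf (alpha i) (beta i) u) :
  let psi := ruin_probability c N X in
  class_D1 psi /\
  forall t : R, 0 < t ->
    let bound : \bar R :=
      ((1 / (8 * t ^+ 2))%:E * supnorm `]0%R, +oo[ (psi^`(2)%classic)
       + (1 / (6 * t ^+ 2))%:E
           * supnorm `]0%R, +oo[ (fun u => (u * psi^`(3)%classic u)%R)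
       + (9 / (16 * t ^+ 2))%:E
           * supnorm `]0%R, +oo[ (fun u => (u ^+ 2 * psi^`(4)%classic u)%R))%E in
    (supnorm `[0%R, +oo[ (fun u => (M2 t psi u - psi u)%R) <= bound)%E /\
    (bound < +oo)%E.
Proof.
move=> psi; have [C [K K0 hK]] := ruin_regularity hmodel hbeta halpha hFX.
have D0 : (`]0%R, +oo[%classic : set R) !=set0 by exists 1; rewrite /= in_itv/= ltr01.
have psiE : psi = (fun u => 1 - survival_probability c N X u).
  by apply/funext => u; exact: (ruin_probabilityE hmodel).
have mpsi : measurable_fun setT psi.
  rewrite psiE; apply: measurable_funB; first exact: measurable_cst.
  by apply: nondecreasing_measurable => //; exact: (survival_probability_homo hmodel).
have bpsi u : `|psi u| <= 1.
  rewrite psiE; have /andP[? ?] := survival_probability01 hmodel u.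
  by rewrite ger0_norm ?subr_ge0// gerBl.
have pos (u : R) : (`]0%R, +oo[%classic : set R) u -> 0 < u by rewrite /= in_itv/= andbT.
have sup2 : forall u : R, (`]0%R, +oo[%classic : set R) u -> `|psi^`(2)%classic u| <= K.
  by move=> u /pos/hK[].
have sup3 : forall u : R, (`]0%R, +oo[%classic : set R) u -> `|u * psi^`(3)%classic u| <= K.
  by move=> u /pos u0; have [_ + _] := hK u u0; rewrite normrM gtr0_norm.
have sup4 : forall u : R, (`]0%R, +oo[%classic : set R) u -> `|u ^+ 2 * psi^`(4)%classic u| <= K.
  by move=> u /pos u0; have [_ _] := hK u u0; rewrite normrM ger0_norm ?sqr_ge0.
(* The suprema become real numbers that bound the weighted derivatives pointwise, which is the form
   [M2_error] takes. *)
have [a2 E2 le2] := supnorm_finite D0 sup2.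
have [a3 E3 le3] := supnorm_finite D0 sup3.
have [a4 E4 le4] := supnorm_finite D0 sup4.
have fin (S : \bar R) a : S = a%:E -> (S < +oo)%E by move=> ->; exact: ltry.
split; first by split; [exact: C|exact: fin E2|exact: fin E4].
move=> t t0 bound.
have comb (S2 S3 S4 : \bar R) (x y z : R) : S2 = a2%:E -> S3 = a3%:E -> S4 = a4%:E ->
    (x%:E * S2 + y%:E * S3 + z%:E * S4 = (x * a2 + y * a3 + z * a4)%:E)%E.
  by move=> -> -> ->.
have boundE := comb _ _ _ (1 / (8 * t ^+ 2)) (1 / (6 * t ^+ 2)) (9 / (16 * t ^+ 2)) E2 E3 E4.
split; last exact: fin boundE.
apply: (le_trans _ (_ : (_ <= bound)%E)); last first.
  by rewrite le_eqVlt; apply/orP; left; apply/eqP/esym; exact: boundE.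
apply: supnorm_le => u; rewrite /= in_itv/= andbT => u0.
have memD (v : R) : 0 < v -> (`]0%R, +oo[%classic : set R) v by rewrite /= in_itv/= andbT.
have := @M2_error R psi 1 a2 a3 a4 t u C mpsi bpsi _ _ _ t0 u0.
have -> : a2 / 8 / t ^+ 2 + (a3 / 6 + 9 / 16 * a4) / t ^+ 2 =
  1 / (8 * t ^+ 2) * a2 + 1 / (6 * t ^+ 2) * a3 + 9 / (16 * t ^+ 2) * a4.
  by field; rewrite gt_eqF.
apply.
- by move=> v /memD/le2.
- by move=> v v0; have := le3 v (memD v v0); rewrite normrM gtr0_norm.
- by move=> v v0; have := le4 v (memD v v0); rewrite normrM ger0_norm ?sqr_ge0.
Qed.
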